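(* Consider the generic filtering algorithm described in the context, where $\big(\{U_t^n\}_{n=1}^N\big)_{t\geq 1}$ is a sequence of independent sets of $N$ independent $\mathcal{U}(0,1)^2$ random variables. Then there exists a constant $\bar C_1\in(0,\infty)$, independent of $N$, such that for all $N\ge 1$, all $q\in(0,1)$ and all integers $T\geq 1$, with probability at least $1-q$ we have $$\max\Big\{\sup_{t\in\{1,\dots,T\}}\|\hat\eta_t^N-\hat\eta_t\|,\ \sup_{t\in\{1,\dots,T\}}\|\eta_t^N-\eta_t\|\Big\}\leq \bar C_1\,\delta_{N,T,q}^{1/2}\log\big(1+\delta_{N,T,q}^{-1/2}\big),$$ where $\delta_{N,T,q}=N^{-1}\big(1+\log(T/q)\big)$.
   Context: $\mathcal{P}(\mathbb{R})$ is the set of Borel probability measures on $\mathbb{R}$. For $\pi\in\mathcal{P}(\mathbb{R})$, $F_\pi$ is its cumulative distribution function and $F_\pi^{-1}$ the generalized inverse of $F_\pi$. $\|\pi_1-\pi_2\|=\sup_{a\in\mathbb{R}}|F_{\pi_1}(a)-F_{\pi_2}(a)|$ is the Kolmogorov distance. For a measure $\pi$, function $f$ and kernel $K$ on $\mathbb{R}$: $\pi(f)=\int f\,d\pi$, $\pi K(A)=\int K(x,A)\pi(dx)$. Model. Fix $\rho\in\mathbb{R}$, $\sigma,c\in(0,\infty)$ and $\eta_1\in\mathcal{P}(\mathbb{R})$ (constants may depend on these). For $z\in\mathbb{R}$ let $M(z,dx)=\mathcal{N}(\rho z,\sigma^2)$, $G(z)=e^{-cz^2/2}$ and $Q(z,dx)=M(z,dx)G(x)$;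 $Q^1=Q$ and $Q^k(x,A)=\int Q(x,dx')Q^{k-1}(x',A)$ for $k\ge2$. Define $\hat\eta_1(dx)=G(x)\eta_1(dx)/\eta_1(G)$ and, for $t\geq 2$, $\eta_t=\hat\eta_{t-1}M$ and $\hat\eta_t(dx)=\hat\eta_1Q^{t-1}(dx)/\hat\eta_1Q^{t-1}(\mathbb{R})$. Generic filtering algorithm. Given $N\ge1$ and random point sets $\{U_t^n=(U_{t,1}^n,U_{t,2}^n)\}_{n=1}^N$ in $(0,1)^2$, $t\geq 1$, all defined on a probability space $(\Omega,\mathcal{F},\mathbb{P})$: set $X_1^n=F_{\eta_1}^{-1}(U_{1,1}^n)$. For $t\geq 2$ set $\hat X_{t-1}^n=F^{-1}_{\hat\eta_{t-1}^N}(U_{t,1}^n)$ and $X_t^n=F^{-1}_{M(\hat X_{t-1}^n,dx)}(U_{t,2}^n)$. For all $t\geq 1$, $W_t^n=G(X_t^n)/\sum_{m=1}^NG(X_t^m)$, $\eta_t^N=\frac1N\sum_{n=1}^N\delta_{\{X_t^n\}}$ and $\hat\eta_t^N=\sum_{n=1}^NW_t^n\delta_{\{X_t^n\}}$. (Operations with index $n$ are performed for all $n\in\{1,\dots,N\}$.) *)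

(* Defs.v *)
From HB Require Import structures.
From mathcomp Require Import all_boot all_order all_algebra finmap.
From mathcomp Require Import all_classical all_reals all_analysis measurable_realfun.

Set Implicit Arguments.
Unset Strict Implicit.
Unset Printing Implicit Defensive.
Import Order.TTheory GRing.Theory Num.Theory.
Import numFieldNormedType.Exports.

Local Open Scope classical_set_scope.
Local Open Scope ring_scope.

Section distribution_functions.
Context {R : realType}.
Implicit Types (pi : set (measurableTypeR R) -> \bar R) (a u : R).

(* The library's [cdf], unfolded for the identity random variable, so that it
   also applies to the weighted empirical measures below. *)
Definition cdf_of pi a : R := fine (pi `]-oo, a]%classic).

Definition quantile pi u : R := inf [set a | u <= cdf_of pi a].

Definition kolmogorov_dist pi1 pi2 : R :=
  sup (range (fun a : R => `|cdf_of pi1 a - cdf_of pi2 a|)).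

End distribution_functions.

Definition independent_on d d' (T : measurableType d) (T' : measurableType d')
    (R : realType) (P : probability T R) (I : choiceType) (D : set I)
    (X : I -> T -> T') : Prop :=
  forall (J : {fset I}) (B : I -> set T'),
    [set` J] `<=` D -> (forall i, measurable (B i)) ->
    P (\bigcap_(i in [set` J]) (X i @^-1` B i)) =
    \big[*%E/1%E]_(i <- J) P (X i @^-1` B i).

Section measure_kernel.
Local Open Scope ereal_scope.
Context d d' (X : measurableType d) (Y : measurableType d') (R : realType).
Variables (pi : {measure set X -> \bar R}) (K : R.-ker X ~> Y).

Definition mkernel (A : set Y) : \bar R := \int[pi]_x K x A.

Let mkernel0 : mkernel set0 = 0.
Proof. by apply: integral0_eq => x _; rewrite measure0. Qed.

Let mkernel_ge0 A : 0 <= mkernel A.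
Proof. exact: integral_ge0. Qed.

Let mkernel_sigma_additive : semi_sigma_additive mkernel.
Proof.
move=> F mF tF mUF; rewrite [X in _ --> X](_ : _ =
  \int[pi]_x (\sum_(n <oo) K x (F n))); last first.
  by apply: eq_integral => x _; apply/esym/cvg_lim => //;
    exact: measure_semi_sigma_additive.
apply/cvg_closeP; split.
  by apply: is_cvg_nneseries => n _ _; exact: integral_ge0.
by rewrite closeE// integral_nneseries// => n; exact: measurable_kernel.
Qed.

HB.instance Definition _ := isMeasure.Build _ _ _ mkernel
  mkernel0 mkernel_ge0 mkernel_sigma_additive.

End measure_kernel.

Section model.
Context {R : realType}.
Variables (rho : R) (sigma c : {posnum R}).
Local Notation mR := (measurableTypeR R).

(* [normal_prob] is parameterized by the standard deviation. *)
Definition M (z : mR) : {measure set mR -> \bar R} :=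
  normal_prob (rho * z) sigma%:num.

Let measurable_M (A : set mR) : measurable A ->
  measurable_fun [set: mR] (M ^~ A).
Proof.
move=> mA; rewrite /M /normal_prob.
pose f (xy : mR * mR) : \bar R :=
  ((normal_pdf (rho * xy.1) sigma%:num xy.2)%:E * (\1_A xy.2)%:E)%E.
have f0 xy : (0 <= f xy)%E.
  by rewrite mule_ge0// lee_fin ?normal_pdf_ge0.
have mf : measurable_fun [set: mR * mR] f.
  apply: emeasurable_funM; apply/measurable_EFinP; last first.
    exact: measurableT_comp (measurable_indic mA) _.
  rewrite /normal_pdf gt_eqF//; apply: measurable_funM => //.
  apply: measurableT_comp => //; apply: measurable_funM => //.
  apply: measurableT_comp => //; apply: measurable_funX.
  apply: measurable_funB => //; exact: measurable_funM.
rewrite [X in measurable_fun _ X](_ : _ = fubini_F (@lebesgue_measure R) f).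
  exact: measurable_fun_fubini_tonelli_F.
apply/funext => z; rewrite /fubini_F [LHS]integral_mkcond epatch_indic.
exact: eq_integral.
Qed.

HB.instance Definition _ := isKernel.Build _ _ mR mR R M measurable_M.

Let M1 z : M z [set: mR] = 1%E.
Proof. exact: probability_setT. Qed.

HB.instance Definition _ := Kernel_isProbability.Build _ _ mR mR R M M1.

Definition G (z : R) : R := expR (- (c%:num * z ^+ 2 / 2)).

Lemma measurable_G : measurable_fun [set: mR] G.
Proof.
apply: measurableT_comp => //; apply: measurableT_comp => //.
by apply: measurable_funM => //; apply: measurable_funM.
Qed.

Let G_ge0 x : (0 <= (G x)%:E)%E.
Proof. by rewrite lee_fin expR_ge0. Qed.

Let measurable_EG : measurable_fun [set: mR] (EFin \o G).
Proof. by apply/measurable_EFinP; exact: measurable_G. Qed.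

(* The measure G(x) mu(dx). *)
Section weighted_measure.
Variable mu : {measure set mR -> \bar R}.

Definition Gmeasure (A : set mR) : \bar R := (\int[mu]_(x in A) (G x)%:E)%E.

Let Gmeasure0 : Gmeasure set0 = 0%E.
Proof. exact: integral_set0. Qed.

Let Gmeasure_ge0 A : (0 <= Gmeasure A)%E.
Proof. by apply: integral_ge0 => x _; rewrite lee_fin expR_ge0. Qed.

Let Gmeasure_sigma_additive : semi_sigma_additive Gmeasure.
Proof. exact: semi_sigma_additive_nng_induced. Qed.

HB.instance Definition _ := isMeasure.Build _ _ _ Gmeasure
  Gmeasure0 Gmeasure_ge0 Gmeasure_sigma_additive.
End weighted_measure.

Definition Q (z : mR) : {measure set mR -> \bar R} := Gmeasure (M z).

Let measurable_Q (A : set mR) : measurable A ->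
  measurable_fun [set: mR] (Q ^~ A).
Proof.
move=> mA; rewrite [X in measurable_fun _ X](_ : _ =
    fun z => \int[M z]_x ((EFin \o G) \_ A) x)%E; last first.
  by apply/funext => z; rewrite -integral_mkcond.
apply: (measurable_fun_integral_kernel measurable_M).
- by move=> x; rewrite patchE; case: ifPn => //= _; exact: G_ge0.
- by apply/(measurable_restrictT _ _).1 => //; exact: measurable_funTS.
Qed.

HB.instance Definition _ := isKernel.Build _ _ mR mR R Q measurable_Q.

Let Q_le1 : (ereal_sup [set Q z [set: mR] | z in [set: mR]] <= 1)%E.
Proof.
apply/(sprob_kernelP (fun z A => Q z A)) => z; rewrite /Q /= /Gmeasure -(M1 z).
rewrite -[leRHS]mul1e -integral_cst//; apply: ge0_le_integral => //.
move=> x _; rewrite lee_fin /G -[leRHS]expR0 ler_expR oppr_le0.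
by rewrite divr_ge0// mulr_ge0// sqr_ge0.
Qed.

HB.instance Definition _ := Kernel_isSubProbability.Build _ _ mR mR R Q Q_le1.

(* The iterate Q^k, for k >= 1 (the value at k = 0 is unused). *)
Fixpoint Qiter (k : nat) : R.-spker mR ~> mR :=
  match k with
  | (_.+1 as l).+1 => mkcomp_noparam Q (Qiter l)
  | _ => Q
  end.

Variable eta1 : probability mR R.

(* In the following definitions, as for all time-indexed objects below, t >= 1
   and the value at t = 0 is unused.  The second argument of [mnormalize] is its
   value for measures of mass 0 or +oo, which do not occur here. *)
Definition eta_hat1 : probability mR R := mnormalize (Gmeasure eta1) eta1.

Definition eta_hat (t : nat) : probability mR R :=
  match t with
  | (_.+1 as s).+1 => mnormalize (mkernel eta_hat1 (Qiter s)) eta1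
  | _ => eta_hat1
  end.

Definition eta_pred (t : nat) : {measure set mR -> \bar R} :=
  match t with
  | (_.+1 as s).+1 => mkernel (eta_hat s) M
  | _ => eta1
  end.

Section algorithm.
Variable N : nat.
Implicit Types x : 'I_N -> R.

Definition weight x (n : 'I_N) : R := G (x n) / \sum_(m < N) G (x m).

Definition empirical x : set mR -> \bar R :=
  fun A => (\sum_(n < N) (N%:R^-1)%:E * \d_(x n) A)%E.

Definition weighted_empirical x : set mR -> \bar R :=
  fun A => (\sum_(n < N) (weight x n)%:E * \d_(x n) A)%E.

(* [particles u t n] is X_t^n computed from the point sets u. *)
Fixpoint particles (u : nat -> 'I_N -> R * R) (t : nat) : 'I_N -> R :=
  match t with
  | (_.+1 as s).+1 => fun n =>
      let x_hat := quantile (weighted_empirical (particles u s)) (u t n).1 in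
      quantile (M x_hat) (u t n).2
  | _ => fun n => quantile eta1 (u t n).1
  end.

Definition etaN u t := empirical (particles u t).

Definition eta_hatN u t := weighted_empirical (particles u t).

End algorithm.

End model.

Definition delta {R : realType} (N T : nat) (q : R) : R :=
  N%:R^-1 * (1 + ln (T%:R / q)).

(* Main.v *)
(* Let k > 0 solve k = c + rho^2 k / (1 + k sigma^2) and put h(x) = exp(-k x^2/2).
   Then h is an eigenfunction of the kernel G(x) M(x, dz), and its Doob transform is
   an autoregressive kernel S(x, .) = N(theta x, s^2) with |theta| < 1: writing Phi(mu) for one step
   of the filter, the h-weighted averages mu(h psi) / mu(h) satisfy
   Phi(mu)(h psi) / Phi(mu)(h) = mu(h S psi) / mu(h).  The kernel S contracts the
   class of functions psi with |psi'(x)| <= L exp((k - c/2) x^2/2), and integration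
   by parts bounds mu(h psi) - nu(h psi) by L times the Kolmogorov distance.
   Hence one-step errors are summed geometrically, and the error at any time is at
   most a constant times the largest one-step error, uniformly in time.

   Given the past, the particles at time t + 1 are i.i.d. with law Phi of the
   current empirical measure.  Hoeffding's inequality at the m-quantiles bounds
   the one-step error by 2/m outside an event of probability
   4 m exp(-3N/(8 m^2)).  Taking m of order 1/rate, the factor m is absorbed by
   the logarithm in the rate. *)
Require Import Defs.
From HB Require Import structures.
From mathcomp Require Import all_boot all_order all_algebra finmap.
From mathcomp Require Import all_classical all_reals all_analysis measurable_realfun.
From mathcomp Require Import ring lra.
Set Implicit Arguments.
Unset Strict Implicit.
Unset Printing Implicit Defensive.
Import Order.TTheory GRing.Theory Num.Theory.
Import numFieldNormedType.Exports.
Local Open Scope classical_set_scope.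
Local Open Scope ring_scope.

(** The exponent k - c/2 of the test class balances two demands. It lies below k, so that h psi and
    its derivative are dominated by an integrable Gaussian. It lies above k - c, so that the class
    contains G/h and G/h times the distribution function of the transition, whose derivatives carry
    an extra linear factor. The distribution function of Phi(mu) is a quotient of h-averages of
    these two functions, which leads back to the Kolmogorov distance.

    The obstacle is the division by mu(h), which has no lower bound over all measures and which Phi
    may decrease. One step multiplies it by lam / mu(G), with lam the eigenvalue of h. So it at
    least doubles unless mu(G) exceeds lam/2, and in that case mu has enough mass where G is not
    small to bound mu(h) from below directly. A local error under a threshold e1 then costs at most
    half of the doubled bound, and mu(h) stays bounded below along the perturbed filter. For larger
    errors the theorem is trivial, since the distance never exceeds 1. The threshold and the
    constant depend on eta1 only through eta1(h). *)

(** * Integration against mixtures and densities *)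

Section integral_mkernel.
Local Open Scope ereal_scope.
Context d d' (X : measurableType d) (Y : measurableType d') (R : realType).
Variables (pi : {measure set X -> \bar R}) (K : R.-ker X ~> Y).

Import HBNNSimple.

Let integral_mkernel_nnsfun (f : {nnsfun Y >-> R}) :
  \int[mkernel pi K]_y (f y)%:E = \int[pi]_x \int[K x]_y (f y)%:E.
Proof.
rewrite integralT_nnsfun sintegralE.
under [RHS]eq_integral do rewrite integralT_nnsfun sintegralE.
rewrite ge0_integral_fsum//; last 2 first.
- by move=> r; apply: measurable_funeM; exact: measurable_kernel.
- by move=> r x _; exact: nnsfun_mulemu_ge0.
apply: eq_fsbigr => r _.
have [r0|r0] := leP 0%R r.
  by rewrite ge0_integralZl//; exact: measurable_kernel.
rewrite preimage_nnfun0//.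
rewrite measure0 mule0 integral0_eq// => x _.
by rewrite measure0 mule0.
Qed.

(** For simple functions this is additivity and the definition of [mkernel]; monotone convergence on
    both sides gives the general case. *)
Lemma integral_mkernel (f : Y -> \bar R) :
  (forall y, 0 <= f y) -> measurable_fun [set: Y] f ->
  \int[mkernel pi K]_y f y = \int[pi]_x \int[K x]_y f y.
Proof.
move=> f0 mf; pose f_ := nnsfun_approx measurableT mf.
have lim_f (nu : {measure set Y -> \bar R}) :
    \int[nu]_y f y = limn (fun n => \int[nu]_y (f_ n y)%:E).
  rewrite -monotone_convergence//.
  - by apply: eq_integral => z _; apply/esym/cvg_lim => //=; exact: cvg_nnsfun_approx.
  - by move=> n; exact/measurable_EFinP.
  - by move=> n z _; rewrite lee_fin.
  - by move=> z _ a b ab; rewrite lee_fin; exact/lefP/nd_nnsfun_approx.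
rewrite lim_f; under eq_fun do rewrite integral_mkernel_nnsfun.
under [RHS]eq_integral do rewrite lim_f.
rewrite -monotone_convergence//.
- move=> n; apply: measurable_fun_integral_kernel => //.
  + by move=> U mU; exact: measurable_kernel.
  + by move=> z; rewrite lee_fin.
  + exact/measurable_EFinP.
- by move=> n x _; apply: integral_ge0 => z _; rewrite lee_fin.
- move=> x _ a b ab; apply: ge0_le_integral => //.
  + by move=> z _; rewrite lee_fin.
  + exact/measurable_EFinP.
  + exact/measurable_EFinP.
  + by move=> z _; rewrite lee_fin; exact/lefP/nd_nnsfun_approx.
Qed.

End integral_mkernel.

Section integral_density.
Local Open Scope ereal_scope.
Context d (X : measurableType d) (R : realType).
Variables (mu nu : {measure set X -> \bar R}) (g : X -> R).
Hypotheses (g0 : forall x, (0 <= g x)%R) (mg : measurable_fun [set: X] g).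
Hypothesis nuE : forall A, measurable A -> nu A = \int[mu]_(x in A) (g x)%:E.

(** A measure with density g is the mixture over mu of point masses g x at x, so densities become a
    special case of [integral_mkernel]. *)
Let K (x : X) : {measure set X -> \bar R} := mscale (NngNum (g0 x)) \d_x.

Let measurable_K U : measurable U -> measurable_fun [set: X] (K ^~ U).
Proof.
move=> mU; rewrite /K /mscale/=; apply: emeasurable_funM; first exact/measurable_EFinP.
by rewrite /dirac; apply/measurable_EFinP; exact: measurable_indic.
Qed.

HB.instance Definition _ := isKernel.Build _ _ _ _ R K measurable_K.

Lemma integral_density (f : X -> \bar R) :
  (forall y, 0 <= f y) -> measurable_fun [set: X] f ->
  \int[nu]_x f x = \int[mu]_x (f x * (g x)%:E).
Proof.
move=> f0 mf; rewrite (eq_measure_integral (mkernel mu K)); last first.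
  move=> A mA _; rewrite nuE// /mkernel integral_mkcond/=; apply: eq_integral => x _.
  have -> : K x A = (g x)%:E * \d_x A by [].
  by rewrite patchE diracE; case: ifPn; rewrite (mule1, mule0).
rewrite integral_mkernel//; apply: eq_integral => x _.
by rewrite ge0_integral_mscale//= integral_dirac//= diracT mul1e muleC.
Qed.

Lemma integrable_density (f : X -> R) : measurable_fun [set: X] f ->
  nu.-integrable [set: X] (EFin \o f) <->
  mu.-integrable [set: X] (EFin \o (fun x => f x * g x)%R).
Proof.
move=> mf; have E : \int[nu]_x `|(f x)%:E| = \int[mu]_x `|(f x * g x)%:E|.
  rewrite integral_density//; last by apply: measurableT_comp => //; exact/measurable_EFinP.
  by apply: eq_integral => x _; rewrite EFinM abseM [X in _ = _ * X]gee0_abs ?lee_fin.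
split=> /integrableP[_ h]; apply/integrableP; split.
- by apply/measurable_EFinP; exact: measurable_funM.
- by rewrite -E.
- exact/measurable_EFinP.
- by rewrite E.
Qed.

Lemma Rintegral_density (f : X -> R) : measurable_fun [set: X] f ->
  nu.-integrable [set: X] (EFin \o f) ->
  (\int[nu]_x f x = \int[mu]_x (f x * g x))%R.
Proof.
move=> mf fi; have gi := (integrable_density mf).1 fi.
rewrite /Rintegral; congr fine.
rewrite integralE [RHS]integralE; congr (_ - _).
- transitivity (\int[mu]_x ((EFin \o f)^\+ x * (g x)%:E)).
    by apply: integral_density => //; exact/measurable_funepos/measurable_EFinP.
  by apply: eq_integral => x _; rewrite !funeposE maxe_pMl ?lee_fin// mul0e.
- transitivity (\int[mu]_x ((EFin \o f)^\- x * (g x)%:E)).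
    by apply: integral_density => //; exact/measurable_funeneg/measurable_EFinP.
  apply: eq_integral => x _; rewrite !funenegE maxe_pMl ?lee_fin// mul0e.
  by rewrite /= -EFinM mulNr.
Qed.

End integral_density.

(** * Gaussian functions and normal integrals *)

(** The rate has either sign: negative for the potential and the eigenfunction, positive for growth
    bounds. The lock keeps conversion from unfolding it to [expR]. *)
HB.lock Definition gauss {R : realType} (a x : R) : R := expR (a * x ^+ 2 / 2).

Section gaussian_integrals.
Context {R : realType}.
Implicit Types (a m s x : R).

Lemma gaussE a x : gauss a x = expR (a * x ^+ 2 / 2).
Proof. by rewrite gauss.unlock. Qed.

Lemma gauss_gt0 a x : 0 < gauss a x. Proof. by rewrite gaussE expR_gt0. Qed.

Lemma gauss_ge0 a x : 0 <= gauss a x. Proof. by rewrite gaussE expR_ge0. Qed.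

Lemma gaussD a b x : gauss (a + b) x = gauss a x * gauss b x.
Proof. by rewrite !gaussE -expRD; congr expR; lra. Qed.

Lemma gauss_le1 a x : a <= 0 -> gauss a x <= 1.
Proof.
move=> a0; rewrite gaussE -[leRHS]expR0 ler_expR pmulr_lle0 ?invr_gt0//.
by rewrite mulr_le0_ge0 ?sqr_ge0.
Qed.

Lemma gauss_ge1 a x : 0 <= a -> 1 <= gauss a x.
Proof.
by move=> a0; rewrite gaussE -[leLHS]expR0 ler_expR divr_ge0// mulr_ge0// sqr_ge0.
Qed.

Lemma ler_gauss a b x : a <= b -> gauss a x <= gauss b x.
Proof.
by move=> ab; rewrite !gaussE ler_expR ler_pM2r ?invr_gt0// ler_wpM2r ?sqr_ge0.
Qed.

Lemma ler_gauss_norm a x y :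
  0 <= a -> `|x| <= `|y| -> gauss a x <= gauss a y.
Proof.
move=> a0 xy; rewrite !gaussE ler_expR ler_pM2r ?invr_gt0//; apply: ler_wpM2l => //.
by rewrite -[x ^+ 2]real_normK ?num_real// -[y ^+ 2]real_normK ?num_real// lerXn2r// nnegrE.
Qed.

Lemma is_derive_gauss a x : is_derive x 1 (gauss a) (a * x * gauss a x).
Proof.
rewrite gauss.unlock; apply: (@is_derive_eq _ _ _ _ _ _ _ _ (is_derive1_comp _ _)).
by rewrite /GRing.scale/=; field.
Qed.

Lemma derivable_gauss a x : derivable (gauss a) x 1.
Proof. by apply: ex_derive; exact: is_derive_gauss. Qed.

Lemma continuous_gauss a : continuous (gauss a).
Proof.
move=> x; apply: differentiable_continuous.
by apply/derivable1_diffP; exact: derivable_gauss.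
Qed.

Lemma measurable_gauss a : measurable_fun [set: R] (gauss a).
Proof. by apply: continuous_measurable_fun; exact: continuous_gauss. Qed.

Let tilt_exponent a m s x B : s != 0 -> B != 0 -> a = (1 - B) / s ^+ 2 ->
  a * x ^+ 2 / 2 + - (x - m) ^+ 2 / (s ^+ 2 *+ 2) =
  a * m ^+ 2 / (2 * B) + - (x - m / B) ^+ 2 / (s ^+ 2 / B *+ 2).
Proof. by move=> s0 B0 ->; field; rewrite s0 B0. Qed.

(** Completing the square: tilting by [gauss a] changes the precision 1 / s^2 to B / s^2. Positivity
    of B keeps it a precision, and 1 / sqrt B is the quotient of the normalizing constants. *)
Lemma normal_pdf_tilt a m s x : 0 < s -> 0 < 1 - a * s ^+ 2 ->
  let B := 1 - a * s ^+ 2 in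
  gauss a x * normal_pdf m s x =
  (Num.sqrt B)^-1 * expR (a * m ^+ 2 / (2 * B)) *
  normal_pdf (m / B) (s / Num.sqrt B) x.
Proof.
move=> s0 B0 B; have sB0 : 0 < Num.sqrt B by rewrite sqrtr_gt0.
rewrite !normal_pdfE ?gt_eqF ?divr_gt0// /normal_peak /normal_fun.
have sB2 : Num.sqrt B ^+ 2 = B by rewrite sqr_sqrtr// ltW.
rewrite expr_div_n sB2.
have p0 : 0 <= s ^+ 2 * pi *+ 2.
  by rewrite mulrn_wge0// mulr_ge0 ?sqr_ge0 ?pi_ge0.
have -> : Num.sqrt (s ^+ 2 / B * pi *+ 2) = Num.sqrt (s ^+ 2 * pi *+ 2) / Num.sqrt B.
  rewrite -sqrtrV; last exact: ltW.
  by rewrite -sqrtrM//; congr Num.sqrt; rewrite mulrnAl [_ / B * _]mulrAC.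
rewrite invf_div; set p := Num.sqrt (s ^+ 2 * pi *+ 2).
have -> : (Num.sqrt B)^-1 * expR (a * m ^+ 2 / (2 * B)) *
    (Num.sqrt B / p * expR (- (x - m / B) ^+ 2 / (s ^+ 2 / B *+ 2))) =
    p^-1 * (expR (a * m ^+ 2 / (2 * B)) *
    expR (- (x - m / B) ^+ 2 / (s ^+ 2 / B *+ 2))).
  rewrite mulrACA [_ * (_ / p)]mulrA mulVf ?mul1r// gt_eqF//.
rewrite mulrCA gaussE -!expRD; congr (_ * expR _).
apply: tilt_exponent; rewrite ?gt_eqF//.
by rewrite /B opprB addrC subrK mulfK// expf_neq0// gt_eqF.
Qed.

End gaussian_integrals.

Section normal_integrals.
Context {R : realType}.
Notation leb := (@lebesgue_measure R).
Implicit Types (a m s x : R).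

(** Lebesgue measure is determined by its values on half-open intervals, and translation preserves
    their length. *)
Lemma lebesgue_measureDl m (A : set (measurableTypeR R)) : measurable A ->
  pushforward leb (+%R m : _ -> measurableTypeR R) A = leb A.
Proof.
move=> mA; apply/esym/lebesgue_measure_unique => //=; first exact: measurable_funD.
move=> _ _ [[a b]] _ <-; rewrite /pushforward/=.
have -> : (+%R m : R -> R) @^-1` `]a, b] = `]a - m, b - m]%classic.
  by apply/seteqP; split=> x /=; rewrite !in_itv/= ltrBlDl lerBrDl.
rewrite !lebesgue_measure_itv/= !lte_fin ltrD2r.
by case: ifP => // _; rewrite -!EFinD opprB addrA subrK.
Qed.

Lemma normal_probDl m s (A : set (measurableTypeR R)) : s != 0 -> measurable A ->
  pushforward (normal_prob 0 s) (+%R m : _ -> measurableTypeR R) A =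
  normal_prob m s A.
Proof.
move=> s0 mA.
have mD : measurable_fun [set: R] (+%R m : R -> measurableTypeR R).
  exact: measurable_funD.
rewrite /pushforward /normal_prob/= [RHS]integral_mkcond/=.
rewrite [RHS](eq_measure_integral (pushforward leb (+%R m : _ -> measurableTypeR R))); last first.
  by move=> B mB _; exact/esym/lebesgue_measureDl.
rewrite ge0_integral_pushforward//=; last 2 first.
- apply/(measurable_restrictT _ _).1 => //; apply: measurable_funTS.
  by apply/measurable_EFinP; exact: measurable_normal_pdf.
- by move=> x _; rewrite patchE; case: ifPn => // _; rewrite lee_fin normal_pdf_ge0.
rewrite preimage_setT [LHS]integral_mkcond/=; apply: eq_integral => x _.
rewrite /= !patchE (_ : (x \in _ @^-1` A) = (m + x \in A))//; case: ifPn => // _.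
by rewrite !normal_pdfE// /normal_fun subr0 [m + x]addrC addrK.
Qed.

Lemma integral_normal_prob m s (f : R -> \bar R) :
  (forall x, 0 <= f x)%E -> measurable_fun [set: R] f ->
  (\int[normal_prob m s]_x f x = \int[leb]_x (f x * (normal_pdf m s x)%:E))%E.
Proof.
move=> f0 mf; apply: integral_density => //; first exact: normal_pdf_ge0.
exact: measurable_normal_pdf.
Qed.

Lemma integrable_normal_prob m s (f : R -> R) : measurable_fun [set: R] f ->
  (normal_prob m s).-integrable [set: R] (EFin \o f) <->
  leb.-integrable [set: R] (EFin \o (fun x => f x * normal_pdf m s x)).
Proof.
move=> mf; apply: (@integrable_density _ (measurableTypeR R) R leb (normal_prob m s)) => //.
  exact: normal_pdf_ge0.
exact: measurable_normal_pdf.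
Qed.

Lemma Rintegral_normal_prob m s (f : R -> R) : measurable_fun [set: R] f ->
  (normal_prob m s).-integrable [set: R] (EFin \o f) ->
  \int[normal_prob m s]_x f x = \int[leb]_x (f x * normal_pdf m s x).
Proof.
move=> mf fi; apply: (@Rintegral_density _ (measurableTypeR R) R leb (normal_prob m s)) => //.
  exact: normal_pdf_ge0.
exact: measurable_normal_pdf.
Qed.

Section tilt.
Variables a m s : R.
Hypotheses (s0 : 0 < s) (as1 : 0 < 1 - a * s ^+ 2).
Let B := 1 - a * s ^+ 2.
Let C := (Num.sqrt B)^-1 * expR (a * m ^+ 2 / (2 * B)).

Let C0 : 0 <= C. Proof. by rewrite mulr_ge0 ?expR_ge0// invr_ge0. Qed.

Lemma integral_normal_tilt (f : R -> \bar R) :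
  (forall x, 0 <= f x)%E -> measurable_fun [set: R] f ->
  (\int[normal_prob m s]_x (f x * (gauss a x)%:E) =
   C%:E * \int[normal_prob (m / B) (s / Num.sqrt B)]_x f x)%E.
Proof.
move=> f0 mf; rewrite !integral_normal_prob//; last 2 first.
- by move=> x; rewrite mule_ge0// lee_fin gauss_ge0.
- by apply: emeasurable_funM => //; apply/measurable_EFinP; exact: measurable_gauss.
rewrite -ge0_integralZl//.
- by apply: eq_integral => x _; rewrite -muleA -EFinM normal_pdf_tilt// EFinM muleCA.
- apply: emeasurable_funM => //; apply/measurable_EFinP; exact: measurable_normal_pdf.
- by move=> x _; rewrite mule_ge0// lee_fin normal_pdf_ge0.
Qed.

Lemma integral_normal_gauss :
  (\int[normal_prob m s]_x (gauss a x)%:E = C%:E)%E.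
Proof.
under eq_integral do rewrite -[X in X%:E]mul1r EFinM.
rewrite (integral_normal_tilt (f := cst 1%E))//.
by rewrite integral_cst// mul1e [X in (_ * X)%E]probability_setT mule1.
Qed.

Lemma integrable_normal_tilt (f : R -> R) : measurable_fun [set: R] f ->
  (normal_prob (m / B) (s / Num.sqrt B)).-integrable [set: R] (EFin \o f) ->
  (normal_prob m s).-integrable [set: R] (EFin \o (fun x => f x * gauss a x)).
Proof.
move=> mf /integrableP[_ fi]; apply/integrableP; split.
  by apply/measurable_EFinP; apply: measurable_funM => //; exact: measurable_gauss.
under eq_integral do rewrite /= normrM [X in _ * X]ger0_norm ?gauss_ge0// EFinM.
rewrite (integral_normal_tilt (f := fun x => `|f x|%:E)) ?lte_mul_pinfty//.
by apply/measurable_EFinP; exact: measurableT_comp.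
Qed.

Lemma Rintegral_normal_tilt (f : R -> R) : measurable_fun [set: R] f ->
  (normal_prob (m / B) (s / Num.sqrt B)).-integrable [set: R] (EFin \o f) ->
  \int[normal_prob m s]_x (f x * gauss a x) =
  C * \int[normal_prob (m / B) (s / Num.sqrt B)]_x f x.
Proof.
move=> mf fi.
rewrite !Rintegral_normal_prob//; last 2 first.
- by apply: measurable_funM => //; exact: measurable_gauss.
- exact: integrable_normal_tilt.
rewrite -RintegralZl//; last exact/integrable_normal_prob.
by apply: eq_Rintegral => x _; rewrite -mulrA normal_pdf_tilt// mulrCA.
Qed.

End tilt.

Lemma integrable_normal_shift m s (f : R -> R) : s != 0 ->
  measurable_fun [set: R] f ->
  (normal_prob m s).-integrable [set: R] (EFin \o f) ->
  (normal_prob 0 s).-integrable [set: R] (EFin \o (fun z => f (m + z))).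
Proof.
move=> s0 mf /integrableP[_ fi].
have mD : measurable_fun [set: R] (+%R m : R -> measurableTypeR R).
  exact: measurable_funD.
apply/integrableP; split; first by apply/measurable_EFinP; exact: measurableT_comp.
apply: le_lt_trans fi.
rewrite [leRHS](eq_measure_integral (pushforward (normal_prob 0 s) (+%R m : _ -> measurableTypeR R))); last first.
  by move=> A mA _; exact/esym/normal_probDl.
rewrite ge0_integral_pushforward//=; last first.
  by apply/measurable_EFinP; apply: measurableT_comp.
Qed.

(** Moves the mean from the measure into the integrand, where it can be differentiated under the
    integral sign. *)
Lemma Rintegral_normal_shift m s (f : R -> R) : s != 0 ->
  measurable_fun [set: R] f ->
  (normal_prob m s).-integrable [set: R] (EFin \o f) ->
  \int[normal_prob m s]_x f x = \int[normal_prob 0 s]_z f (m + z).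
Proof.
move=> s0 mf fi.
have mD : measurable_fun [set: R] (+%R m : R -> measurableTypeR R).
  exact: measurable_funD.
suff E : (\int[normal_prob m s]_x (f x)%:E = \int[normal_prob 0 s]_z (f (m + z))%:E)%E.
  by rewrite /Rintegral E.
rewrite [LHS](eq_measure_integral (pushforward (normal_prob 0 s) (+%R m : _ -> measurableTypeR R))); last first.
  by move=> A mA _; exact/esym/normal_probDl.
rewrite integral_pushforward//.
- exact/measurable_EFinP.
- by rewrite preimage_setT; exact: integrable_normal_shift.
Qed.

End normal_integrals.

Lemma measurable_ler d (T : measurableType d) (R : realType) (f g : T -> R) :
  measurable_fun [set: T] f -> measurable_fun [set: T] g ->
  measurable [set x | f x <= g x].
Proof.
move=> mf mg; rewrite -[X in measurable X]setTI.
exact: (measurable_fun_ler mf mg measurableT (Y := [set true])).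
Qed.

Lemma measurable_ltr d (T : measurableType d) (R : realType) (f g : T -> R) :
  measurable_fun [set: T] f -> measurable_fun [set: T] g ->
  measurable [set x | f x < g x].
Proof.
move=> mf mg; rewrite -[X in measurable X]setTI.
exact: (measurable_fun_ltr mf mg measurableT (Y := [set true])).
Qed.

Lemma integrable_bounded d (T : measurableType d) (R : realType)
    (P : probability T R) (D : set T) (f : T -> R) (C : R) : measurable D ->
  measurable_fun D f -> (forall x, D x -> `|f x| <= C) ->
  P.-integrable D (EFin \o f).
Proof.
move=> mD mf fC; apply: (le_integrable mD _ _ (finite_measure_integrable_cst P C mD)).
  exact/measurable_EFinP.
by move=> x Dx /=; rewrite lee_fin (le_trans (fC _ Dx))// ler_norm.
Qed.

(** * Integration by parts against distribution functions *)

Section partial_integration.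
Context {R : realType}.
Notation leb := (@lebesgue_measure R).
Variables (f df w : R -> R) (Cf : R).
Hypothesis fdf : forall x : R, is_derive x 1 f (df x).
Hypothesis cdf : continuous df.
Hypothesis dfw : forall x, `|df x| <= w x.
Hypothesis iw : leb.-integrable [set: R] (EFin \o w).
Hypothesis fC : forall x, `|f x| <= Cf.

Lemma is_derive_continuous : continuous f.
Proof.
move=> x; apply: differentiable_continuous; apply/derivable1_diffP.
exact: ex_derive.
Qed.
Let cf := is_derive_continuous.

Let mf : measurable_fun [set: R] f.
Proof. exact: continuous_measurable_fun. Qed.

Let mdf : measurable_fun [set: R] df.
Proof. exact: continuous_measurable_fun. Qed.

Let FTC x a : x <= a -> (\int[leb]_(u in `[x, a]) (df u)%:E = (f a - f x)%:E)%E.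
Proof.
rewrite le_eqVlt => /predU1P[->|xa].
  by rewrite set_itv1 integral_set1 subrr.
rewrite (continuous_FTC2 xa (F := f)) ?EFinB//.
- by apply: continuous_subspaceT.
- split; first by move=> u _; exact: ex_derive.
  + by apply: cvg_at_right_filter; exact: cf.
  + by apply: cvg_at_left_filter; exact: cf.
- by move=> u _; rewrite derive1E; exact: derive_val.
Qed.

Section one_measure.
Variables (mu : probability (measurableTypeR R) R) (a : R).

Let A := [set p : R * R | p.1 <= p.2 /\ p.2 <= a].
Let K (p : measurableTypeR R * measurableTypeR R) : R := \1_A p * df p.2.

Let mA : measurable (A : set (measurableTypeR R * measurableTypeR R)).
Proof.
pose T : measurableType _ := (measurableTypeR R * measurableTypeR R)%type.
have m1 : measurable [set p : T | (p.1 : R) <= p.2] by exact: measurable_ler.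
have m2 : measurable [set p : T | (p.2 : R) <= a] by exact: measurable_ler.
exact: measurableI.
Qed.

Let mK : measurable_fun [set: measurableTypeR R * measurableTypeR R] K.
Proof.
apply: measurable_funM; first exact: measurable_indic.
exact: measurableT_comp.
Qed.

Let iK : (mu \x leb)%E.-integrable [set: _] (EFin \o K).
Proof.
apply/integrable12ltyP; first exact/measurable_EFinP.
apply: (@le_lt_trans _ _ (\int[mu]_x \int[leb]_u `|(w u)%:E|)%E).
  apply: ge0_le_integral => //.
  - by move=> x _; exact: integral_ge0.
  - apply: (measurable_fun_fubini_tonelli_F (m2 := leb) (abse \o (EFin \o K))) => //.
    + by apply: measurableT_comp => //; exact/measurable_EFinP.
    + by move=> x; exact: abse_ge0.
  move=> x _; apply: ge0_le_integral => //.
  - apply: measurableT_comp => //; apply/measurable_EFinP.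
    exact: (measurableT_comp mK (measurable_pair1 x)).
  - by apply: measurableT_comp => //; case/integrableP: iw.
  move=> u _ /=; rewrite lee_fin normrM (le_trans _ (ler_norm _))//.
  apply: le_trans (dfw u); rewrite ler_piMl// indicE.
  by case: (_ \in _); rewrite ?normr1 ?normr0.
rewrite integral_cst//. rewrite [X in (_ * X)%E]probability_setT mule1.
by case/integrableP: iw.
Qed.

(** Fubini for [df u] on the region x <= u <= a, valid for measures with atoms. Integrating in u
    first gives f a - f x, integrating in x first gives [cdf_of mu u * df u]. *)
Lemma partial_integration :
  \int[mu]_(x in `]-oo, a]) f x =
  f a * cdf_of mu a - \int[leb]_(u in `]-oo, a]) (cdf_of mu u * df u).
Proof.
have mY : measurable (`]-oo, a] : set (measurableTypeR R)) by [].
have fiY : mu.-integrable `]-oo, a] (EFin \o f).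
  by apply: (@integrable_bounded _ _ _ _ _ _ Cf) => //; exact: measurable_funTS.
have := Fubini iK; rewrite /=.
have -> : (\int[mu]_x \int[leb]_y (K (x, y))%:E =
           (f a * cdf_of mu a - \int[mu]_(x in `]-oo, a]) f x)%:E)%E.
  transitivity (\int[mu]_(x in `]-oo, a]) (f a - f x)%:E)%E.
    rewrite [RHS]integral_mkcond; apply: eq_integral => x _.
    rewrite patchE; case: ifPn => [|/negP]; rewrite inE/= in_itv/= => xa.
      rewrite -FTC// [RHS]integral_mkcond; apply: eq_integral => u _.
      rewrite patchE /K indicE; case: ifPn => [|/negP]; rewrite inE/= in_itv/= => ua.
        by rewrite mem_set ?mul1r//=; apply/andP.
      by rewrite memNset ?mul0r//= => /andP.
    rewrite integral0_eq// => u _; rewrite /K indicE memNset ?mul0r//=.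
    by move=> [xu ua]; apply: xa; exact: le_trans ua.
  have -> : (f a * cdf_of mu a - \int[mu]_(x in `]-oo, a]) f x) =
            \int[mu]_(x in `]-oo, a]) (f a - f x).
    rewrite RintegralB//; first by rewrite Rintegral_cst.
    exact: finite_measure_integrable_cst.
  rewrite fineK//; apply: integrable_fin_num => //.
  apply: (@integrable_bounded _ _ _ _ _ _ (Cf + Cf)) => //.
    by apply: measurable_funB => //; exact: measurable_funTS.
  by move=> x _; rewrite (le_trans (ler_normB _ _))// lerD.
have -> : (\int[leb]_y \int[mu]_x (K (x, y))%:E =
           \int[leb]_(u in `]-oo, a]) (cdf_of mu u * df u)%:E)%E.
  rewrite [RHS]integral_mkcond; apply: eq_integral => u _.
  rewrite patchE; case: ifPn => [|/negP]; rewrite inE/= in_itv/= => ua.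
    transitivity (\int[mu]_x (df u * \1_(`]-oo, u] : set R) x)%:E)%E.
      apply: eq_integral => x _; rewrite /K mulrC; congr (_ * _)%:E.
      rewrite !indicE; congr (_%:R); congr nat_of_bool.
      apply/idP/idP; rewrite !inE/= in_itv/=; first by case.
      by move=> xu; split.
    under eq_integral do rewrite EFinM.
    rewrite integralZl//; last first.
      apply: (@integrable_bounded _ _ _ _ _ _ 1) => //.
      by move=> x _; rewrite indicE; case: (_ \in _); rewrite ?normr1 ?normr0.
    rewrite integral_indic// setIT mulrC EFinM /cdf_of fineK//.
    exact: fin_num_measure.
  rewrite integral0_eq// => x _; rewrite /K indicE memNset ?mul0r//=.
  by move=> [xu ?]; exact: ua.
move=> E; rewrite /Rintegral -E/=.
by rewrite opprB addrC subrK.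
Qed.

End one_measure.

Lemma cdf_of_prob (mu : probability (measurableTypeR R) R) a :
  mu `]-oo, a]%classic = (cdf_of mu a)%:E.
Proof. by rewrite /cdf_of fineK//; exact: fin_num_measure. Qed.

Lemma cdf_of_ge0 (mu : probability (measurableTypeR R) R) a : 0 <= cdf_of mu a.
Proof. by rewrite -lee_fin -cdf_of_prob. Qed.

Lemma cdf_of_le1 (mu : probability (measurableTypeR R) R) a : cdf_of mu a <= 1.
Proof. by rewrite -lee_fin -cdf_of_prob probability_le1. Qed.

Lemma cdf_of_nondecreasing (mu : probability (measurableTypeR R) R) :
  {homo cdf_of mu : x y / x <= y}.
Proof.
move=> x y xy; rewrite -lee_fin -!cdf_of_prob le_measure ?inE//.
by apply: subset_itvl; rewrite bnd_simp.
Qed.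

Let integrable_cdf_df (mu : probability (measurableTypeR R) R) a :
  leb.-integrable `]-oo, a] (EFin \o (fun u => cdf_of mu u * df u)).
Proof.
have mY : measurable (`]-oo, a] : set (measurableTypeR R)) by [].
apply: (le_integrable mY _ _ (integrableS measurableT mY (@subsetT _ _) iw)).
  apply: measurable_funTS; apply/measurable_EFinP; apply: measurable_funM => //.
  by apply: nondecreasing_measurable => // x y; exact: cdf_of_nondecreasing.
move=> u _ /=; rewrite lee_fin normrM.
apply: (le_trans _ (ler_norm _)); apply: le_trans (dfw u).
by rewrite ler_piMl// ger0_norm ?cdf_of_ge0// cdf_of_le1.
Qed.

Section two_measures.
Variables (mu nu : probability (measurableTypeR R) R) (e : R).
Hypothesis munu : forall a, `|cdf_of mu a - cdf_of nu a| <= e.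

(** The boundary term costs e * Cf and the remaining integral e times that of w. The truncation at a
    serves the distribution function of the updated measure, where the indicator of the ray cannot
    be differentiated. *)
Lemma partial_integral_dist a :
  `|\int[mu]_(x in `]-oo, a]) f x - \int[nu]_(x in `]-oo, a]) f x| <=
  e * (Cf + \int[leb]_u w u).
Proof.
rewrite !partial_integration.
have dE : (fun u => (cdf_of mu u - cdf_of nu u) * df u) =
    (fun u => cdf_of mu u * df u - cdf_of nu u * df u).
  by apply/funext => u; rewrite mulrBl.
rewrite [X in `|X|](_ : _ = f a * (cdf_of mu a - cdf_of nu a) -
    \int[leb]_(u in `]-oo, a]) ((cdf_of mu u - cdf_of nu u) * df u)); last first.
  by rewrite dE RintegralB//; ring.
have mY : measurable (`]-oo, a] : set (measurableTypeR R)) by [].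
have e0 : 0 <= e by rewrite (le_trans _ (munu 0)).
have iY : leb.-integrable `]-oo, a] (EFin \o (fun u => (cdf_of mu u - cdf_of nu u) * df u)).
  rewrite dE; have := integrableB mY (integrable_cdf_df mu a) (integrable_cdf_df nu a).
  by apply: eq_integrable.
apply: le_trans (ler_normB _ _) _; rewrite [leRHS]mulrDr; apply: lerD.
  by rewrite normrM mulrC ler_pM.
apply: le_trans (le_normr_Rintegral mY iY) _.
rewrite -RintegralZl//.
apply: (@le_trans _ _ (\int[leb]_(u in `]-oo, a]) (e * w u))).
  apply: le_Rintegral => //.
  - by apply: (integrable_norm iY).
  - have := integrableZl mY e (integrableS measurableT mY (@subsetT _ _) iw).
    by apply: eq_integrable.
  - by move=> u _; rewrite normrM ler_pM.
rewrite Rintegral_mkcond; apply: le_Rintegral => //.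
- rewrite -restrict_EFin; apply/integrable_restrict => //.
  rewrite setTI.
  have := integrableZl mY e (integrableS measurableT mY (@subsetT _ _) iw).
  by apply: eq_integrable.
- have := integrableZl measurableT e iw.
  by apply: eq_integrable.
- move=> u _; rewrite patchE; case: ifPn => // _.
  by rewrite mulr_ge0// (le_trans _ (dfw u)).
Qed.

End two_measures.

Lemma cvg_integral_itvNy (mu : probability (measurableTypeR R) R) :
  \int[mu]_(x in `]-oo, n%:R]) f x @[n --> \oo] --> \int[mu]_x f x.
Proof.
have if_ : mu.-integrable [set: R] (EFin \o f).
  by apply: (@integrable_bounded _ _ _ _ _ _ Cf).
apply: fine_cvg; rewrite fineK; last exact: integrable_fin_num.
under eq_fun do rewrite integral_mkcond.
apply: (@dominated_cvg _ _ _ mu _ measurableT _ _ (cst Cf%:E)) => //.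
- move=> n; apply/(measurable_restrictT _ _).1 => //; apply: measurable_funTS.
  exact/measurable_EFinP.
- move=> x _; apply: cvg_near_cst; near=> n.
  rewrite patchE mem_set//= in_itv/=; near: n.
  exact: nbhs_infty_ger.
- exact: finite_measure_integrable_cst.
- move=> n x _; rewrite patchE; case: ifPn => _; rewrite ?lee_fin//.
  by rewrite normr0 (le_trans _ (fC 0)).
Unshelve. all: by end_near. Qed.

(** The truncated bound is uniform in a, so it passes to the limit. *)
Lemma integral_dist (mu nu : probability (measurableTypeR R) R) (e : R) :
  (forall a, `|cdf_of mu a - cdf_of nu a| <= e) ->
  `|\int[mu]_x f x - \int[nu]_x f x| <= e * (Cf + \int[leb]_u w u).
Proof.
move=> munu.
have cv : `|\int[mu]_(x in `]-oo, n%:R]) f x - \int[nu]_(x in `]-oo, n%:R]) f x|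
    @[n --> \oo] --> `|\int[mu]_x f x - \int[nu]_x f x|.
  by apply: cvg_norm; apply: cvgB; exact: cvg_integral_itvNy.
apply: (cvgr_to_le cv); near=> n.
exact: partial_integral_dist.
Unshelve. all: by end_near. Qed.

End partial_integration.

(** * Test functions of controlled Gaussian growth *)

Section tame_functions.
Context {R : realType}.
Notation leb := (@lebesgue_measure R).
Variables (k c : R).
Hypotheses (c0 : 0 < c) (ck : c <= k).

Let g := k - c / 2.
Let g' := k - c / 4.

Let k0 : 0 < k. Proof. exact: lt_le_trans ck. Qed.
Let g0 : 0 < g. Proof. by rewrite /g; move: c0 ck; lra. Qed.

(** The derivative is part of the data, and its continuity is what the fundamental theorem of
    calculus asks for. Only the derivative is bounded, so L acts as a seminorm that vanishes on
    constants. *)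
Definition tame (L : R) (psi dpsi : R -> R) :=
  [/\ forall x : R, is_derive x 1 psi (dpsi x), continuous dpsi &
      forall x, `|dpsi x| <= L * gauss g x].

(** Trades a polynomial factor for an increase c / 4 of the growth rate, by 1 + y <= exp y. *)
Lemma gauss_poly x : 2 + x ^+ 2 <= (2 + 8 / c) * gauss (c / 4) x.
Proof.
have h1 : 1 + c / 4 * x ^+ 2 / 2 <= gauss (c / 4) x.
  by rewrite gaussE; exact: expR_ge1Dx.
have h2 : 0 <= x ^+ 2 by exact: sqr_ge0.
have h3 : 0 < 8 / c by rewrite divr_gt0.
apply: le_trans (ler_wpM2l _ h1); last by move: h3; lra.
rewrite (_ : (2 + 8 / c) * _ = 2 + 8 / c + x ^+ 2 + c / 4 * x ^+ 2); last first.
  by field; rewrite gt_eqF.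
rewrite -subr_ge0 (_ : _ - _ = 8 / c + c / 4 * x ^+ 2); last by ring.
by apply: addr_ge0; [exact: ltW|rewrite mulr_ge0// divr_ge0// ltW].
Qed.

Lemma gauss_sqr x : x ^+ 2 <= 8 / c * gauss (c / 4) x.
Proof.
have h1 : 1 + c / 4 * x ^+ 2 / 2 <= gauss (c / 4) x.
  by rewrite gaussE; exact: expR_ge1Dx.
have h3 : 0 < 8 / c by rewrite divr_gt0.
apply: le_trans (ler_wpM2l (ltW h3) h1).
rewrite (_ : 8 / c * _ = 8 / c + x ^+ 2); last by field; rewrite gt_eqF.
by rewrite lerDr ltW.
Qed.

Lemma abs_le1Dsqr (x : R) : `|x| <= 1 + x ^+ 2.
Proof.
rewrite -[x ^+ 2]real_normK ?num_real//; have := normr_ge0 x.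
by set y := `|x| => y0; nra.
Qed.

Lemma gauss_half x : gauss (- k) x * gauss g x = gauss (- (c / 2)) x.
Proof. by rewrite -gaussD; congr gauss; rewrite /g; lra. Qed.

Lemma gauss_quarter x :
  gauss (- (c / 2)) x * gauss (c / 4) x = gauss (- (c / 4)) x.
Proof. by rewrite -gaussD; congr gauss; lra. Qed.

Lemma integrable_gaussN a : 0 < a ->
  leb.-integrable [set: R] (EFin \o (gauss (- a) : R -> R)).
Proof.
move=> a0; pose s := (Num.sqrt a)^-1.
have s0 : s != 0 by rewrite invr_eq0 gt_eqF// sqrtr_gt0.
have := integrableZl measurableT (normal_peak s)^-1 (integrable_normal_pdf 0 s).
apply: eq_integrable => // x _ /=.
rewrite normal_pdfE// -EFinM mulKf ?gt_eqF ?normal_peak_gt0//.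
rewrite /normal_fun gaussE subr0 /s exprVn sqr_sqrtr ?ltW//.
by rewrite -[_ *+ 2]mulr_natr invfM invrK !mulNr [X in - (X)]mulrA [X in - (X / _)]mulrC.
Qed.

Section one_function.
Variables (L : R) (psi dpsi : R -> R).
Hypothesis psiL : tame L psi dpsi.

Lemma tame_ge0 : 0 <= L.
Proof.
case: psiL => _ _ /(_ 0) h.
have := le_trans (normr_ge0 _) h.
by rewrite pmulr_lge0// gauss_gt0.
Qed.

Lemma tame_continuous : continuous psi.
Proof. by case: psiL => d _ _; exact: is_derive_continuous d. Qed.

Lemma tame_measurable : measurable_fun [set: R] psi.
Proof. by apply: continuous_measurable_fun; exact: tame_continuous. Qed.

(** Mean value theorem: the intermediate point is closer to 0 than x, where [gauss g] is smaller. *)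
Lemma tame_growth x : `|psi x - psi 0| <= L * `|x| * gauss g x.
Proof.
case: psiL => dp cp bp.
have gmono y : `|y| <= `|x| -> gauss g y <= gauss g x.
  by apply: ler_gauss_norm; exact: ltW.
have [x0|x0|->] := ltgtP x 0; last by rewrite subrr !normr0 mulr0 mul0r.
- have [y] := MVT x0 (fun z _ => dp z) (continuous_subspaceT tame_continuous).
  rewrite in_itv/= => /andP[xy y0] E.
  rewrite distrC E sub0r normrM normrN mulrAC ler_wpM2r//.
  apply: le_trans (bp y) _; rewrite ler_wpM2l ?tame_ge0// gmono//.
  by rewrite !ltr0_norm// lerN2 ltW.
- have [y] := MVT x0 (fun z _ => dp z) (continuous_subspaceT tame_continuous).
  rewrite in_itv/= => /andP[y0 yx] E.
  rewrite E subr0 normrM mulrAC ler_wpM2r//.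
  apply: le_trans (bp y) _; rewrite ler_wpM2l ?tame_ge0// gmono//.
  by rewrite !gtr0_norm// ltW.
Qed.

End one_function.
End tame_functions.

(** * Integrals of test functions weighted by the eigenfunction *)

Section tame_weighted.
Context {R : realType}.
Notation leb := (@lebesgue_measure R).
Variables (k c : R).
Hypotheses (c0 : 0 < c) (ck : c <= k).
Let g := k - c / 2.
Let k0 : 0 < k. Proof. exact: lt_le_trans ck. Qed.

(* For L = 1, [2 + 8 / c] bounds [gauss (- k) * psi], and its derivative is bounded
   by the prefactor of the integral times [gauss (- (c / 4))]. *)
Definition tame_const : R :=
  2 + 8 / c + (1 + k + 2 * k * (8 / c)) * \int[leb]_x gauss (- (c / 4)) x.

Let W := 1 + k + 2 * k * (8 / c).

Let W0 : 0 < W.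
Proof.
have := divr_gt0 (ltr0n R 8) c0; have := k0; rewrite /W; set y := 8 / c; nra.
Qed.

Lemma tame_const_ge0 : 0 <= tame_const.
Proof.
apply: addr_ge0; first by rewrite addr_ge0// divr_ge0// ltW.
by rewrite mulr_ge0 ?(ltW W0)//; apply: Rintegral_ge0 => x _; exact: gauss_ge0.
Qed.

Section one_function.
Variables (L : R) (psi dpsi : R -> R).
Hypotheses (psiL : tame k c L psi dpsi) (psi0 : `|psi 0| <= L).

Lemma tame_bound x : `|psi x| <= L * (1 + `|x|) * gauss g x.
Proof.
have L0 := tame_ge0 psiL.
rewrite -(subrK (psi 0) (psi x)) (le_trans (ler_normD _ _))//.
apply: le_trans (lerD (tame_growth c0 ck psiL x) psi0) _.
rewrite -/g -mulrA mulrDr mulr1 mulrDl -mulrA addrC lerD2r ler_peMr//.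
by apply: gauss_ge1; rewrite /g; move: c0 ck; lra.
Qed.

Let w x := L * W * gauss (- (c / 4)) x.

Let bound_f x : `|gauss (- k) x * psi x| <= L * (2 + 8 / c).
Proof.
have L0 := tame_ge0 psiL.
rewrite normrM ger0_norm ?gauss_ge0//.
apply: le_trans (ler_wpM2l (gauss_ge0 _ _) (tame_bound x)) _.
rewrite mulrCA gauss_half -!mulrA ler_wpM2l//.
apply: (@le_trans _ _ ((2 + x ^+ 2) * gauss (- (c / 2)) x)).
  by rewrite ler_wpM2r ?gauss_ge0//; have := abs_le1Dsqr x; lra.
apply: le_trans (ler_wpM2r (gauss_ge0 _ _) (gauss_poly c0 x)) _.
rewrite -mulrA [_ * gauss (- _) _]mulrC gauss_quarter ler_piMr//.
  by rewrite addr_ge0// divr_ge0// ltW.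
by apply: gauss_le1; rewrite oppr_le0 divr_ge0// ltW.
Qed.

Let df x := - k * x * gauss (- k) x * psi x + gauss (- k) x * dpsi x.

Let is_derive_f (x : R) : is_derive x 1 (fun x => gauss (- k) x * psi x) (df x).
Proof.
case: psiL => dp _ _.
apply: (is_derive_eq (is_deriveM (is_derive_gauss (- k) x) (dp x))).
by rewrite /df /GRing.scale/= addrC [psi x * _]mulrC.
Qed.

Let continuous_df : continuous df.
Proof.
have cp := tame_continuous psiL.
case: psiL => dp cdp _ x; rewrite /df.
apply: cvgD; apply: cvgM.
- apply: cvgM; first by apply: cvgM; [exact: cvg_cst|exact: cvg_id].
  exact: continuous_gauss.
- exact: cp.
- exact: continuous_gauss.
- exact: cdp.
Qed.

Let bound_df x : `|df x| <= w x.
Proof.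
have L0 := tame_ge0 psiL; case: psiL => _ _ /(_ x); rewrite -/g => dpx.
have h0 := gauss_ge0 (- k) x; have gg0 := gauss_ge0 g x.
have hg0 := gauss_ge0 (- (c / 2)) x.
have b1 : `|- k * x * gauss (- k) x * psi x| <= k * `|x| * (L * (1 + `|x|)) * gauss (- (c / 2)) x.
  rewrite !normrM normrN (gtr0_norm k0) (ger0_norm h0) -(gauss_half k c).
  rewrite -/g [leRHS]mulrA mulrAC [leRHS]mulrAC ler_wpM2r// -!mulrA.
  by rewrite !ler_wpM2l ?(ltW k0)// mulrA; exact: tame_bound.
have b2 : `|gauss (- k) x * dpsi x| <= L * gauss (- (c / 2)) x.
  by rewrite normrM ger0_norm// -(gauss_half k c) mulrCA ler_wpM2l.
apply: le_trans (ler_normD _ _) _; apply: le_trans (lerD b1 b2) _.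
rewrite (_ : _ + _ = L * ((k * (`|x| + `|x| ^+ 2) + 1) * gauss (- (c / 2)) x)); last by ring.
rewrite /w -mulrA ler_wpM2l// -gauss_quarter.
rewrite [leRHS]mulrCA [leRHS]mulrC; rewrite ler_wpM2r//.
have h1 := gauss_sqr c0 x; have h2 := abs_le1Dsqr x; have h3 := gauss_ge0 (c / 4) x.
have h4 : x ^+ 2 = `|x| ^+ 2 by rewrite real_normK ?num_real.
have h5 := gauss_ge1 x (divr_ge0 (ltW c0) (ler0n R 4)).
rewrite -h4 /W.
(* Uses |x| <= 1 + x^2. The constant 1 + k and the quadratic term are then absorbed separately into
   [gauss (c / 4)], which explains the shape of W. *)
apply: (@le_trans _ _ ((1 + k) + 2 * k * x ^+ 2)).
  have := ler_wpM2l (ltW k0) h2; lra.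
rewrite [leRHS]mulrDl; apply: lerD.
  by rewrite ler_peMr// addr_ge0// ltW.
by rewrite -[leRHS]mulrA ler_wpM2l// mulr_ge0// ltW.
Qed.

Let integrable_w : leb.-integrable [set: R] (EFin \o w).
Proof.
have c4 : 0 < c / 4 by rewrite divr_gt0.
have := integrableZl measurableT (L * W) (integrable_gaussN c4).
exact: eq_integrable.
Qed.

Let KE : L * (2 + 8 / c) + \int[leb]_u w u = L * tame_const.
Proof.
have c4 : 0 < c / 4 by rewrite divr_gt0.
rewrite /w RintegralZl//; last exact: integrable_gaussN.
by rewrite /tame_const [RHS]mulrDr [in RHS]mulrA.
Qed.

Lemma tame_weighted_bound x : `|gauss (- k) x * psi x| <= L * tame_const.
Proof.
apply: le_trans (bound_f x) _; rewrite -KE lerDl; apply: Rintegral_ge0 => u _.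
by rewrite mulr_ge0 ?gauss_ge0// mulr_ge0 ?(tame_ge0 psiL)// ltW.
Qed.

Lemma tame_weighted_measurable :
  measurable_fun [set: R] (fun x => gauss (- k) x * psi x).
Proof.
by apply: measurable_funM; [exact: measurable_gauss|exact: tame_measurable psiL].
Qed.

Section two_measures.
Variables (mu nu : probability (measurableTypeR R) R) (e : R).
Hypothesis munu : forall a, `|cdf_of mu a - cdf_of nu a| <= e.

Lemma tame_partial_integral_dist a :
  `|\int[mu]_(x in `]-oo, a]) (gauss (- k) x * psi x) -
    \int[nu]_(x in `]-oo, a]) (gauss (- k) x * psi x)| <= e * (L * tame_const).
Proof.
rewrite -KE.
exact: (partial_integral_dist is_derive_f continuous_df bound_df integrable_w bound_f munu).
Qed.

Lemma tame_integral_dist :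
  `|\int[mu]_x (gauss (- k) x * psi x) -
    \int[nu]_x (gauss (- k) x * psi x)| <= e * (L * tame_const).
Proof.
rewrite -KE.
exact: (integral_dist is_derive_f continuous_df bound_df integrable_w bound_f munu).
Qed.

End two_measures.
End one_function.
End tame_weighted.

Lemma norm_lt_itv (R : realDomainType) (u v x : R) :
  u < x -> x < v -> `|x| <= `|u| + `|v|.
Proof.
move=> ux xv; have := ler_norm v; have := ler_norm (- u); rewrite normrN.
have := normr_ge0 u; have := normr_ge0 v => *.
by rewrite ler_norml; apply/andP; split; lra.
Qed.

(** * Gaussian smoothing contracts the test class *)

Section gaussian_smoothing.
Context {R : realType}.
Variables (k c : R).
Hypotheses (c0 : 0 < c) (ck : c <= k).
Let g := k - c / 2.
(** A rate between g and k. The distance c / 4 from g pays for a linear factor or for the cross term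
    of a square, while g' * s^2 < 1 keeps [gauss g'] integrable. *)
Let g' := k - c / 4.
Let k0 : 0 < k. Proof. exact: lt_le_trans ck. Qed.
Let g0 : 0 < g. Proof. by rewrite /g; move: c0 ck; lra. Qed.

Variables (theta s : R).
Hypotheses (s0 : 0 < s) (ks1 : k * s ^+ 2 < 1).

Let B := 1 - g * s ^+ 2.
(** Smoothing turns the growth rate g into g * theta^2 / B; the hypothesis says that the rate does
    not increase. *)
Hypothesis thetaB : theta ^+ 2 <= B.

Let s20 : 0 < s ^+ 2. Proof. by rewrite exprn_gt0. Qed.

Let B0 : 0 < B.
Proof.
by rewrite /B subr_gt0 (lt_trans _ ks1)// ltr_pM2r// /g; move: c0; lra.
Qed.

Let g's1 : 0 < 1 - g' * s ^+ 2.
Proof.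
by rewrite subr_gt0 (lt_trans _ ks1)// ltr_pM2r// /g'; move: c0; lra.
Qed.

(** The difference of the exponents is a perfect square with coefficient c / 8. The splitting
    separates a factor that is bounded for bounded y from one that is integrable in z. *)
Lemma gauss_split y z :
  gauss g (y + z) <= gauss (g + 4 * g ^+ 2 / c) y * gauss g' z.
Proof.
rewrite !gaussE -expRD ler_expR -subr_ge0.
rewrite (_ : _ - _ = c / 8 * (z - 4 * g / c * y) ^+ 2).
  by rewrite mulr_ge0 ?sqr_ge0// divr_ge0// ltW.
have -> : g' = g + c / 4 by rewrite /g' /g; lra.
by field; rewrite gt_eqF.
Qed.

Lemma integrable_gauss m a : a * s ^+ 2 < 1 ->
  (normal_prob m s).-integrable [set: R] (EFin \o gauss a).
Proof.
move=> as1; apply/integrableP; split.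
  by apply/measurable_EFinP; exact: measurable_gauss.
under eq_integral do rewrite /= ger0_norm ?gauss_ge0//.
by rewrite integral_normal_gauss ?subr_gt0// ltry.
Qed.

Let gauss_g' (x : R) : gauss g' x = gauss (c / 4) x * gauss g x.
Proof.
rewrite -gaussD.
have -> : c / 4 + g = g'.
  by rewrite /g' /g; field.
by [].
Qed.

Let poly_gauss (x : R) : 1 + `|x| <= (2 + 8 / c) * gauss (c / 4) x.
Proof. by apply: le_trans (gauss_poly c0 x); have := abs_le1Dsqr x; lra. Qed.

Let g2c : 0 <= g + 4 * g ^+ 2 / c.
Proof.
apply: addr_ge0; first exact: ltW.
by rewrite divr_ge0 ?(ltW c0)// mulr_ge0// sqr_ge0.
Qed.

Section one_function.
Variables (L : R) (psi dpsi : R -> R).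
Hypotheses (psiL : tame k c L psi dpsi).

Lemma tame_integrable m : (normal_prob m s).-integrable [set: R] (EFin \o psi).
Proof.
have L0 := tame_ge0 psiL.
have i' : (normal_prob m s).-integrable [set: R] (EFin \o gauss g').
  by apply: integrable_gauss; rewrite -subr_gt0.
pose C := (`|psi 0| + L) * (2 + 8 / c).
apply: (le_integrable measurableT _ _ (integrableZl measurableT C i')).
  by apply/measurable_EFinP; exact: tame_measurable psiL.
move=> x _ /=; rewrite lee_fin; apply: (le_trans _ (ler_norm _)).
have psiL' : tame k c (`|psi 0| + L) psi dpsi.
  case: psiL => h1 h2 h3; split=> // y; apply: le_trans (h3 y) _.
  by rewrite ler_wpM2r ?gauss_ge0// lerDr.
have psi0L : `|psi 0| <= `|psi 0| + L by rewrite lerDl.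
apply: le_trans (tame_bound c0 ck psiL' psi0L x) _.
rewrite -/g /C -!mulrA ler_wpM2l ?addr_ge0//.
rewrite gauss_g' mulrA ler_wpM2r ?gauss_ge0//; exact: poly_gauss.
Qed.

Definition gsmooth x : R := \int[normal_prob (theta * x) s]_z psi z.
Definition dgsmooth x : R := \int[normal_prob 0 s]_z (theta * dpsi (theta * x + z)).

Let f x z : R := psi (theta * x + z).
Let df x z : R := theta * dpsi (theta * x + z).

Let smoothE x : gsmooth x = \int[normal_prob 0 s]_z f x z.
Proof.
rewrite /gsmooth Rintegral_normal_shift ?gt_eqF//.
  exact: tame_measurable psiL.
exact: tame_integrable.
Qed.

Let dfE (x z : R) : is_derive x 1 (f ^~ z) (df x z).
Proof.
case: psiL => dp _ _; rewrite /f.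
have d1 : is_derive x 1 (fun x : R => theta * x + z) theta.
  by apply: is_derive_eq; rewrite /GRing.scale/=; ring.
have := @is_derive1_comp R psi (fun x : R => theta * x + z) x _ _ (dp _) d1.
by rewrite mulrC.
Qed.

Let d1E x z : partial1of2 f x z = df x z.
Proof.
rewrite /partial1of2 derive1E.
by have := dfE x z => h; exact: derive_val.
Qed.

(** Differentiation under the integral sign needs one integrable majorant for all x in an open
    interval. [gauss_split] provides it, with r a bound of |theta * x| on the interval. *)
Let dominated (u v : R) : exists D : R -> R,
  [/\ forall z, 0 <= D z, (normal_prob 0 s).-integrable [set: R] (EFin \o D) &
      forall x z : R, x \in `]u, v[ -> `|df x z| <= D z].
Proof.
have L0 := tame_ge0 psiL; have [_ _ dpb] := psiL.
pose r := `|theta| * (`|u| + `|v|).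
have r0 : 0 <= r by rewrite mulr_ge0// addr_ge0.
pose C := `|theta| * (L * gauss (g + 4 * g ^+ 2 / c) r).
have C0 : 0 <= C.
  by apply: mulr_ge0; [exact: normr_ge0|apply: mulr_ge0 => //; exact: gauss_ge0].
exists (fun z => C * gauss g' z); split.
- by move=> z; apply: mulr_ge0; [exact: C0|exact: gauss_ge0].
- have i' : (normal_prob 0 s).-integrable [set: R] (EFin \o gauss g').
    by apply: integrable_gauss; rewrite -subr_gt0.
  have := integrableZl measurableT C i'.
  exact: eq_integrable.
- move=> x z; rewrite in_itv/= => /andP[ux xv].
  have -> : C * gauss g' z = `|theta| * (L * (gauss (g + 4 * g ^+ 2 / c) r * gauss g' z)).
    by rewrite /C -!mulrA.
  have -> : df x z = theta * dpsi (theta * x + z) by [].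
  rewrite normrM; apply: ler_wpM2l; first exact: normr_ge0.
  apply: le_trans (dpb _) _; apply: ler_wpM2l; first exact: L0.
  apply: le_trans (gauss_split _ _) _; apply: ler_wpM2r; first exact: gauss_ge0.
  apply: ler_gauss_norm; first exact: g2c.
  rewrite normrM (ger0_norm r0); apply: ler_wpM2l; first exact: normr_ge0.
  exact: norm_lt_itv ux xv.
Qed.

Let intf (x : R) : (normal_prob 0 s).-integrable [set: R] (EFin \o f x).
Proof.
apply: integrable_normal_shift; first by rewrite gt_eqF.
  exact: tame_measurable psiL.
exact: tame_integrable.
Qed.

Let mdf (x : R) : measurable_fun [set: R] (df x).
Proof.
case: psiL => _ cdp _; apply: measurable_funM => //.
apply: (measurableT_comp (continuous_measurable_fun cdp)).
by apply: measurable_funD; [exact: measurable_cst|exact: measurable_id].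
Qed.

Let itv1 (x : R) : x \in `]x - 1, x + 1[.
Proof. by rewrite in_itv/=; lra. Qed.

Let intdf (x : R) : (normal_prob 0 s).-integrable [set: R] (EFin \o df x).
Proof.
have [D [D0 iD dfD]] := dominated (x - 1) (x + 1).
apply: (le_integrable measurableT _ _ iD).
  by apply/measurable_EFinP; exact: mdf.
move=> z _ /=; rewrite lee_fin [leRHS]ger0_norm; last exact: D0.
exact: dfD (itv1 x).
Qed.

Let is_derive_smooth (x : R) : is_derive x 1 gsmooth (dgsmooth x).
Proof.
have [D [D0 iD dfD]] := dominated (x - 1) (x + 1).
rewrite (_ : gsmooth = fun x => \int[normal_prob 0 s]_z f x z); last first.
  by apply/funext => y; exact: smoothE.
have if' y : `]x - 1, x + 1[%classic y ->
    (normal_prob 0 s).-integrable [set: R] (EFin \o f y).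
  by move=> _; exact: intf.
have der y z : `]x - 1, x + 1[%classic y -> [set: R] z -> derivable (f ^~ z) y 1.
  by move=> _ _; apply: ex_derive; exact: dfE.
have ub y z : `]x - 1, x + 1[%classic y -> [set: R] z -> `|partial1of2 f y z| <= D z.
  by move=> yuv _; rewrite d1E; exact: dfD.
have h1 := derivable_under_integral measurableT (itv1 x) if' der D0 iD ub.
have h2 := differentiation_under_integral measurableT (itv1 x) if' der D0 iD ub.
apply: DeriveDef; first exact: h1.
by rewrite -derive1E h2; apply: eq_Rintegral => z _; exact: d1E.
Qed.

Let continuous_dsmooth : continuous dgsmooth.
Proof.
move=> x; have [D [D0 iD dfD]] := dominated (x - 1) (x + 1).
apply: (@continuity_under_integral _ _ _ (normal_prob 0 s) df _ measurableT
  (x - 1) (x + 1) _ _ D).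
- by move=> y _; exact: intdf.
- apply: aeW => z _ y _.
  case: psiL => _ cdp _; rewrite /df; apply: cvgM; first exact: cvg_cst.
  apply: (@continuous_comp _ _ _ (fun y => theta * y + z) dpsi); last exact: cdp.
  apply: cvgD; last exact: cvg_cst.
  by apply: cvgM; [exact: cvg_cst|exact: cvg_id].
- exact: iD.
- by move=> y yuv; apply: aeW => z _; exact: dfD.
- by rewrite inE; exact: itv1.
Qed.

(** The chain rule brings out theta, and the normal integral of [gauss g] brings out 1 / sqrt B.
    Their product is the contraction factor, and [thetaB] restores the original growth rate. *)
Lemma dsmooth_bound x :
  `|dgsmooth x| <= `|theta| / Num.sqrt B * L * gauss g x.
Proof.
have L0 := tame_ge0 psiL; have gs1 : g * s ^+ 2 < 1 by rewrite -subr_gt0.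
have idf := intdf x.
have ig : (normal_prob 0 s).-integrable [set: R] (EFin \o (fun z => gauss g (theta * x + z))).
  apply: integrable_normal_shift; first by rewrite gt_eqF.
    exact: measurable_gauss.
  exact: integrable_gauss.
have iLg : (normal_prob 0 s).-integrable [set: R]
    (EFin \o (fun z => `|theta| * L * gauss g (theta * x + z))).
  have := integrableZl measurableT (`|theta| * L) ig.
  exact: eq_integrable.
apply: le_trans (le_normr_Rintegral measurableT idf) _.
apply: (@le_trans _ _ (\int[normal_prob 0 s]_z (`|theta| * L * gauss g (theta * x + z)))).
  apply: le_Rintegral => //; first exact: integrable_norm idf.
  move=> z _; rewrite normrM -mulrA ler_wpM2l//.
  by case: psiL => _ _; exact.
rewrite RintegralZl// -(@Rintegral_normal_shift _ (theta * x) s (gauss g)) ?gt_eqF//; last 2 first.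
- exact: measurable_gauss.
- exact: integrable_gauss.
rewrite /Rintegral integral_normal_gauss//= -/B.
rewrite mulrA (mulrAC `|theta| L); apply: ler_wpM2l.
  by rewrite mulr_ge0// divr_ge0// sqrtr_ge0.
rewrite gaussE ler_expR.
have -> : g * (theta * x) ^+ 2 / (2 * B) = g / 2 * (theta ^+ 2 / B * x ^+ 2).
  by rewrite exprMn invfM; ring.
rewrite [leRHS]mulrAC; apply: ler_wpM2l; first by rewrite divr_ge0// ltW.
by rewrite ler_piMl ?sqr_ge0// ler_pdivrMr// mul1r.
Qed.

Lemma tame_smooth : tame k c (`|theta| / Num.sqrt B * L) gsmooth dgsmooth.
Proof.
by split; [exact: is_derive_smooth|exact: continuous_dsmooth|exact: dsmooth_bound].
Qed.

End one_function.
End gaussian_smoothing.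

(** * Bounded integrands under Markov kernels *)

Lemma Rintegral_cst_probability d (T : measurableType d) (R : realType)
  (P : probability T R) (C : R) : \int[P]_x (cst C x) = C.
Proof. by rewrite Rintegral_cst// [X in fine X]probability_setT mulr1. Qed.

Section Rintegral_mkernel.
Context d d' (X : measurableType d) (Y : measurableType d') (R : realType).
Variables (pi : probability X R) (K : R.-pker X ~> Y) (nu : probability Y R).
Hypothesis nuE : forall A, measurable A -> nu A = mkernel pi K A.
Variables (f : Y -> R) (C : R).
Hypotheses (mf : measurable_fun [set: Y] f) (fC : forall y, `|f y| <= C).

Let Kx (x : X) : set Y -> \bar R := K x.

Let Kx1 x : Kx x [set: Y] = 1%E. Proof. exact: prob_kernel. Qed.

HB.instance Definition _ x := Measure.on (Kx x).
HB.instance Definition _ x := Measure_isProbability.Build _ _ _ (Kx x) (Kx1 x).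

Let int_f (mu : probability Y R) : mu.-integrable [set: Y] (EFin \o f).
Proof. by apply: (@integrable_bounded _ _ _ _ _ _ C). Qed.

Let int_cst d1 (Z : measurableType d1) (mu : probability Z R) :
  mu.-integrable [set: Z] (EFin \o cst C).
Proof. exact: finite_measure_integrable_cst. Qed.

(** Adding the bound C makes f nonnegative, which reduces measurability and the mixture formula to
    the nonnegative case. *)
Let shiftE (mu : probability Y R) :
  (\int[mu]_y (f y + C)%:E = (\int[mu]_y f y + C)%:E)%E.
Proof.
rewrite -[X in (_ + X)%:E](Rintegral_cst_probability mu).
rewrite -RintegralD//; [|exact: int_f|exact: int_cst].
rewrite fineK//; apply: integrable_fin_num => //.
have := integrableD measurableT (int_f mu) (int_cst mu).
exact: eq_integrable.
Qed.

Let fC0 y : (0 <= (f y + C)%:E)%E.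
Proof. by rewrite lee_fin -lerBlDr sub0r; have := fC y; rewrite ler_norml => /andP[]. Qed.

Let mfC : measurable_fun [set: Y] (fun y => (f y + C)%:E).
Proof. by apply/measurable_EFinP; apply: measurable_funD. Qed.

Lemma measurable_Rintegral_kernel : measurable_fun [set: X] (fun x => \int[K x]_y f y).
Proof.
have mK : measurable_fun [set: X] (fun x => \int[K x]_y (f y + C)%:E)%E.
  apply: (measurable_fun_integral_kernel (l := K)) => //.
  by move=> U mU; exact: measurable_kernel.
rewrite (_ : (fun _ => _) = (fun x => fine (\int[K x]_y (f y + C)%:E)%E - C)).
  by apply: measurable_funB => //; exact: measurableT_comp.
by apply/funext => x; rewrite (shiftE (Kx x)) /= addrK.
Qed.

Lemma Rintegral_kernel_bound x : `|\int[K x]_y f y| <= C.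
Proof.
apply: le_trans (le_normr_Rintegral measurableT (int_f (Kx x))) _.
apply: (@le_trans _ _ (\int[K x]_y (cst C y))).
  apply: le_Rintegral => //; [exact: integrable_norm (int_f (Kx x))|exact: (int_cst (Kx x))].
rewrite le_eqVlt; apply/orP; left; apply/eqP; exact: (Rintegral_cst_probability (Kx x)).
Qed.

Lemma Rintegral_mkernel : \int[nu]_y f y = \int[pi]_x \int[K x]_y f y.
Proof.
apply: (@addIr _ C); apply: EFin_inj; rewrite -shiftE.
rewrite (eq_measure_integral (mkernel pi K)); last by move=> A mA _; exact: nuE.
rewrite integral_mkernel//.
under eq_integral do rewrite (shiftE (Kx _)).
have iK : pi.-integrable [set: X] (EFin \o (fun x => \int[K x]_y f y)).
  apply: (@integrable_bounded _ _ _ _ _ _ C) => //.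
    exact: measurable_Rintegral_kernel.
  by move=> x _; exact: Rintegral_kernel_bound.
rewrite -[X in (_ + X)%:E](Rintegral_cst_probability pi).
rewrite -RintegralD//; last exact: int_cst.
rewrite fineK//; apply: integrable_fin_num => //.
have := integrableD measurableT iK (int_cst pi).
exact: eq_integrable.
Qed.

End Rintegral_mkernel.

(** A zero integral would make the positive integrand vanish almost everywhere, so the whole line
    would be a null set of a probability measure. *)
Lemma Rintegral_gauss_gt0 (R : realType) (mu : probability (measurableTypeR R) R) (a : R) :
  0 <= a -> 0 < \int[mu]_x gauss (- a) x.
Proof.
move=> a0; rewrite lt_neqAle Rintegral_ge0 ?andbT; last by move=> x _; exact: gauss_ge0.
apply/negP => /eqP E.
have mg : measurable_fun [set: measurableTypeR R] (gauss (- a) : R -> R) by exact: measurable_gauss.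
have ig : mu.-integrable [set: _] (EFin \o gauss (- a)).
  apply: (@integrable_bounded _ _ _ _ _ _ 1) => // x _.
  by rewrite ger0_norm ?gauss_ge0// gauss_le1// oppr_le0.
have E' : (\int[mu]_x `|(EFin \o (gauss (- a) : R -> R)) x| = 0)%E.
  under eq_integral do rewrite /= ger0_norm ?gauss_ge0//.
  by rewrite -[LHS]fineK ?integrable_fin_num// [X in X%:E](esym E).
have /(ae_eq_integral_abs mu measurableT)[+ _] : measurable_fun [set: measurableTypeR R] (EFin \o (gauss (- a) : R -> R)).
  exact/measurable_EFinP.
move=> /(_ E')[N [mN N0 subN]].
have : (mu [set: _] <= mu N)%E.
  apply: le_measure; rewrite ?inE// => x _; apply: subN => /= /(_ I)[] /eqP.
  by rewrite gt_eqF// gauss_gt0.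
by rewrite N0 probability_setT lee_fin ler10.
Qed.

(** * One step of the filter *)

Section filter_step.
Context {R : realType}.
Variables (rho : R) (sigma c : {posnum R}).
Local Notation mR := (measurableTypeR R).
Local Notation G := (G c).
Local Notation M := (M rho sigma).

Lemma G_gauss (x : R) : G x = gauss (- c%:num) x.
Proof. by rewrite gaussE /Defs.G !mulNr. Qed.

Lemma G_gt0 (x : R) : 0 < G x. Proof. by rewrite G_gauss gauss_gt0. Qed.

Lemma G_le1 (x : R) : G x <= 1. Proof. by rewrite G_gauss gauss_le1// oppr_le0. Qed.

Lemma G_norm_le1 (x : R) : `|G x| <= 1.
Proof. by rewrite ger0_norm ?(ltW (G_gt0 _))// G_le1. Qed.

Lemma integrable_G (mu : probability mR R) : mu.-integrable [set: mR] (EFin \o G).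
Proof.
apply: (@integrable_bounded _ _ _ _ _ _ 1) => //; first exact: measurable_G.
by move=> x _; exact: G_norm_le1.
Qed.

Definition Gint (mu : probability mR R) : R := \int[mu]_x G x.

Lemma Gint_gt0 (mu : probability mR R) : 0 < Gint mu.
Proof.
rewrite /Gint; under eq_Rintegral do rewrite G_gauss.
exact: Rintegral_gauss_gt0.
Qed.

Lemma Gint_le1 (mu : probability mR R) : Gint mu <= 1.
Proof.
rewrite -[leRHS](Rintegral_cst_probability mu); apply: le_Rintegral => //.
- exact: integrable_G.
- exact: finite_measure_integrable_cst.
- by move=> x _; exact: G_le1.
Qed.

Lemma Gmeasure_setT (mu : probability mR R) : Gmeasure c mu [set: mR] = (Gint mu)%:E.
Proof. by rewrite /Gint /Gmeasure fineK//; apply: integrable_fin_num => //; exact: integrable_G. Qed.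

Lemma mnormalize_GmeasureE (mu P : probability mR R) (A : set mR) : measurable A ->
  mnormalize (Gmeasure c mu) P A = (\int[mu]_(x in A) (G x / Gint mu)%:E)%E.
Proof.
move=> mA; rewrite /mnormalize/= Gmeasure_setT eqe gt_eqF ?Gint_gt0//=.
rewrite muleC -integralZl//.
  by apply: eq_integral => x _; rewrite mulrC EFinM.
by apply: integrableS (integrable_G mu).
Qed.

Definition update (mu : probability mR R) : probability mR R :=
  mnormalize (Gmeasure c mu) mu.

Lemma Rintegral_update (mu : probability mR R) (f : R -> R) (C : R) :
  measurable_fun [set: R] f -> (forall x, `|f x| <= C) ->
  \int[update mu]_x f x = (\int[mu]_x (f x * G x)) / Gint mu.
Proof.
move=> mf fC.
rewrite (@Rintegral_density _ mR R mu (update mu) (fun x => G x / Gint mu)) //.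
- under eq_Rintegral do rewrite mulrA.
  rewrite RintegralZr//; apply: (@integrable_bounded _ _ _ _ _ _ C) => //.
    by apply: measurable_funM => //; exact: measurable_G.
  by move=> x _; rewrite normrM -[leRHS]mulr1 ler_pM// G_norm_le1.
- by move=> x; rewrite divr_ge0 ?ltW ?G_gt0 ?Gint_gt0.
- by apply: measurable_funM => //; exact: measurable_G.
- by move=> A mA; exact: mnormalize_GmeasureE.
- by apply: (@integrable_bounded _ _ _ _ _ _ C).
Qed.

Definition predict (pi : probability mR R) : set mR -> \bar R := mkernel pi M.

HB.instance Definition _ pi := Measure.on (predict pi).

Let predict_setT pi : predict pi [set: mR] = 1%E.
Proof.
rewrite /predict /mkernel (eq_integral (cst 1%E)); last first.
  by move=> x _; exact: prob_kernel.
by rewrite integral_cst// mul1e [LHS]probability_setT.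
Qed.

HB.instance Definition _ pi :=
  Measure_isProbability.Build _ _ _ (predict pi) (predict_setT pi).

Definition filter_step (mu : probability mR R) : probability mR R :=
  predict (update mu).

Lemma Rintegral_filter_step (mu : probability mR R) (f : R -> R) (C : R) :
  measurable_fun [set: R] f -> (forall x, `|f x| <= C) ->
  \int[filter_step mu]_x f x =
  (\int[mu]_x (\int[normal_prob (rho * x) sigma%:num]_z f z * G x)) / Gint mu.
Proof.
move=> mf fC.
rewrite (@Rintegral_mkernel _ _ mR mR R (update mu) M (filter_step mu) _ f C)//.
apply: (@Rintegral_update _ _ C).
- exact: (@measurable_Rintegral_kernel _ _ mR mR R M f C mf fC).
- exact: (@Rintegral_kernel_bound _ _ mR mR R M f C mf fC).
Qed.

End filter_step.

(* The equation for k says that gauss (- k) is an eigenfunction of G(x) M(x, dz). *)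
Lemma riccati_root (R : realType) (rho sigma c : R) : 0 < sigma -> 0 < c ->
  exists2 k, 0 < k & k = c + rho ^+ 2 * k / (1 + k * sigma ^+ 2).
Proof.
move=> s0 c0; have s2 : 0 < sigma ^+ 2 by rewrite exprn_gt0.
pose p := 1 - c * sigma ^+ 2 - rho ^+ 2.
pose D := p ^+ 2 + 4 * sigma ^+ 2 * c.
have D0 : 0 < D by rewrite ltr_wpDl ?sqr_ge0// !mulr_gt0.
have sD : Num.sqrt D ^+ 2 = D by rewrite sqr_sqrtr// ltW.
have pD : p < Num.sqrt D.
  have [p0|p0] := ltP p 0; first exact: lt_le_trans (sqrtr_ge0 _).
  rewrite -[ltLHS](ger0_norm p0) -sqrtr_sqr ltr_sqrt//.
  by rewrite ltrDl !mulr_gt0.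
(* Clearing the denominator turns the equation into sigma^2 k^2 + p k - c = 0; this is its positive
   root and D its discriminant. *)
pose k := (Num.sqrt D - p) / (2 * sigma ^+ 2).
have k0 : 0 < k by rewrite divr_gt0 ?subr_gt0// mulr_gt0.
exists k => //.
have b0 : 0 < 1 + k * sigma ^+ 2 by rewrite addr_gt0// mulr_gt0.
have kq : sigma ^+ 2 * k ^+ 2 + p * k - c = 0.
  have -> : sigma ^+ 2 * k ^+ 2 + p * k - c =
      (Num.sqrt D ^+ 2 - (p ^+ 2 + 4 * sigma ^+ 2 * c)) / (4 * sigma ^+ 2).
    by rewrite /k; move: (Num.sqrt D) => w; field; rewrite gt_eqF.
  by rewrite sD subrr mul0r.
apply/eqP; rewrite -subr_eq0; apply/eqP.
rewrite (_ : _ - _ = (sigma ^+ 2 * k ^+ 2 + p * k - c) / (1 + k * sigma ^+ 2)).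
  by rewrite kq mul0r.
by rewrite /p; field; rewrite gt_eqF.
Qed.

(** * The Doob transform *)

Section doob.
Context {R : realType}.
Variables (rho : R) (sigma c : {posnum R}) (k : R).
Local Notation mR := (measurableTypeR R).
Hypothesis k0 : 0 < k.
Hypothesis kE : k = c%:num + rho ^+ 2 * k / (1 + k * sigma%:num ^+ 2).

(** Tilting by the eigenfunction raises the precision 1 / sigma^2 by k; b is the quotient sigma^2 /
    s^2 of the old and the new variance. *)
Definition doob_var_ratio : R := 1 + k * sigma%:num ^+ 2.
Local Notation b := doob_var_ratio.
Definition doob_theta : R := rho / b.
Local Notation theta := doob_theta.
Definition doob_s : R := sigma%:num / Num.sqrt b.
Local Notation s := doob_s.
(** The eigenvalue of [gauss (- k)] under the kernel G(x) M(x, dz). *)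
Definition doob_lam : R := (Num.sqrt b)^-1.
Local Notation lam := doob_lam.
(** The contraction factor of [dsmooth_bound] at these parameters. *)
Definition doob_tau : R := `|theta| / Num.sqrt (1 - (k - c%:num / 2) * s ^+ 2).
Local Notation tau := doob_tau.

Let s2 : 0 < sigma%:num ^+ 2. Proof. by rewrite exprn_gt0. Qed.

Lemma doob_var_ratio_gt0 : 0 < b. Proof. by rewrite addr_gt0// mulr_gt0. Qed.

Lemma doob_lam_gt0 : 0 < lam. Proof. by rewrite invr_gt0 sqrtr_gt0 doob_var_ratio_gt0. Qed.

Lemma doob_s_gt0 : 0 < s. Proof. by rewrite divr_gt0// sqrtr_gt0 doob_var_ratio_gt0. Qed.

Lemma doob_s2 : s ^+ 2 = sigma%:num ^+ 2 / b.
Proof. by rewrite expr_div_n sqr_sqrtr// ltW// doob_var_ratio_gt0. Qed.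

Lemma c_le_doob : c%:num <= k.
Proof.
rewrite [leRHS]kE lerDl divr_ge0 ?(ltW doob_var_ratio_gt0)//.
by rewrite mulr_ge0 ?sqr_ge0// ltW.
Qed.

Lemma doob_ks2 : k * s ^+ 2 < 1.
Proof.
rewrite doob_s2 mulrA ltr_pdivrMr ?doob_var_ratio_gt0// mul1r /b.
by rewrite ltrDr.
Qed.

(** The equation for k gives theta^2 = (1 - c / k) / b, while the right-hand side is (1 + c *
    sigma^2 / 2) / b. The gap comes from c > 0 alone, so the contraction holds for every rho, stable
    or not. *)
Lemma doob_theta2 : theta ^+ 2 < 1 - (k - c%:num / 2) * s ^+ 2.
Proof.
have b0 := doob_var_ratio_gt0.
have rE : rho ^+ 2 = (k - c%:num) * b / k.
  have e : k - c%:num = rho ^+ 2 * k / b by rewrite {1}kE addrC addKr.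
  rewrite e divfK; last by rewrite gt_eqF.
  by rewrite mulfK// gt_eqF.
rewrite doob_s2 /theta expr_div_n rE -subr_gt0.
rewrite (_ : _ - _ = (c%:num / k + c%:num * sigma%:num ^+ 2 / 2) / b).
  by rewrite divr_gt0// addr_gt0// divr_gt0// mulr_gt0.
have -> : sigma%:num ^+ 2 = (b - 1) / k by rewrite /b [1 + _]addrC addrK [k * _]mulrC mulfK ?gt_eqF.
by field; rewrite !gt_eqF.
Qed.

Lemma doob_tau_ge0 : 0 <= tau.
Proof. by rewrite divr_ge0// sqrtr_ge0. Qed.

Lemma doob_tau_lt1 : tau < 1.
Proof.
have B0 := le_lt_trans (sqr_ge0 _) doob_theta2.
rewrite ltr_pdivrMr ?sqrtr_gt0// mul1r -sqrtr_sqr ltr_sqrt//.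
exact: doob_theta2.
Qed.

End doob.

Section doob_transform.
Context {R : realType}.
Variables (rho : R) (sigma c : {posnum R}) (k : R).
Local Notation mR := (measurableTypeR R).
Hypothesis k0 : 0 < k.
Hypothesis kE : k = c%:num + rho ^+ 2 * k / (1 + k * sigma%:num ^+ 2).
Local Notation b := (doob_var_ratio sigma k).
Local Notation theta := (doob_theta rho sigma k).
Local Notation s := (doob_s sigma k).
Local Notation lam := (doob_lam sigma k).
Local Notation tau := (doob_tau rho sigma c k).
Local Notation tame := (tame k c%:num).
Local Notation K := (tame_const k c%:num).
Local Notation S := (gsmooth theta s).
Local Notation Phi := (filter_step rho sigma c).

Let c0 : 0 < c%:num. Proof. by []. Qed.
Let ck' := c_le_doob k0 kE.
Let K0 : 0 <= K := tame_const_ge0 c0 ck'.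

Lemma tame_doob L psi dpsi : tame L psi dpsi ->
  tame (tau * L) (S psi) (dgsmooth theta s dpsi).
Proof.
move=> psiL; apply: (tame_smooth c0 ck' (doob_s_gt0 sigma k0) (doob_ks2 sigma k0)) => //.
exact: ltW (doob_theta2 k0 kE).
Qed.

Lemma tame_cst (L C : R) : 0 <= L -> tame L (cst C) (cst 0).
Proof.
move=> L0; split; [by move=> x; exact: is_derive_cst|exact: cst_continuous|].
by move=> x; rewrite normr0 mulr_ge0// gauss_ge0.
Qed.

Lemma tame_bounded L psi dpsi : tame L psi dpsi ->
  forall x, `|gauss (- k) x * psi x| <= (L + `|psi 0|) * K.
Proof.
move=> psiL x; apply: (tame_weighted_bound c0 ck' (dpsi := dpsi)); last by rewrite lerDr (tame_ge0 psiL).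
case: psiL => h1 h2 h3; split=> // y; apply: le_trans (h3 y) _.
by rewrite ler_wpM2r ?gauss_ge0// lerDl.
Qed.

Lemma tame_integrable_weighted L psi dpsi (mu : probability mR R) : tame L psi dpsi ->
  mu.-integrable [set: mR] (EFin \o (fun x => gauss (- k) x * psi x)).
Proof.
move=> psiL; apply: (@integrable_bounded _ _ _ _ _ _ ((L + `|psi 0|) * K)) => //.
  exact: tame_weighted_measurable psiL.
by move=> x _; exact: tame_bounded psiL x.
Qed.

(** Tilting the transition by [gauss (- k)] yields the normal law with mean theta * x and deviation
    s; the exponential left over combines with G into [gauss (- k) x]. *)
Lemma doob_identity L psi dpsi (x : R) : tame L psi dpsi ->
  (\int[normal_prob (rho * x) sigma%:num]_z (gauss (- k) z * psi z)) * Defs.G c x =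
  lam * (gauss (- k) x * S psi x).
Proof.
move=> psiL; have b0 := doob_var_ratio_gt0 sigma k0.
have bE : 1 - (- k) * sigma%:num ^+ 2 = b by rewrite mulNr opprK.
have thetaE : rho * x / b = theta * x by rewrite /doob_theta mulrAC.
transitivity (lam * expR (- k * (rho * x) ^+ 2 / (2 * b)) * S psi x * Defs.G c x).
  congr (_ * _); under eq_Rintegral do rewrite mulrC.
  have B0 : 0 < 1 - (- k) * sigma%:num ^+ 2 by rewrite bE.
  have ip : (normal_prob (rho * x / (1 - (- k) * sigma%:num ^+ 2))
      (sigma%:num / Num.sqrt (1 - (- k) * sigma%:num ^+ 2))).-integrable [set: R] (EFin \o psi).
    rewrite bE.
    exact: (tame_integrable c0 ck' (doob_s_gt0 sigma k0) (doob_ks2 sigma k0) psiL).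
  rewrite (Rintegral_normal_tilt _ B0 (tame_measurable psiL) ip); last by [].
  by rewrite bE thetaE.
(* The equation for k is exactly this matching of exponents. *)
have -> : gauss (- k) x = expR (- k * (rho * x) ^+ 2 / (2 * b)) * Defs.G c x.
  rewrite G_gauss !gaussE -expRD; congr expR.
  rewrite [in LHS]kE /doob_var_ratio; field.
  by rewrite gt_eqF.
by rewrite -!mulrA; congr (_ * (_ * _)); rewrite mulrC.
Qed.

Definition wint (mu : probability mR R) (psi : R -> R) : R :=
  \int[mu]_x (gauss (- k) x * psi x).

Definition hint (mu : probability mR R) : R := wint mu (cst 1).

Lemma hint_gauss mu : hint mu = \int[mu]_x gauss (- k) x.
Proof. by apply: eq_Rintegral => x _; rewrite mulr1. Qed.

Lemma hint_gt0 mu : 0 < hint mu.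
Proof. by rewrite hint_gauss Rintegral_gauss_gt0// ltW. Qed.

Lemma wint_filter_step L psi dpsi mu : tame L psi dpsi ->
  wint (Phi mu) psi = lam / Gint c mu * wint mu (S psi).
Proof.
move=> psiL; rewrite /wint.
rewrite (@Rintegral_filter_step _ rho sigma c mu _ ((L + `|psi 0|) * K)); last 2 first.
- exact: tame_weighted_measurable psiL.
- exact: tame_bounded psiL.
under eq_Rintegral do rewrite (doob_identity _ psiL).
rewrite RintegralZl//; last exact: tame_integrable_weighted (tame_doob psiL).
by rewrite mulrAC.
Qed.

Lemma smooth_cst (C x : R) : S (cst C) x = C.
Proof. by rewrite /gsmooth (@Rintegral_cst_probability _ _ _ (normal_prob _ _)). Qed.

Lemma hint_filter_step mu : hint (Phi mu) = lam / Gint c mu * hint mu.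
Proof.
rewrite /hint (wint_filter_step _ (tame_cst 1 ler01)); congr (_ * _).
by apply: eq_Rintegral => x _; rewrite smooth_cst.
Qed.

Definition hratio mu psi := wint mu psi / hint mu.

(** The normalization of the filter enters numerator and denominator as the same factor
    [lam / Gint c mu], so the nonlinearity cancels. *)
Lemma hratio_filter_step L psi dpsi mu : tame L psi dpsi ->
  hratio (Phi mu) psi = hratio mu (S psi).
Proof.
move=> psiL; rewrite /hratio hint_filter_step (wint_filter_step _ psiL).
have l0 : lam / Gint c mu != 0.
  by rewrite gt_eqF// divr_gt0 ?Gint_gt0// doob_lam_gt0.
by rewrite -mulf_div divff// mul1r.
Qed.

End doob_transform.

(** * Test functions that recover the distribution function *)

Section normal_cdf.
Context {R : realType}.
Notation leb := (@lebesgue_measure R).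
Variables (s : R).
Hypothesis s0 : 0 < s.

Let s_neq0 : s != 0. Proof. by rewrite gt_eqF. Qed.

Let integrable_pdf (y : R) : leb.-integrable `]-oo, y] (EFin \o normal_pdf 0 s).
Proof.
have mY : measurable (`]-oo, y] : set (measurableTypeR R)) by [].
exact: (integrableS measurableT mY (@subsetT _ _) (integrable_normal_pdf 0 s)).
Qed.

Lemma is_derive_cdf_normal (y : R) :
  is_derive y 1 (cdf_of (normal_prob 0 s)) (normal_pdf 0 s y).
Proof.
have y1 : y < y + 1 by rewrite ltrDl.
have [d1 d2] := @continuous_FTC1 R (normal_pdf 0 s) -oo%O y (y + 1) y1
  (integrable_pdf (y + 1)) (ltNyr _) (@continuous_normal_pdf _ 0 _ s_neq0 y).
by apply: DeriveDef; [exact: d1|rewrite -derive1E; exact: d2].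
Qed.

Lemma cdf_normal_shift m (a : R) :
  cdf_of (normal_prob m s) a = cdf_of (normal_prob 0 s) (a - m).
Proof.
rewrite /cdf_of -normal_probDl// /pushforward.
congr (fine (normal_prob 0 s _)).
by apply/seteqP; split=> x /=; rewrite !in_itv/= lerBrDl.
Qed.

End normal_cdf.

Section tame_examples.
Context {R : realType}.
Variables (k c : R).
Hypotheses (c0 : 0 < c) (ck : c <= k).

Let gamma := k - c.
Let gamma0 : 0 <= gamma. Proof. by rewrite subr_ge0. Qed.

(** The linear factor raises the rate k - c by c / 4, still below k - c / 2. *)
Lemma gauss_linear_bound (C x : R) : 0 <= C ->
  C * (1 + `|x|) * gauss gamma x <= C * (2 + 8 / c) * gauss (k - c / 2) x.
Proof.
move=> C0; rewrite -!mulrA; apply: ler_wpM2l => //.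
have h : 1 + `|x| <= (2 + 8 / c) * gauss (c / 4) x.
  by apply: le_trans (gauss_poly c0 x); have := abs_le1Dsqr x; lra.
apply: le_trans (ler_wpM2r (gauss_ge0 gamma x) h) _.
rewrite -mulrA; apply: ler_wpM2l.
  by rewrite addr_ge0// divr_ge0// ltW.
by rewrite -gaussD; apply: ler_gauss; rewrite /gamma; move: c0; lra.
Qed.

(** This function is G divided by the eigenfunction. The one of [tame_gauss_cdf] carries in addition
    the distribution function of the transition at a, as a function of the starting point. *)
Lemma tame_gauss : tame k c (gamma * (2 + 8 / c)) (gauss gamma)
  (fun x => gamma * x * gauss gamma x).
Proof.
split.
- by move=> x; exact: is_derive_gauss.
- move=> x; apply: cvgM; last exact: continuous_gauss.
  by apply: cvgM; [exact: cvg_cst|exact: cvg_id].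
- move=> x; apply: le_trans (gauss_linear_bound x gamma0).
  rewrite !normrM (ger0_norm gamma0) (ger0_norm (gauss_ge0 _ _)).
  by apply: ler_wpM2r; [exact: gauss_ge0|apply: ler_wpM2l => //; rewrite lerDr].
Qed.

Variables (rho s a : R).
Hypothesis s0 : 0 < s.
Let s_neq0 : s != 0. Proof. by rewrite gt_eqF. Qed.

Lemma tame_gauss_cdf :
  tame k c ((gamma + `|rho| * normal_peak s) * (2 + 8 / c))
  (fun x => gauss gamma x * cdf_of (normal_prob (rho * x) s) a)
  (fun x => gamma * x * gauss gamma x * cdf_of (normal_prob 0 s) (a - rho * x) -
            rho * gauss gamma x * normal_pdf 0 s (a - rho * x)).
Proof.
have p0 : 0 <= normal_peak s by exact: normal_peak_ge0.
pose F := cdf_of (normal_prob 0 s).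
have cF : continuous F by apply: is_derive_continuous; exact: is_derive_cdf_normal.
have d1 (x : R) : is_derive x 1 (fun x : R => a - rho * x) (- rho).
  by apply: is_derive_eq; rewrite /GRing.scale/=; ring.
have c1 (x : R) : (fun x : R => a - rho * x) x @[x --> x] --> (a - rho * x).
  apply: cvgB; first exact: cvg_cst.
  by apply: cvgM; [exact: cvg_cst|exact: cvg_id].
split.
- move=> x; rewrite (_ : (fun x => _) = fun x => gauss gamma x * F (a - rho * x)); last first.
    by apply/funext => y; rewrite cdf_normal_shift.
  have d2 := @is_derive1_comp R F (fun x : R => a - rho * x) x _ _
    (is_derive_cdf_normal s0 _) (d1 x).
  apply: (is_derive_eq (is_deriveM (is_derive_gauss gamma x) d2)).
  by rewrite /GRing.scale/= -/F; ring.
- move=> x; apply: cvgB; apply: cvgM.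
  + apply: cvgM; last exact: continuous_gauss.
    by apply: cvgM; [exact: cvg_cst|exact: cvg_id].
  + by apply: (@continuous_comp _ _ _ (fun x => a - rho * x) F); [exact: c1|exact: cF].
  + by apply: cvgM; [exact: cvg_cst|exact: continuous_gauss].
  + apply: (@continuous_comp _ _ _ (fun x => a - rho * x) (normal_pdf 0 s)); first exact: c1.
    exact: continuous_normal_pdf.
- move=> x; apply: le_trans (gauss_linear_bound x _); last first.
    by rewrite addr_ge0// mulr_ge0.
  apply: le_trans (ler_normB _ _) _; rewrite !normrM.
  rewrite (ger0_norm gamma0) (ger0_norm (gauss_ge0 _ _)).
  rewrite (ger0_norm (cdf_of_ge0 (normal_prob 0 s) _)).
  rewrite (ger0_norm (normal_pdf_ge0 _ _ _)).
  have h1 : gamma * `|x| * gauss gamma x * cdf_of (normal_prob 0 s) (a - rho * x) <=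
            gamma * `|x| * gauss gamma x.
    by rewrite ler_piMr ?cdf_of_le1// mulr_ge0 ?gauss_ge0// mulr_ge0.
  have h2 : `|rho| * gauss gamma x * normal_pdf 0 s (a - rho * x) <=
            `|rho| * gauss gamma x * normal_peak s.
    by rewrite ler_wpM2l ?normal_pdf_ub// mulr_ge0 ?gauss_ge0.
  apply: le_trans (lerD h1 h2) _.
  rewrite (mulrAC _ _ (normal_peak s)) -mulrDl; apply: ler_wpM2r; first exact: gauss_ge0.
  have h3 : 0 <= `|rho| * normal_peak s by rewrite mulr_ge0.
  have := gamma0; move: h3 (normr_ge0 x).
  by move: (`|rho| * _) `|x| gamma => r y g r0 y0 g0; nra.
Qed.

End tame_examples.

(** * Perturbation of quotients *)

Section quotients.
Context {R : realFieldType}.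
Implicit Types A B a b d K : R.

(** Since B / b lies between 0 and 1, the error of the denominator costs no more than that of the
    numerator, and the bound is of first order in 1 / K. *)
Lemma quotient_dist A B a b d K : 0 < K -> K <= a -> K <= b -> 0 <= d ->
  `|A - B| <= d -> `|a - b| <= d -> 0 <= B <= b ->
  `|A / a - B / b| <= 2 * d / K.
Proof.
move=> K0 Ka Kb d0 AB ab /andP[B0 Bb].
have a0 : 0 < a := lt_le_trans K0 Ka; have b0 : 0 < b := lt_le_trans K0 Kb.
have -> : A / a - B / b = ((A - B) + B / b * (b - a)) / a.
  by field; rewrite !gt_eqF.
rewrite normrM [X in _ * X]gtr0_norm ?invr_gt0//.
apply: (@le_trans _ _ ((d + d) / a)).
  rewrite ler_wpM2r// ?invr_ge0 ?(ltW a0)//.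
  apply: le_trans (ler_normD _ _) _; apply: lerD => //.
  rewrite normrM distrC (ger0_norm (divr_ge0 B0 (ltW b0))) -[leRHS]mul1r.
  by apply: ler_pM => //; [rewrite divr_ge0// ltW|rewrite ler_pdivrMr// mul1r].
rewrite (_ : d + d = 2 * d); last by ring.
by rewrite ler_wpM2l ?mulr_ge0// lef_pV2.
Qed.

(** The version for numerators of either sign, where B / b is controlled only by Bmax / K. *)
Lemma quotient_dist_bounded A B a b d K Bmax : 0 < K -> K <= a -> K <= b -> 0 <= d ->
  `|A - B| <= d -> `|B| <= Bmax -> forall d', `|a - b| <= d' ->
  `|A / a - B / b| <= d / K + Bmax * d' / K ^+ 2.
Proof.
move=> K0 Ka Kb d0 AB BB d' ab.
have a0 : 0 < a := lt_le_trans K0 Ka; have b0 : 0 < b := lt_le_trans K0 Kb.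
have -> : A / a - B / b = (A - B) / a + B * (b - a) / (a * b).
  by field; rewrite !gt_eqF.
apply: le_trans (ler_normD _ _) _; apply: lerD.
  rewrite normrM [X in _ * X]gtr0_norm ?invr_gt0//.
  by apply: ler_pM => //; [rewrite invr_ge0 ltW|rewrite lef_pV2].
rewrite normrM [X in _ * X]gtr0_norm ?invr_gt0 ?mulr_gt0//.
apply: ler_pM => //; first by rewrite invr_ge0 mulr_ge0// ltW.
  by rewrite normrM distrC; apply: ler_pM.
by rewrite lef_pV2 ?posrE ?exprn_gt0 ?mulr_gt0// expr2 ler_pM// ltW.
Qed.

End quotients.

(** * Lower bounds on the eigenfunction mass *)

Section stability.
Context {R : realType}.
Variables (rho : R) (sigma c : {posnum R}) (k : R).
Local Notation mR := (measurableTypeR R).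
Hypothesis k0 : 0 < k.
Hypothesis kE : k = c%:num + rho ^+ 2 * k / (1 + k * sigma%:num ^+ 2).
Local Notation lam := (doob_lam sigma k).
Local Notation tau := (doob_tau rho sigma c k).
Local Notation tame := (tame k c%:num).
Local Notation K := (tame_const k c%:num).
Local Notation S := (gsmooth (doob_theta rho sigma k) (doob_s sigma k)).
Local Notation Phi := (filter_step rho sigma c).
Local Notation wint := (wint k).
Local Notation hint := (hint k).
Local Notation hratio := (hratio k).
Implicit Types mu nu : probability mR R.

Let c0 : 0 < c%:num. Proof. by []. Qed.
Let ck' := c_le_doob k0 kE.
Let K0 : 0 <= K := tame_const_ge0 c0 ck'.

Let tame1 : tame 1 (cst 1) (cst 0) := tame_cst c k 1 ler01.

Definition close e mu nu := forall a, `|cdf_of mu a - cdf_of nu a| <= e.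

Lemma hint_dist e mu nu : close e mu nu -> `|hint mu - hint nu| <= e * K.
Proof.
move=> munu; rewrite -[K]mul1r.
apply: (tame_integral_dist c0 ck' tame1 _ munu).
by rewrite normr1.
Qed.

(* [hratio] commutes with subtracting the constant [psi 0], which is why no bound
   on [psi 0] is needed. *)
Lemma hratio_dist e kappa mu nu L psi dpsi : 0 <= e -> 0 < kappa ->
  kappa <= hint mu -> kappa <= hint nu -> close e mu nu -> tame L psi dpsi ->
  `|hratio mu psi - hratio nu psi| <= (K / kappa + (K / kappa) ^+ 2) * L * e.
Proof.
move=> e0 kap0 kmu knu munu psiL; have L0 := tame_ge0 psiL.
pose psi0 x := psi x - psi 0.
have psi0L : tame L psi0 dpsi.
  case: psiL => h1 h2 h3; split=> // x.
  apply: (is_derive_eq (is_deriveB (h1 x) (is_derive_cst (psi 0) x 1))).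
  by rewrite subr0.
have psi00 : `|psi0 0| <= L by rewrite /psi0 subrr normr0.
have shift pi : hratio pi psi = hratio pi psi0 + psi 0.
  have h0 := hint_gt0 k0 pi.
  have E : wint pi psi = wint pi psi0 + psi 0 * hint pi.
    rewrite /hint /wint -RintegralZl//; last first.
      exact: (tame_integrable_weighted k0 kE _ tame1).
    rewrite -RintegralD//.
    - by apply: eq_Rintegral => x _; rewrite /psi0 /cst; ring.
    - exact: (tame_integrable_weighted k0 kE _ psi0L).
    - have := integrableZl measurableT (psi 0)
        (tame_integrable_weighted k0 kE pi tame1).
      exact: eq_integrable.
  by rewrite /hratio E mulrDl mulfK ?gt_eqF.
rewrite !shift opprD addrACA subrr addr0.
have dA : `|wint mu psi0 - wint nu psi0| <= e * (L * K).
  exact: (tame_integral_dist c0 ck' psi0L psi00 munu).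
have bB : `|wint nu psi0| <= L * K.
  have ii := tame_integrable_weighted k0 kE nu psi0L.
  apply: le_trans (le_normr_Rintegral measurableT ii) _.
  rewrite -[leRHS](Rintegral_cst_probability nu); apply: le_Rintegral => //.
  - exact: integrable_norm ii.
  - exact: finite_measure_integrable_cst.
  - by move=> x _; exact: (tame_weighted_bound c0 ck' psi0L psi00).
apply: le_trans (quotient_dist_bounded kap0 kmu knu _ dA bB (hint_dist munu)) _.
  by rewrite !mulr_ge0.
rewrite le_eqVlt; apply/orP; left; apply/eqP.
by field; rewrite gt_eqF.
Qed.

(* A lower bound of gauss (- k) on the set where G > lam / 4. *)
Definition hlow : R := expR (k / c%:num * ln (lam / 4)).

Lemma hlow_gt0 : 0 < hlow. Proof. exact: expR_gt0. Qed.

(** The inequality holds pointwise. Where G <= lam / 4 the left-hand side is not positive; elsewhere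
    G <= 1, and [gauss (- k)], the power k / c of G, is at least [hlow]. *)
Lemma hint_lower mu : hlow * (Gint c mu - lam / 4) <= hint mu.
Proof.
have l0 := doob_lam_gt0 sigma k0; have l4 : 0 < lam / 4 by rewrite divr_gt0.
have h0 := hlow_gt0.
rewrite hint_gauss -{1}[lam / 4](Rintegral_cst_probability mu) /Gint.
have iG := integrable_G c mu.
have ic : mu.-integrable [set: mR] (EFin \o cst (lam / 4)).
  exact: finite_measure_integrable_cst.
rewrite -RintegralB// -RintegralZl//; last first.
  by have := integrableB measurableT iG ic; exact: eq_integrable.
apply: le_Rintegral => //.
- have := integrableZl measurableT hlow (integrableB measurableT iG ic).
  exact: eq_integrable.
- have := tame_integrable_weighted k0 kE mu tame1.
  by apply: eq_integrable => // x _ /=; rewrite mulr1.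
move=> x _ /=.
have [Gx|Gx] := leP (Defs.G c x) (lam / 4).
  apply: (@le_trans _ _ 0); last exact: gauss_ge0.
  by rewrite pmulr_rle0// subr_le0.
apply: (@le_trans _ _ hlow).
  rewrite ler_piMr ?(ltW h0)// lerBlDr (le_trans (G_le1 c x))// lerDl ltW//.
rewrite /hlow gaussE ler_expR.
have -> : - k * x ^+ 2 / 2 = k / c%:num * ln (Defs.G c x).
  by rewrite /Defs.G expRK; field; rewrite gt_eqF.
rewrite ler_wpM2l ?divr_ge0 ?(ltW k0)//.
by rewrite ler_ln ?posrE ?G_gt0// ltW.
Qed.

(* Either Gint is small and normalization at least doubles [hint], or [hint_lower]
   applies; so [hint] stays bounded below along perturbed filters. *)
Lemma hint_filter_step_lower kappa mu : kappa <= hint mu ->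
  kappa <= lam ^+ 2 * hlow / 8 -> 2 * kappa <= hint (Phi mu).
Proof.
move=> kmu kap; rewrite (hint_filter_step k0 kE).
have l0 := doob_lam_gt0 sigma k0; have G0 := Gint_gt0 c mu; have h0 := hlow_gt0.
have hm0 := hint_gt0 k0 mu.
have [Gl|Gl] := leP (Gint c mu) (lam / 2).
  apply: (@le_trans _ _ (2 * hint mu)); first by rewrite ler_pM2l.
  by rewrite ler_pM2r// ler_pdivlMr//; move: Gl; lra.
apply: (@le_trans _ _ (lam * hint mu)); last first.
  rewrite ler_pM2r// ler_pdivlMr// ler_piMr ?(ltW l0)//.
  exact: Gint_le1.
have : hlow * (lam / 4) <= hint mu.
  apply: le_trans (hint_lower mu); rewrite ler_pM2l//; move: Gl; lra.
move=> /(ler_wpM2l (ltW l0)); apply: le_trans.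
by move: kap; lra.
Qed.

End stability.

(** * Stability of the filter under local errors *)

Section filter_stability.
Context {R : realType}.
Variables (rho : R) (sigma c : {posnum R}).
Local Notation mR := (measurableTypeR R).
Local Notation Phi := (filter_step rho sigma c).
Local Notation M := (M rho sigma).
Local Notation G := (Defs.G c).
Implicit Types mu nu : probability mR R.

Lemma eq_Rintegral_measure mu nu (f : R -> R) :
  (forall A, measurable A -> mu A = nu A) -> \int[mu]_x f x = \int[nu]_x f x.
Proof.
move=> munu; rewrite /Rintegral (eq_measure_integral nu)// => A mA _.
exact: munu.
Qed.

Lemma cdf_of_update mu (a : R) :
  cdf_of (update c mu) a = (\int[mu]_(x in `]-oo, a]) G x) / Gint c mu.
Proof.
have mY : measurable (`]-oo, a] : set mR) by [].
rewrite -RintegralZr//; first exact: (congr1 fine (mnormalize_GmeasureE c mu mu mY)).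
exact: (integrableS measurableT mY (@subsetT _ _) (integrable_G c mu)).
Qed.

Lemma cdf_of_filter_step mu (a : R) :
  cdf_of (Phi mu) a =
  (\int[mu]_x (cdf_of (normal_prob (rho * x) sigma%:num) a * G x)) / Gint c mu.
Proof.
have mY : measurable (`]-oo, a] : set mR) by [].
have mf : measurable_fun [set: mR] (fun x : mR => cdf_of (normal_prob (rho * x) sigma%:num) a).
  apply: measurableT_comp => //.
  exact: (measurable_kernel M _ mY).
rewrite -(@Rintegral_update _ c mu (fun x => cdf_of (normal_prob (rho * x) sigma%:num) a) 1)//; last first.
  by move=> x; rewrite ger0_norm ?cdf_of_ge0 ?cdf_of_le1.
apply: (congr1 fine); apply: eq_integral => x _.
exact: (cdf_of_prob (normal_prob (rho * x) sigma%:num)).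
Qed.

Variable k : R.
Hypothesis k0 : 0 < k.
Hypothesis kE : k = c%:num + rho ^+ 2 * k / (1 + k * sigma%:num ^+ 2).
Local Notation lam := (doob_lam sigma k).
Local Notation tau := (doob_tau rho sigma c k).
Local Notation tame := (tame k c%:num).
Local Notation K := (tame_const k c%:num).
Local Notation S := (gsmooth (doob_theta rho sigma k) (doob_s sigma k)).
Local Notation wint := (wint k).
Local Notation hint := (hint k).
Local Notation hratio := (hratio k).

Let c0 : 0 < c%:num. Proof. by []. Qed.
Let ck' := c_le_doob k0 kE.
Let K0 : 0 <= K := tame_const_ge0 c0 ck'.

Let psiG := gauss (k - c%:num).
Let psia a x := psiG x * cdf_of (normal_prob (rho * x) sigma%:num) a.

(** A common constant for [psiG] and all [psia a]. The summand 1 makes it bound the value of [psiG]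
    at 0 as well. *)
Let LA := (k - c%:num + `|rho| * normal_peak sigma%:num) * (2 + 8 / c%:num) + 1.

Let c8 : 0 <= 2 + 8 / c%:num.
Proof. by rewrite addr_ge0// divr_ge0. Qed.

Let gamma0 : 0 <= k - c%:num. Proof. by rewrite subr_ge0. Qed.

Let rp0 : 0 <= `|rho| * normal_peak sigma%:num.
Proof. by rewrite mulr_ge0// normal_peak_ge0. Qed.

Let tame_le L L' psi dpsi : L <= L' -> tame L psi dpsi -> tame L' psi dpsi.
Proof.
move=> LL [h1 h2 h3]; split=> // x; apply: le_trans (h3 x) _.
by apply: ler_wpM2r => //; exact: gauss_ge0.
Qed.

Let tame_psiG : tame LA psiG (fun x => (k - c%:num) * x * psiG x).
Proof.
apply: tame_le (tame_gauss c0 ck'); rewrite /LA.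
move: (mulr_ge0 rp0 c8); move: (`|rho| * _) (2 + _) (k - _) => r y g ry.
by rewrite mulrDl; lra.
Qed.

Let LA0 : 0 <= LA. Proof. exact: tame_ge0 tame_psiG. Qed.

Let tame_psia a : tame LA (psia a) (fun x =>
  (k - c%:num) * x * psiG x * cdf_of (normal_prob 0 sigma%:num) (a - rho * x) -
  rho * psiG x * normal_pdf 0 sigma%:num (a - rho * x)).
Proof.
by apply: tame_le (tame_gauss_cdf c0 ck' rho a _) => //; rewrite /LA lerDl.
Qed.

Let psiGE x : gauss (- k) x * psiG x = G x.
Proof. by rewrite /psiG -gaussD G_gauss; congr gauss; ring. Qed.

Lemma Gint_wint mu : Gint c mu = wint mu psiG.
Proof. by apply: eq_Rintegral => x _; rewrite psiGE. Qed.

(** Dividing numerator and denominator of [cdf_of_filter_step] by [hint mu] leaves only averages of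
    test functions. *)
Lemma cdf_of_filter_step_hratio mu a :
  cdf_of (Phi mu) a = hratio mu (psia a) / hratio mu psiG.
Proof.
rewrite cdf_of_filter_step Gint_wint /hratio.
have h0 : (hint mu)^-1 != 0 by rewrite invr_eq0 gt_eqF// hint_gt0.
rewrite -mulf_div divff// mulr1; congr (_ / _).
by apply: eq_Rintegral => x _; rewrite /psia mulrA psiGE mulrC.
Qed.

Lemma hint_le_Gint mu : hint mu <= Gint c mu.
Proof.
rewrite hint_gauss; apply: le_Rintegral => //.
- apply: (@integrable_bounded _ _ _ _ _ _ 1) => //; first exact: measurable_gauss.
  by move=> x _; rewrite ger0_norm ?gauss_ge0// gauss_le1// oppr_le0 ltW.
- exact: integrable_G.
- by move=> x _; rewrite G_gauss; apply: ler_gauss; rewrite lerN2.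
Qed.

(** As c <= k, G dominates the eigenfunction. The denominator in [cdf_of_filter_step_hratio] is thus
    at least 1 for every measure. *)
Lemma hratio_psiG_ge1 mu : 1 <= hratio mu psiG.
Proof.
rewrite /hratio ler_pdivlMr ?hint_gt0// mul1r -Gint_wint.
exact: hint_le_Gint.
Qed.

Lemma hratio_psia_itv mu a : 0 <= hratio mu (psia a) <= hratio mu psiG.
Proof.
have h0 := hint_gt0 k0 mu; apply/andP; split.
  rewrite divr_ge0 ?(ltW h0)//; apply: Rintegral_ge0 => x _.
  by rewrite !mulr_ge0 ?gauss_ge0 ?cdf_of_ge0.
rewrite /hratio ler_pM2r ?invr_gt0//; apply: le_Rintegral => //.
- exact: (tame_integrable_weighted k0 kE mu (tame_psia a)).
- exact: (tame_integrable_weighted k0 kE mu tame_psiG).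
- move=> x _; rewrite ler_wpM2l ?gauss_ge0// ler_piMr ?gauss_ge0//.
  exact: cdf_of_le1.
Qed.

(** The updated distribution function is a truncated integral of G divided by the full one, so the
    truncated integration by parts applies. The denominators are at least kappa because [Gint]
    dominates [hint]. *)
Lemma close_update e kappa mu nu : 0 <= e -> 0 < kappa ->
  kappa <= hint mu -> kappa <= hint nu -> close e mu nu ->
  close (2 * (LA * K) / kappa * e) (update c mu) (update c nu).
Proof.
move=> e0 kap0 kmu knu munu a; rewrite !cdf_of_update.
have d0 : 0 <= e * (LA * K) by rewrite !mulr_ge0.
have psiG0 : `|psiG 0| <= LA.
  rewrite /psiG gaussE expr0n/= mulr0 mul0r expR0 normr1 /LA lerDr.
  by rewrite mulr_ge0// addr_ge0.
have hG : `|Gint c mu - Gint c nu| <= e * (LA * K).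
  rewrite !Gint_wint.
  exact: (tame_integral_dist c0 ck' tame_psiG psiG0 munu).
have hA : `|\int[mu]_(x in `]-oo, a]) G x - \int[nu]_(x in `]-oo, a]) G x| <= e * (LA * K).
  have := tame_partial_integral_dist c0 ck' tame_psiG psiG0 munu a.
  under eq_Rintegral do rewrite psiGE.
  by under [X in `|_ - X|]eq_Rintegral do rewrite psiGE.
apply: le_trans (quotient_dist kap0 _ _ d0 hA hG _) _.
- exact: le_trans (hint_le_Gint mu).
- exact: le_trans (hint_le_Gint nu).
- have G0 := Gint_gt0 c nu.
  have -> : \int[nu]_(x in `]-oo, a]) G x = cdf_of (update c nu) a * Gint c nu.
    by rewrite cdf_of_update divfK// gt_eqF.
  rewrite mulr_ge0 ?(ltW G0) ?cdf_of_ge0//=.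
  by rewrite ler_piMl ?(ltW G0) ?cdf_of_le1.
- rewrite le_eqVlt; apply/orP; left; apply/eqP; ring.
Qed.

(** The way back from test functions to the Kolmogorov distance; it costs one application of the
    filter. *)
Lemma close_filter_step d mu nu :
  (forall L psi dpsi, tame L psi dpsi ->
    `|hratio mu psi - hratio nu psi| <= d * L) ->
  0 <= d -> close (2 * (d * LA)) (Phi mu) (Phi nu).
Proof.
move=> munu d0 a; rewrite !cdf_of_filter_step_hratio.
rewrite -[leRHS]divr1; apply: quotient_dist => //.
- exact: hratio_psiG_ge1.
- exact: hratio_psiG_ge1.
- by rewrite mulr_ge0.
- exact: munu (tame_psia a).
- exact: munu tame_psiG.
- exact: hratio_psia_itv.
Qed.

Section sequences.
Variables (eta : probability mR R) (mu nu : nat -> probability mR R) (e : R).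

(** Half the initial mass, so that the induction starts from 2 * kappa, capped by the threshold of
    [hint_filter_step_lower]. *)
Let kappa := Num.min (hint eta / 2) (lam ^+ 2 * hlow sigma c k / 8).
(** The cost of one local error in [hratio_dist], summed over a geometric series of ratio tau. *)
Let Cr := (K / kappa + (K / kappa) ^+ 2) / (1 - tau).

(** The exact laws arise from a different construction and are compared with Phi on measurable sets,
    hence equations between values rather than between measures. *)
Hypothesis nu0E : forall A, measurable A -> nu 0%N A = eta A.
Hypothesis nuSE : forall n A, measurable A -> nu n.+1 A = Phi (nu n) A.
Hypotheses (e0 : 0 <= e) (eK : e * K <= kappa).
Hypothesis munu0 : close e (mu 0%N) (nu 0%N).

Let kappa_gt0 : 0 < kappa.
Proof.
rewrite lt_min divr_gt0 ?hint_gt0//= divr_gt0// mulr_gt0 ?hlow_gt0//.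
by rewrite exprn_gt0// doob_lam_gt0.
Qed.

Let Cr0 : 0 <= Cr.
Proof.
have K1 : 0 <= K / kappa by rewrite divr_ge0// ltW.
rewrite divr_ge0//; first by rewrite addr_ge0// sqr_ge0.
by rewrite subr_ge0 ltW// doob_tau_lt1.
Qed.

Let hratio_nuS n psi : hratio (nu n.+1) psi = hratio (Phi (nu n)) psi.
Proof.
have eqw f : wint (nu n.+1) f = wint (Phi (nu n)) f.
  by apply: eq_Rintegral_measure => A mA; exact: nuSE.
by rewrite /hratio /hint !eqw.
Qed.

Let hint_nuS n : hint (nu n.+1) = hint (Phi (nu n)).
Proof. by apply: eq_Rintegral_measure => A mA; exact: nuSE. Qed.

Let cdf_nuS n a : cdf_of (nu n.+1) a = cdf_of (Phi (nu n)) a.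
Proof. by rewrite /cdf_of nuSE. Qed.

(** A local error takes at most e * K <= kappa away from 2 * kappa. *)
Let close_hint pi pi' : close e pi pi' -> 2 * kappa <= hint pi' -> kappa <= hint pi.
Proof.
move=> /(hint_dist k0 kE); rewrite distrC => h k2.
have := le_trans (ler_norm _) (le_trans h eK).
by rewrite lerBlDr; move: k2; lra.
Qed.

Let stepL pi : kappa <= hint pi -> 2 * kappa <= hint (Phi pi).
Proof.
move=> h; apply: (hint_filter_step_lower k0 kE h).
by rewrite /kappa ge_min lexx orbT.
Qed.

Let nu_lower n : 2 * kappa <= hint (nu n).
Proof.
elim: n => [|n IHn]; last first.
  rewrite hint_nuS; apply: stepL; apply: le_trans IHn.
  by rewrite ler_peMl ?(ltW kappa_gt0)// ler1n.
have -> : hint (nu 0%N) = hint eta.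
  by apply: eq_Rintegral_measure => A mA; exact: nu0E.
have : kappa <= hint eta / 2 by rewrite /kappa ge_min lexx.
by lra.
Qed.

Let nu_lower1 n : kappa <= hint (nu n).
Proof.
by apply: le_trans (nu_lower n); rewrite ler_peMl ?(ltW kappa_gt0)// ler1n.
Qed.

(** The bounds need one another: the lower bound on [hint] lets [hratio_dist] convert the new local
    error, and the bound on averages at time n gives closeness at time n + 1 by
    [close_filter_step]. *)
Lemma filter_stability_rec n :
  (forall m, (m < n)%N -> close e (mu m.+1) (Phi (mu m))) ->
  [/\ kappa <= hint (mu n),
      forall L psi dpsi, tame L psi dpsi ->
        `|hratio (mu n) psi - hratio (nu n) psi| <= Cr * e * L &
      close ((1 + 2 * (Cr * LA)) * e) (mu n) (nu n)].
Proof.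
have tau0 := doob_tau_ge0 rho sigma c k; have tau1 := doob_tau_lt1 k0 kE.
have t10 : 0 < 1 - tau by rewrite subr_gt0.
have CrE : K / kappa + (K / kappa) ^+ 2 = Cr * (1 - tau).
  by rewrite /Cr divfK// gt_eqF.
have e1 : e <= (1 + 2 * (Cr * LA)) * e.
  rewrite mulrDl mul1r lerDl; apply: mulr_ge0 => //; apply: mulr_ge0 => //.
  exact: mulr_ge0.
elim: n => [_|n IHn munuS].
  have k1 := close_hint munu0 (nu_lower 0).
  split => //; last by move=> a; apply: le_trans (munu0 a) e1.
  move=> L psi dpsi psiL.
  apply: le_trans (hratio_dist k0 kE e0 kappa_gt0 k1 (nu_lower1 0) munu0 psiL) _.
  rewrite mulrAC; apply: ler_wpM2r; first exact: tame_ge0 psiL.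
  by rewrite CrE; apply: ler_wpM2r => //; rewrite ler_piMr// lerBlDr lerDl.
have [|kn hn cn] := IHn; first by move=> m mn; apply: munuS; exact: leqW.
have munu1 := munuS n (ltnSn n).
have kS := close_hint munu1 (stepL kn).
have kS' : kappa <= hint (Phi (mu n)).
  by apply: le_trans (stepL kn); rewrite ler_peMl ?(ltW kappa_gt0)// ler1n.
split => //.
- move=> L psi dpsi psiL; rewrite hratio_nuS.
  have d1 := hratio_dist k0 kE e0 kappa_gt0 kS kS' munu1 psiL.
  have d2 := hn _ _ _ (tame_doob k0 kE psiL).
  rewrite -!(hratio_filter_step k0 kE _ psiL) in d2.
  apply: le_trans (ler_distD (hratio (Phi (mu n)) psi) _ _) _.
  apply: le_trans (lerD d1 d2) _.
  (* The new local error contributes Cr * (1 - tau) * e * L and the inherited one Cr * e * (tau *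
     L). *)
  rewrite le_eqVlt; apply/orP; left; apply/eqP.
  by rewrite CrE; ring.
- move=> a; rewrite cdf_nuS.
  apply: le_trans (ler_distD (cdf_of (Phi (mu n)) a) _ _) _.
  rewrite mulrDl mul1r; apply: lerD; first exact: munu1.
  have := close_filter_step hn (mulr_ge0 Cr0 e0) a.
  move=> h; apply: le_trans h _.
  by rewrite le_eqVlt; apply/orP; left; apply/eqP; ring.
Qed.

End sequences.

(** A deterministic statement about any sequence with small local errors. The quantifier order makes
    C and e1 independent of the time n, and they depend on [eta] only through [hint eta]. *)
Theorem filter_stability (eta : probability mR R) : exists C e1 : R,
  [/\ 0 < C, 0 < e1 & forall (mu nu : nat -> probability mR R) e n,
    (forall A, measurable A -> nu 0%N A = eta A) ->
    (forall m A, measurable A -> nu m.+1 A = Phi (nu m) A) ->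
    0 <= e -> e <= e1 -> close e (mu 0%N) (nu 0%N) ->
    (forall m, (m < n)%N -> close e (mu m.+1) (Phi (mu m))) ->
    close (C * e) (mu n) (nu n) /\
    close (C * e) (update c (mu n)) (update c (nu n))].
Proof.
pose kappa := Num.min (hint eta / 2) (lam ^+ 2 * hlow sigma c k / 8).
pose Cr := (K / kappa + (K / kappa) ^+ 2) / (1 - tau).
pose C1 := 1 + 2 * (Cr * LA).
pose C2 := 2 * (LA * K) / kappa * C1.
have kap0 : 0 < kappa.
  rewrite lt_min divr_gt0 ?hint_gt0//= divr_gt0// mulr_gt0 ?hlow_gt0//.
  by rewrite exprn_gt0// doob_lam_gt0.
have K1 : 0 <= K / kappa by rewrite divr_ge0// ltW.
have Cr0 : 0 <= Cr.
  rewrite divr_ge0//; first by rewrite addr_ge0// sqr_ge0.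
  by rewrite subr_ge0 ltW// doob_tau_lt1.
have C10 : 0 < C1 by rewrite ltr_pwDl// mulr_ge0// mulr_ge0.
have C20 : 0 <= C2.
  apply: mulr_ge0; last exact: ltW.
  by rewrite divr_ge0 ?(ltW kap0)// mulr_ge0// mulr_ge0.
(* C1 serves the predictive laws and C2 the updated ones. The denominator K + 1 is positive even for
   K = 0 and still gives e * K <= kappa. *)
exists (C1 + C2), (kappa / (K + 1)); split.
- exact: ltr_wpDr.
- by rewrite divr_gt0// ltr_wpDl.
move=> mu nu e n nu0E nuSE e0 ee1 munu0 munuS.
have eK : e * K <= kappa.
  rewrite -[leRHS](@divfK _ (K + 1)) ?gt_eqF ?ltr_wpDl//.
  by apply: ler_pM => //; rewrite lerDl.
have [kn _ cn] := filter_stability_rec nu0E nuSE e0 eK munu0 munuS.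
(* The exact filter is a perturbed filter with error 0, so the recursion applied to [nu] itself
   gives its lower bound. *)
have kn' : kappa <= hint (nu n).
  have := @filter_stability_rec eta nu nu 0 nu0E nuSE (lexx 0).
  rewrite mul0r => /(_ (ltW kap0)).
  have cl m : close 0 (nu m.+1) (Phi (nu m)).
    by move=> a; rewrite /cdf_of nuSE// subrr normr0.
  have c00 : close 0 (nu 0%N) (nu 0%N) by move=> a; rewrite subrr normr0.
  by move=> /(_ c00 n (fun m _ => cl m))[].
have cu := close_update (mulr_ge0 (ltW C10) e0) kap0 kn kn' cn.
split=> a; [apply: le_trans (cn a) _|apply: le_trans (cu a) _].
- by apply: (ler_wpM2r e0); rewrite lerDl.
- by rewrite (mulrA (2 * (LA * K) / kappa) C1 e); apply: (ler_wpM2r e0); rewrite lerDr ltW.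
Qed.

End filter_stability.

(** * The exact filter as an iteration of one step *)

Section mnormalize.
Context d (T : measurableType d) (R : realType).
Variables (q : {measure set T -> \bar R}) (P : probability T R) (m : R).
Hypotheses (m0 : 0 < m) (qT : q [set: T] = m%:E).

Lemma mnormalizeE (A : set T) : (mnormalize q P A = (m^-1)%:E * q A)%E.
Proof. by rewrite /mnormalize/= qT eqe gt_eqF//= muleC. Qed.

Lemma integral_mnormalize (f : T -> \bar R) :
  (forall x, 0 <= f x)%E -> measurable_fun [set: T] f ->
  (\int[mnormalize q P]_x f x = (m^-1)%:E * \int[q]_x f x)%E.
Proof.
move=> f0 mf.
rewrite (@integral_density _ T R q (mnormalize q P) (cst m^-1))//.
- under eq_integral do rewrite muleC/=.
  by rewrite ge0_integralZl// lee_fin invr_ge0 ltW.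
- by move=> x; rewrite invr_ge0 ltW.
- by move=> A mA; rewrite [LHS]mnormalizeE; exact: (esym (integral_cst q mA (m^-1)%:E)).
Qed.

End mnormalize.

Section exact_filter.
Context {R : realType}.
Variables (rho : R) (sigma c : {posnum R}).
Local Notation mR := (measurableTypeR R).
Local Notation Phi := (filter_step rho sigma c).
Local Notation M := (M rho sigma).
Local Notation G := (Defs.G c).
Local Notation Q := (Q rho sigma c).
Local Notation Qiter := (Qiter rho sigma c).

(** [Qiter] splits off the first factor of the product, whereas the filter recursion appends a last
    one. *)
Lemma Qiter_comp n z (A : set mR) : measurable A ->
  (Qiter n.+2 z A = \int[Qiter n.+1 z]_w Q w A)%E.
Proof.
move=> mA; elim: n z => [//|n IHn] z.
have QA0 : forall w, (0 <= Q w A)%E by move=> w; exact: measure_ge0.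
have mQA : measurable_fun [set: mR] (Q ^~ A) by exact: measurable_kernel.
transitivity (\int[Q z]_y \int[Qiter n.+1 y]_w Q w A)%E.
  by apply: eq_integral => y _; exact: IHn.
rewrite -(integral_mkernel (Q z) (Qiter n.+1) QA0 mQA).
exact: eq_measure_integral.
Qed.

Lemma Gmeasure_predict (pi : probability mR R) (A : set mR) : measurable A ->
  (Gmeasure c (predict rho sigma pi) A = \int[pi]_z Q z A)%E.
Proof.
move=> mA; rewrite /Gmeasure integral_mkcond.
have f0 x : (0 <= ((fun x => (G x)%:E) \_ A) x)%E.
  by rewrite patchE; case: ifPn => // _; rewrite lee_fin ltW// G_gt0.
have mf : measurable_fun [set: mR] ((fun x : mR => (G x)%:E) \_ A).
  apply/(measurable_restrictT _ _).1 => //; apply: measurable_funTS.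
  by apply/measurable_EFinP; exact: measurable_G.
rewrite (eq_measure_integral (mkernel pi M))//.
rewrite integral_mkernel//; apply: eq_integral => z _.
by rewrite -integral_mkcond.
Qed.

Section normalized.
Variables (q : {measure set mR -> \bar R}) (P : probability mR R) (m : R).
Hypotheses (m0 : 0 < m) (qT : q [set: mR] = m%:E).
Let pi : probability mR R := mnormalize q P.
Let g := Gint c (predict rho sigma pi).

Let qQ (A : set mR) : measurable A ->
  (mkernel q Q A = m%:E * Gmeasure c (predict rho sigma pi) A)%E.
Proof.
move=> mA; rewrite Gmeasure_predict// (integral_mnormalize P m0 qT)//.
  by rewrite muleA -EFinM divff ?gt_eqF// mul1e.
exact: measurable_kernel.
Qed.

Lemma mkernel_Q_setT : mkernel q Q [set: mR] = (m * g)%:E.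
Proof. by rewrite qQ// EFinM; congr (_ * _)%E; exact: Gmeasure_setT. Qed.

(** Normalization is a rescaling, so normalizing before Q acts changes nothing after the final
    normalization. The mass m > 0 keeps both sides away from the default value of [mnormalize]. *)
Lemma update_predict_mnormalize (P' : probability mR R) (A : set mR) :
  measurable A ->
  update c (predict rho sigma pi) A = mnormalize (mkernel q Q) P' A.
Proof.
move=> mA; have G0 : 0 < g := Gint_gt0 c (predict rho sigma pi).
transitivity ((g^-1)%:E * Gmeasure c (predict rho sigma pi) A)%E.
  exact: (mnormalizeE _ G0 (Gmeasure_setT c (predict rho sigma pi))).
symmetry; transitivity (((m * g)^-1)%:E * mkernel q Q A)%E.
  exact: (mnormalizeE _ (mulr_gt0 m0 G0) mkernel_Q_setT).
rewrite qQ// muleA -EFinM; congr (_%:E * _)%E.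
by rewrite invfM mulrAC mulVf ?mul1r// gt_eqF.
Qed.

End normalized.

Lemma mkernel_QiterS (pi : {measure set mR -> \bar R}) n A : measurable A ->
  mkernel pi (Qiter n.+2) A = mkernel (mkernel pi (Qiter n.+1)) Q A.
Proof.
move=> mA; rewrite [RHS]/mkernel integral_mkernel//; last exact: measurable_kernel.
by apply: eq_integral => z _; exact: Qiter_comp.
Qed.

Section eta_sequence.
Variable eta1 : probability mR R.
Local Notation eta_hat := (eta_hat rho sigma c eta1).
Local Notation eta_pred := (eta_pred rho sigma c eta1).

(** Indexed from 0: [eta_seq n] is the predictive law at time n + 1, here with its structure of
    probability measure. *)
Definition eta_seq n : probability mR R :=
  if n is n'.+1 then predict rho sigma (eta_hat n) else eta1.

Lemma eta_seq_pred n A : eta_seq n A = eta_pred n.+1 A.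
Proof. by case: n. Qed.

Let eta_hat1T : eta_hat1 c eta1 [set: mR] = (1 : R)%:E.
Proof. exact: probability_setT. Qed.

(** Excludes the default branch of every [mnormalize] in [eta_hat]. *)
Let mass n : exists2 m : R, 0 < m &
  mkernel (eta_hat1 c eta1) (Qiter n.+1) [set: mR] = m%:E.
Proof.
elim: n => [|n [m m0 mE]].
  eexists; last exact: (mkernel_Q_setT eta1 ltr01 eta_hat1T).
  by rewrite mul1r Gint_gt0.
eexists; last first.
  by rewrite mkernel_QiterS//; exact: (mkernel_Q_setT eta1 m0 mE).
by rewrite mulr_gt0// Gint_gt0.
Qed.

Let eq_mnormalize (q q' : {measure set mR -> \bar R}) (P : probability mR R) (A : set mR) :
  measurable A -> (forall B, measurable B -> q B = q' B) ->
  mnormalize q P A = mnormalize q' P A.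
Proof. by move=> mA qq; rewrite /mnormalize qq//; case: ifP => // _; rewrite qq. Qed.

Lemma eta_hat_update n A : measurable A -> eta_hat n.+1 A = update c (eta_seq n) A.
Proof.
move=> mA; case: n => [//|[|n]].
  (* At time 2 the iterate is Q itself and no earlier factor can be split off. *)
  transitivity (mnormalize (Gmeasure c (eta_seq 1)) eta1 A); last first.
    by rewrite [LHS]mnormalize_GmeasureE// [RHS]mnormalize_GmeasureE.
  apply: eq_mnormalize => // B mB.
  by symmetry; exact: Gmeasure_predict.
have [m m0 mE] := mass n.
symmetry; transitivity (mnormalize (mkernel (mkernel (eta_hat1 c eta1) (Qiter n.+1)) Q) eta1 A).
  exact: (update_predict_mnormalize eta1 m0 mE).
apply: eq_mnormalize => // B mB.
by symmetry; exact: mkernel_QiterS.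
Qed.

Lemma eta_seqS n A : measurable A -> eta_seq n.+1 A = Phi (eta_seq n) A.
Proof.
by move=> mA; apply: eq_measure_integral => B mB _; exact: eta_hat_update.
Qed.

End eta_sequence.
End exact_filter.

(** * Union bound and Hoeffding's inequality *)

Section union_bound.
Local Open Scope ereal_scope.
Context d (T : measurableType d) (R : realType) (mu : {measure set T -> \bar R}).

Lemma measure_union_bound (I : Type) (s : seq I) (Q : pred I) (F : I -> set T) (A : set T) :
  measurable A -> (forall i, Q i -> measurable (F i)) ->
  A `<=` \big[setU/set0]_(i <- s | Q i) F i ->
  mu A <= \sum_(i <- s | Q i) mu (F i).
Proof.
move=> mA mF AF.
have mU r : measurable (\big[setU/set0]_(i <- r | Q i) F i).
  by elim/big_ind: _ => //; exact: measurableU.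
apply: (@le_trans _ _ (mu (\big[setU/set0]_(i <- s | Q i) F i))).
  by apply: le_measure; rewrite ?inE.
elim: {AF} s => [|i s IHs]; first by rewrite !big_nil measure0.
rewrite !big_cons; case: ifPn => // Qi.
apply: le_trans (measureU2 _ _ _) _ => //; first exact: mF.
exact: leeD.
Qed.

Lemma finite_union_bound (I : finType) (Q : pred I) (F : I -> set T) (A : set T) :
  measurable A -> (forall i, Q i -> measurable (F i)) ->
  (forall x, A x -> exists2 i, Q i & F i x) ->
  mu A <= \sum_(i | Q i) mu (F i).
Proof.
move=> mA mF AF; apply: measure_union_bound => // x /AF[i Qi Fi].
by rewrite -bigcup_seq_cond; exists i => //=; rewrite mem_index_enum.
Qed.

End union_bound.

Section hoeffding.
Context {R : realType}.
Implicit Types p e l y : R.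

(** From 1 - y <= exp(-y), hence exp y <= 1 / (1 - y). *)
Lemma expR_quadratic y : `|y| <= 1 / 2 -> expR y <= 1 + y + 2 * y ^+ 2.
Proof.
rewrite ler_norml => /andP[y1 y2].
have y10 : 0 < 1 - y by move: y2; lra.
have h : 1 - y <= expR (- y) by exact: expR_ge1Dx.
rewrite -[y in expR y]opprK expRN.
apply: (@le_trans _ _ (1 - y)^-1); first by rewrite lef_pV2// posrE expR_gt0.
rewrite -[leLHS]mul1r ler_pdivrMr//.
have : 0 <= y ^+ 2 * (1 - 2 * y) by rewrite mulr_ge0 ?sqr_ge0//; move: y2; lra.
nra.
Qed.

(** The first-order terms cancel by centring, and p * (1 - p) <= 1 / 4. The constant 1 / 2 replaces
    the sharp 1 / 8, at the price of restricting l. *)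
Lemma bernoulli_mgf p l : 0 <= p <= 1 -> 0 <= l <= 1 / 2 ->
  p * expR (l * (1 - p)) + (1 - p) * expR (- l * p) <= expR (l ^+ 2 / 2).
Proof.
move=> /andP[p0 p1] /andP[l0 l1].
have h1 : expR (l * (1 - p)) <= 1 + l * (1 - p) + 2 * (l * (1 - p)) ^+ 2.
  by apply: expR_quadratic; rewrite ger0_norm ?mulr_ge0 ?subr_ge0//; nra.
have h2 : expR (- l * p) <= 1 + - l * p + 2 * (- l * p) ^+ 2.
  by apply: expR_quadratic; rewrite mulNr normrN ger0_norm ?mulr_ge0//; nra.
apply: (@le_trans _ _ (1 + l ^+ 2 / 2)); last exact: expR_ge1Dx.
have q0 : 0 <= 1 - p by rewrite subr_ge0.
apply: le_trans (lerD (ler_wpM2l p0 h1) (ler_wpM2l q0 h2)) _.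
rewrite [leLHS](_ : _ = 1 + 2 * l ^+ 2 * (p * (1 - p))); last by ring.
rewrite lerD2l.
have : p * (1 - p) <= 1 / 4 by have := sqr_ge0 (2 * p - 1); nra.
move=> h; apply: le_trans (ler_wpM2l _ h) _; first by rewrite mulr_ge0 ?sqr_ge0.
by rewrite le_eqVlt; apply/orP; left; apply/eqP; field.
Qed.

Context d (Omega : measurableType d) (P : probability Omega R) (N : nat).
Variables (A : 'I_N -> set Omega) (p : R).
Hypothesis mA : forall n, measurable (A n).

Let cell (f : {ffun 'I_N -> bool}) (n : 'I_N) := if f n then A n else ~` A n.

(** Independence with common probability p, written as the probabilities of all 2^N success
    patterns. This form is symmetric under complements and reduces exponential moments to finite
    sums. *)
Definition independent_events := forall f : {ffun 'I_N -> bool},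
  P (\bigcap_(n in [set: 'I_N]) cell f n) = (\prod_n (if f n then p else 1 - p))%:E.

Hypothesis indep : independent_events.
Hypothesis p01 : 0 <= p <= 1.

Definition frequency (omega : Omega) : R := (\sum_n \1_(A n) omega) / N%:R.

Lemma hoeffding_upper e : 0 < e <= 1 ->
  (P [set omega | (p + e < frequency omega)%R] <= (expR (- (3 / 8 * N%:R * e ^+ 2)))%:E)%E.
Proof.
move=> /andP[e0 e1]; case/andP: (p01) => p0 p1.
(* The choice keeps l <= 1 / 2, as [bernoulli_mgf] requires, and l^2 / 2 - l * e = - 3 / 8 * e^2 is
   the exponent of the bound. *)
pose l := e / 2.
have l01 : 0 <= l <= 1 / 2 by rewrite /l; apply/andP; split; lra.
have [N0|N0] := posnP N.
  rewrite (_ : [set _ | _] = set0) ?measure0 ?lee_fin ?expR_ge0//.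
  apply/seteqP; split=> // omega /=; rewrite /frequency big1; last first.
    by move=> n _; have := ltn_ord n; rewrite [X in (_ < X)%N]N0.
  by rewrite mul0r; lra.
have NR0 : 0 < N%:R :> R by rewrite ltr0n.
pose cnt (f : {ffun 'I_N -> bool}) : R := \sum_n (f n)%:R.
have mcell f : measurable (\bigcap_(n in [set: 'I_N]) cell f n).
  apply: fin_bigcap_measurable; first exact: finite_finset.
  by move=> n _; rewrite /cell; case: (f n) => //; exact: measurableC.
have mfreq : measurable_fun [set: Omega] frequency.
  apply: measurable_funM => //; apply: measurable_sum => n.
  exact: measurable_indic.
apply: (@le_trans _ _ (\sum_(f : {ffun 'I_N -> bool} | (N%:R * (p + e) < cnt f)%R)
    P (\bigcap_(n in [set: 'I_N]) cell f n))%E).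
  apply: finite_union_bound => //.
    rewrite -[X in measurable X]setTI.
    by apply: (measurable_fun_ltr _ mfreq measurableT (Y := [set true])).
  move=> omega /= h; exists [ffun n => omega \in A n].
    move: h; rewrite /frequency ltr_pdivlMr// mulrC => /lt_le_trans; apply.
    by rewrite le_eqVlt; apply/orP; left; apply/eqP; apply: eq_bigr => n _; rewrite ffunE indicE.
  move=> n _; rewrite /cell ffunE; case: ifPn; rewrite ?inE// => /negP h'.
  by move=> An; apply: h'; rewrite inE.
under eq_bigr do rewrite indep.
rewrite sumEFin lee_fin.
pose w (n : 'I_N) (b : bool) : R := if b then p * expR (l * (1 - p)) else (1 - p) * expR (- l * p).
have wE (f : {ffun 'I_N -> bool}) : \prod_n w n (f n) =
    (\prod_n (if f n then p else 1 - p)) * expR (l * (cnt f - N%:R * p)).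
  rewrite (_ : l * _ = \sum_(n < N) (l * ((f n)%:R - p))); last first.
    rewrite -mulr_sumr sumrB sumr_const card_ord.
    by rewrite -[p *+ N]mulr_natl.
  rewrite expR_sum -big_split/=; apply: eq_bigr => n _; rewrite /w.
  by case: (f n); rewrite ?sub0r ?mulrN ?mulNr.
apply: (@le_trans _ _ (\sum_(f : {ffun 'I_N -> bool})
    expR (- (l * N%:R * e)) * \prod_n w n (f n))).
  rewrite [leRHS](bigID (fun f => N%:R * (p + e) < cnt f))/= -[leLHS]addr0.
  have w0 f : 0 <= \prod_n w n (f n).
    apply: prodr_ge0 => n _; rewrite /w; case: (f n); rewrite mulr_ge0 ?expR_ge0//.
    by rewrite subr_ge0.
  apply: lerD; last by apply: sumr_ge0 => f _; rewrite mulr_ge0 ?expR_ge0.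
  apply: ler_sum => f fN; rewrite wE mulrCA -expRD ler_peMr//.
    by apply: prodr_ge0 => n _; case: (f n); rewrite ?subr_ge0.
  rewrite -[leLHS]expR0 ler_expR addrC subr_ge0 -mulrA; apply: ler_wpM2l; first by case/andP: l01.
  by rewrite lerBrDr -mulrDr addrC ltW.
(* The sum over all patterns of products factors into a product of two-term sums, each an
   exponential moment of one centred indicator. *)
rewrite -mulr_sumr -(bigA_distr_bigA w).
have wb n : \sum_(b : bool) w n b <= expR (l ^+ 2 / 2).
  by rewrite big_bool/=; exact: bernoulli_mgf.
apply: (@le_trans _ _ (expR (- (l * N%:R * e)) * \prod_(n < N) expR (l ^+ 2 / 2))).
  rewrite ler_wpM2l ?expR_ge0//; apply: ler_prod => n _; rewrite wb andbT.
  rewrite big_bool/= addr_ge0// mulr_ge0 ?expR_ge0//.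
  by rewrite subr_ge0.
rewrite prodr_const card_ord -expRM_natl -expRD ler_expR /l -mulr_natl.
rewrite le_eqVlt; apply/orP; left; apply/eqP; by field.
Qed.

End hoeffding.

Section hoeffding_two_sided.
Context (R : realType) d (Omega : measurableType d) (P : probability Omega R) (N : nat).
Variables (A : 'I_N -> set Omega) (p : R).
Hypothesis mA : forall n, measurable (A n).
Hypothesis indep : independent_events P A p.
Hypothesis p01 : 0 <= p <= 1.
Hypothesis N0 : (0 < N)%N.

Let NR0 : (N%:R : R) != 0. Proof. by rewrite pnatr_eq0 -lt0n. Qed.

Let A' n := ~` A n.

Let mA' n : measurable (A' n). Proof. exact: measurableC. Qed.

Let indep' : independent_events P A' (1 - p).
Proof.
move=> f; have := indep [ffun n => ~~ f n].
rewrite (_ : \bigcap_(n in _) _ = \bigcap_(n in [set: 'I_N]) if f n then A' n else ~` A' n).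
  move=> ->; congr (_%:E); apply: eq_bigr => n _; rewrite ffunE.
  by case: (f n) => //=; rewrite subKr.
by apply: eq_bigcapr => n _; rewrite ffunE /A'; case: (f n) => //=; rewrite setCK.
Qed.

Let p01' : 0 <= 1 - p <= 1.
Proof. by case/andP: p01 => p0 p1; apply/andP; split; lra. Qed.

Let frequencyC omega : frequency A' omega = 1 - frequency A omega :> R.
Proof.
rewrite /frequency; apply: (mulIf NR0); rewrite mulrBl mul1r !divfK//.
have -> : N%:R = \sum_(n < N) (1 : R) by rewrite sumr_const card_ord.
rewrite -sumrB; apply: eq_bigr => n _.
rewrite /A' !indicE; have [h|h] := boolP (omega \in A n).
  by rewrite memNset ?subrr//= => h'; move: h; rewrite inE.
by rewrite subr0 mem_set//= => h'; move: h; rewrite mem_set.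
Qed.

Lemma measurable_frequency : measurable_fun [set: Omega] (frequency A : Omega -> R).
Proof.
by apply: measurable_funM => //; apply: measurable_sum => n; exact: measurable_indic.
Qed.

(** The lower tail is the upper tail of the complementary events. *)
Lemma hoeffding e : 0 < e <= 1 ->
  (P [set omega | (e < `|frequency A omega - p|)%R] <=
   (2 * expR (- (3 / 8 * N%:R * e ^+ 2)))%:E)%E.
Proof.
move=> e01.
have m1 : measurable [set omega | p + e < frequency A omega].
  rewrite -[X in measurable X]setTI.
  exact: (measurable_fun_ltr _ measurable_frequency measurableT (Y := [set true])).
have m2 : measurable [set omega | (1 - p) + e < frequency A' omega].
  rewrite (_ : [set _ | _] = [set omega | frequency A omega < p - e]).
    rewrite -[X in measurable X]setTI.
    exact: (measurable_fun_ltr measurable_frequency _ measurableT (Y := [set true])).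
  by apply/seteqP; split=> omega /=; rewrite frequencyC; lra.
have mE : measurable [set omega | e < `|frequency A omega - p|].
  rewrite -[X in measurable X]setTI.
  apply: (measurable_fun_ltr (g := fun omega => `|frequency A omega - p|) _ _ measurableT (Y := [set true])) => //.
  apply: measurableT_comp => //; apply: measurable_funB => //.
  exact: measurable_frequency.
apply: (@le_trans _ _ (P [set omega | (p + e < frequency A omega)%R] +
                       P [set omega | ((1 - p) + e < frequency A' omega)%R])%E).
  rewrite (le_trans _ (measureU2 _ m1 m2))//; apply: le_measure; rewrite ?inE//.
    exact: measurableU.
  move=> omega /=; rewrite frequencyC lter_normr => /orP[h|h]; [left|right]; lra.
rewrite mulrDl mul1r EFinD; apply: leeD.
- exact: hoeffding_upper.
- exact: hoeffding_upper.
Qed.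

End hoeffding_two_sided.

(** * Quantiles and distribution functions *)

Section quantile.
Context {R : realType}.
Local Notation mR := (measurableTypeR R).
Implicit Types (pi : probability mR R).

Section cdf_limits.
Variable pi : probability mR R.

Let idTR : mR -> R := idfun.

#[local] HB.instance Definition _ :=
  @isMeasurableFun.Build _ _ _ _ idTR (@measurable_id _ _ setT).

Lemma cdf_of_cvgy : cdf_of pi a @[a --> +oo] --> (1 : R).
Proof. by apply: fine_cvg; exact: (cvg_cdfy1 (idTR : {RV pi >-> R})). Qed.

Lemma cdf_of_cvgNy : cdf_of pi a @[a --> -oo] --> (0 : R).
Proof. by apply: fine_cvg; exact: (cvg_cdfNy0 (idTR : {RV pi >-> R})). Qed.

Lemma cdf_of_right_continuous : right_continuous (cdf_of pi).
Proof.
move=> a; apply: fine_cvg; rewrite -cdf_of_prob.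
exact: (@cdf_right_continuous _ _ _ pi (idTR : {RV pi >-> R})).
Qed.

End cdf_limits.

(** The Galois connection between quantile and distribution function. For u in (0, 1) the infimum is
    over a nonempty set bounded below, and right continuity puts the infimum into the set. *)
Lemma quantile_le pi (u a : R) : 0 < u < 1 ->
  (quantile pi u <= a) = (u <= cdf_of pi a).
Proof.
move=> /andP[u0 u1]; pose S := [set x | u <= cdf_of pi x].
have [b bu] : exists b, cdf_of pi b < u.
  have /cvgr_lt/(_ _ u0)/filter_ex[b bu] := @cdf_of_cvgNy pi.
  by exists b.
have S0 : S !=set0.
  have /cvgr_gt/(_ _ u1)/filter_ex[a0 ua] := @cdf_of_cvgy pi.
  by exists a0; exact: ltW.
have lbS : lbound S b.
  move=> x /= ux; rewrite leNgt; apply/negP => xb.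
  by have := le_lt_trans (le_trans ux (cdf_of_nondecreasing pi (ltW xb))) bu; rewrite ltxx.
apply/idP/idP => [qa|ua]; last by apply: ge_inf => //; exists b.
rewrite leNgt; apply/negP => Fa.
have /cvgr_lt/(_ _ Fa) : cdf_of pi x @[x --> a^'+] --> cdf_of pi a.
  exact: cdf_of_right_continuous.
move=> h; have [x [ax xu]] : exists x, a < x /\ cdf_of pi x < u.
  have : \forall x \near a^'+, a < x /\ cdf_of pi x < u.
    by near=> x; split; [near: x; exact: nbhs_right_gt|near: x].
  by move=> /filter_ex.
have : x <= quantile pi u.
  apply: lb_le_inf => // y /= uy; rewrite leNgt; apply/negP => yx.
  by have := le_lt_trans (le_trans uy (cdf_of_nondecreasing pi (ltW yx))) xu; rewrite ltxx.
by move=> /le_trans/(_ qa); rewrite leNgt ax.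
Unshelve. all: by end_near. Qed.

(** Open right rays form a generating class stable under intersection. *)
Lemma eq_cdf_of_measure (mu nu : probability mR R) :
  (forall a, cdf_of mu a = cdf_of nu a) -> forall A, measurable A -> mu A = nu A.
Proof.
move=> E.
apply: (@measure_unique _ R mR (@RGenOInfty.G R) (fun n => `](- n%:R)%R, +oo[%classic)).
- exact: RGenOInfty.measurableE.
- move=> _ _ [x ->] [y ->]; exists (Num.max x y); apply/seteqP; split=> z /=;
    by rewrite !in_itv/= !andbT gt_max => /andP.
- by move=> n; exists (- n%:R).
- apply/seteqP; split=> // x _; exists (Num.truncn `|x|).+1 => //=.
  by rewrite in_itv/= andbT ltrNl (le_lt_trans (ler_norm _))// normrN truncnS_gt.
- move=> _ [x ->].
  have mI : measurable (`]-oo, x] : set mR) by [].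
  have H (pi : probability mR R) : pi (~` `]-oo, x]%classic) = (1 - (cdf_of pi x)%:E)%E.
    by rewrite (@probability_setC _ mR R pi _ mI) cdf_of_prob.
  by rewrite -setCitvl; transitivity (1 - (cdf_of mu x)%:E)%E; [exact: H|rewrite E -H].
- by move=> k; exact: (le_lt_trans (probability_le1 _ _) (ltry _)).
Qed.

Lemma measurable_fun_ray d (T : measurableType d) (f : T -> mR) :
  (forall a, measurable [set x | f x <= a]) -> measurable_fun setT f.
Proof.
move=> mf _; apply: (measurability _ (@RGenOInfty.measurableE R)) => //.
move=> _ [_ [a ->] <-]; rewrite setTI.
rewrite (_ : _ @^-1` _ = ~` [set x | f x <= a]); first exact: measurableC.
by apply/seteqP; split=> x /=; rewrite in_itv/= andbT ltNge => /negP.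
Qed.

End quantile.

(** * Empirical measures and measurability of the particles *)

Section empirical.
Context {R : realType}.
Variables (rho : R) (sigma c : {posnum R}) (N : nat).
Local Notation mR := (measurableTypeR R).
Local Notation G := (G c).
Implicit Types x : 'I_N.+1 -> R.

Let dirac_at x (k : nat) : {measure set mR -> \bar R} := \d_(x (inord k) : mR).

Let atom x (k : nat) : {measure set mR -> \bar R} :=
  mscale (N.+1%:R^-1)%:nng (dirac_at x k).

(** [empirical] as a sum of measures, which gives it the structure of a probability. The sum is
    indexed by [nat], hence [inord] in the atoms and at least one particle. *)
Definition emp x : set mR -> \bar R := msum (atom x) N.+1.

HB.instance Definition _ x := Measure.on (emp x).

Lemma empE x A : emp x A = empirical x A.
Proof.
rewrite /emp /msum /empirical; apply: eq_bigr => i _.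
by rewrite /atom /mscale /dirac_at/= inord_val.
Qed.

Let emp_setT x : emp x [set: mR] = 1%E.
Proof.
rewrite empE /empirical; under eq_bigr do rewrite diracT mule1.
rewrite sumEFin sumr_const card_ord -[X in X%:E = _]mulr_natr mulVf//.
Qed.

HB.instance Definition _ x :=
  Measure_isProbability.Build _ _ _ (emp x) (emp_setT x).

Lemma integral_emp x (D : set mR) (f : mR -> \bar R) : measurable D -> measurable_fun D f ->
  (forall y, D y -> (0 <= f y)%E) ->
  (\int[emp x]_(y in D) f y = \sum_(n < N.+1) (N.+1%:R^-1)%:E * (\d_(x n) D * f (x n)))%E.
Proof.
move=> mD mf f0; rewrite /emp ge0_integral_measure_sum//; apply: eq_bigr => i _.
rewrite /atom ge0_integral_mscale//; congr (_ * _)%E.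
by rewrite /dirac_at integral_dirac// inord_val.
Qed.

Lemma cdf_of_emp x a :
  cdf_of (emp x) a = (\sum_(n < N.+1) (x n <= a)%R%:R) / N.+1%:R.
Proof.
rewrite /cdf_of empE /empirical mulr_suml.
rewrite (eq_bigr (fun n => ((x n <= a)%R%:R / N.+1%:R)%:E)) ?sumEFin// => n _.
rewrite diracE EFinM muleC; congr ((nat_of_bool _)%:R%:E * _)%E.
by apply/idP/idP => [/set_mem/=|h]; [|apply/mem_set => /=]; rewrite in_itv.
Qed.

(** Identifies the weighted particles with the exact update of the empirical measure, so the
    algorithm becomes a perturbed iteration of [filter_step]. *)
Lemma weighted_empirical_update x A : measurable A ->
  weighted_empirical c x A = update c (emp x : probability mR R) A.
Proof.
move=> mA; rewrite [RHS]mnormalize_GmeasureE//.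
have mG := @measurable_G R c.
have GI : Gint c (emp x : probability mR R) = (\sum_(n < N.+1) G (x n)) / N.+1%:R.
  rewrite /Gint /Rintegral integral_emp//; last first.
  - by move=> y _; rewrite lee_fin ltW// G_gt0.
  - exact/measurable_EFinP.
  rewrite mulr_suml; under eq_bigr do rewrite diracT mul1e -EFinM mulrC.
  by rewrite sumEFin.
rewrite integral_emp//; last first.
- by move=> y _; rewrite lee_fin divr_ge0 ?ltW ?G_gt0 ?Gint_gt0.
- by apply: measurable_funTS; apply/measurable_EFinP; apply: measurable_funM.
rewrite /weighted_empirical; apply: eq_bigr => n _.
rewrite [RHS]muleCA [RHS]muleC -EFinM [LHS]EFinM; congr (_ * _)%E; congr (_%:E).
rewrite GI /weight.
have S0 : 0 < \sum_(m < N.+1) G (x m).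
  rewrite big_ord_recl ltr_wpDr ?G_gt0//; apply: sumr_ge0 => i _; exact: ltW (G_gt0 _ _).
have N0 : N.+1%:R != 0 :> R by rewrite pnatr_eq0.
by move: (lt0r_neq0 S0) N0; move: (N.+1%:R : R) => y y0 S0'; field; apply/andP; split.
Qed.

End empirical.

Section particles_measurability.
Context d (D : measurableType d) {R : realType}.
Variables (rho : R) (sigma c : {posnum R}) (eta1 : probability (measurableTypeR R) R).
Variable N : nat.
Local Notation mR := (measurableTypeR R).

Lemma measurable_fun_posV (f : D -> R) : measurable_fun setT f -> (forall w, 0 < f w) ->
  measurable_fun setT (fun w => (f w)^-1).
Proof.
move=> mf f0; apply: measurable_fun_ray => a.
rewrite (_ : [set x | _] = [set w | 1 <= a * f w]).
  by apply: measurable_ler => //; exact: measurable_funM.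
by apply/funext => w /=; rewrite -ler_pdivrMr// mul1r.
Qed.

Lemma measurable_ray_indic (f : D -> mR) a : measurable_fun setT f ->
  measurable_fun setT (fun w => (f w <= a)%R%:R : R).
Proof.
move=> mf; have mS : measurable [set w | f w <= a] by apply: measurable_ler.
rewrite (_ : (fun _ => _) = \1_[set w | f w <= a]); first exact: measurable_indic.
by apply/funext => w; rewrite indicE; congr (nat_of_bool _)%:R;
  apply/idP/idP => [h|/set_mem//]; apply/mem_set.
Qed.

Lemma measurable_empirical_cdf (X : 'I_N.+1 -> D -> mR) a :
  (forall n, measurable_fun setT (X n)) ->
  measurable_fun setT (fun w => cdf_of (emp (X ^~ w)) a).
Proof.
move=> mX; under eq_fun do rewrite cdf_of_emp.
apply: measurable_funM => //; apply: measurable_sum => n.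
exact: measurable_ray_indic.
Qed.

Lemma measurable_empirical_update_cdf (X : 'I_N.+1 -> D -> mR) a :
  (forall n, measurable_fun setT (X n)) ->
  measurable_fun setT (fun w => cdf_of (update c (emp (X ^~ w))) a).
Proof.
move=> mX.
have mG n : measurable_fun setT (fun w => G c (X n w)).
  by apply: measurableT_comp (mX n); exact: measurable_G.
have EW : (fun w => cdf_of (update c (emp (X ^~ w))) a) = (fun w => \sum_(n < N.+1)
   (G c (X n w) / \sum_(m < N.+1) G c (X m w)) * (X n w <= a)%R%:R).
  apply/funext => w; rewrite /cdf_of -weighted_empirical_update// /weighted_empirical.
  rewrite (eq_bigr (fun n => ((G c (X n w) / \sum_(m < N.+1) G c (X m w)) * (X n w <= a)%R%:R)%:E)) ?sumEFin// => n _.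
  rewrite diracE EFinM; congr (_ * (nat_of_bool _)%:R%:E)%E.
  by apply/idP/idP => [/set_mem/=|h]; [|apply/mem_set => /=]; rewrite in_itv.
rewrite EW; apply: measurable_sum => n; apply: measurable_funM.
  apply: measurable_funM => //; apply: measurable_fun_posV.
    by apply: measurable_sum => m; exact: mG.
  move=> w; rewrite big_ord_recl ltr_wpDr ?G_gt0//; apply: sumr_ge0 => i _; exact: ltW (G_gt0 _ _).
exact: measurable_ray_indic.
Qed.

(** By [quantile_le] the sublevel sets compare u with a distribution function, so the law itself may
    depend measurably on the parameter. *)
Lemma measurable_quantile (pi : D -> probability mR R) (u : D -> R) :
  (forall a, measurable_fun setT (fun w => cdf_of (pi w) a)) ->
  measurable_fun setT u -> (forall w, 0 < u w < 1) ->
  measurable_fun setT (fun w => quantile (pi w) (u w)).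
Proof.
move=> mpi mu u01; apply: measurable_fun_ray => a.
rewrite (_ : [set w | _] = [set w | u w <= cdf_of (pi w) a]); first exact: measurable_ler.
by apply/funext => w /=; rewrite quantile_le.
Qed.

Definition next_particle (x : 'I_N.+1 -> R) (uv : R * R) : R :=
  quantile (M rho sigma (quantile (weighted_empirical c x) uv.1)) uv.2.

Lemma quantile_weighted_empirical (x : 'I_N.+1 -> R) u :
  quantile (weighted_empirical c x) u = quantile (update c (emp x)) u.
Proof.
rewrite /quantile; congr inf; apply/funext => a /=.
by rewrite /cdf_of weighted_empirical_update.
Qed.

Lemma measurable_next_particle (X : 'I_N.+1 -> D -> mR) (u1 u2 : D -> R) :
  (forall n, measurable_fun setT (X n)) ->
  measurable_fun setT u1 -> measurable_fun setT u2 ->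
  (forall w, 0 < u1 w < 1) -> (forall w, 0 < u2 w < 1) ->
  measurable_fun setT (fun w => next_particle (X ^~ w) (u1 w, u2 w)).
Proof.
move=> mX mu1 mu2 u1P u2P; rewrite /next_particle/=.
have mh : measurable_fun setT (fun w => quantile (weighted_empirical c (X ^~ w)) (u1 w)).
  under eq_fun do rewrite quantile_weighted_empirical.
  by apply: measurable_quantile => // a; exact: measurable_empirical_update_cdf.
apply: (@measurable_quantile (fun w => normal_prob
  (rho * quantile (weighted_empirical c (X ^~ w)) (u1 w)) sigma%:num : probability mR R)) => // a.
have mF : measurable_fun setT (fun z : mR => cdf_of (M rho sigma z) a).
  apply: measurableT_comp => //.
  by apply: (@measurable_kernel _ _ mR mR R (M rho sigma)).
exact: (measurableT_comp mF mh).
Qed.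

Lemma particlesS (u : nat -> 'I_N.+1 -> R * R) m n :
  particles rho sigma c eta1 u m.+2 n = next_particle (particles rho sigma c eta1 u m.+1) (u m.+2 n).
Proof. by []. Qed.

Lemma measurable_particles (u : D -> nat -> 'I_N.+1 -> mR * mR) m :
  (forall s n, (s <= m)%N -> measurable_fun setT (fun w => u w s.+1 n)) ->
  (forall s n w, (s <= m)%N -> 0 < (u w s.+1 n).1 < 1 /\ 0 < (u w s.+1 n).2 < 1) ->
  forall n, measurable_fun setT (fun w => particles rho sigma c eta1 (u w) m.+1 n : mR).
Proof.
have mfst (f : D -> mR * mR) : measurable_fun setT f -> measurable_fun setT (fun w => (f w).1).
  by move=> mf; apply: measurableT_comp.
have msnd (f : D -> mR * mR) : measurable_fun setT f -> measurable_fun setT (fun w => (f w).2).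
  by move=> mf; apply: measurableT_comp.
elim: m => [|m IH] mu u01 n.
  apply: (@measurable_quantile (fun=> eta1)) => //; first exact/mfst/mu.
  by move=> w; case: (u01 0 n w).
under eq_fun do rewrite particlesS.
rewrite (_ : (fun _ => _) = (fun w => next_particle
  ((fun k w => particles rho sigma c eta1 (u w) m.+1 k) ^~ w) ((u w m.+2 n).1, (u w m.+2 n).2))); last first.
  by apply/funext => w; rewrite -surjective_pairing.
apply: measurable_next_particle.
- by move=> k; apply: IH => [s k' sm|s k' w sm]; [apply: mu|apply: u01]; exact: leqW.
- exact/mfst/mu.
- exact/msnd/mu.
- by move=> w; case: (u01 m.+1 n w).
- by move=> w; case: (u01 m.+1 n w).
Qed.

End particles_measurability.

(** * Uniform deviation of empirical distribution functions *)

Section weak_dkw.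
Context d (T : measurableType d) {R : realType} (P : probability T R).
Variables (nu : probability (measurableTypeR R) R) (N : nat).
Local Notation mR := (measurableTypeR R).
Variable X : 'I_N.+1 -> T -> mR.
Hypothesis mX : forall n, measurable_fun setT (X n).
Hypothesis indepX : forall B : set mR, measurable B ->
  independent_events P (fun n => X n @^-1` B) (fine (nu B)).

Let m01 (B : set mR) : measurable B -> 0 <= fine (nu B) <= 1.
Proof.
move=> mB; apply/andP; split; first exact: fine_ge0.
by rewrite -lee_fin fineK ?probability_le1 ?fin_num_measure.
Qed.

(** The open ray is the increasing union of closed rays ending before the quantile, each of mass
    below u. *)
Lemma open_ray_quantile u : 0 < u < 1 -> fine (nu `]-oo, quantile nu u[%classic) <= u.
Proof.
move=> u01.
pose F k : set mR := `]-oo, quantile nu u - k.+1%:R^-1]%classic.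
have FU : \bigcup_k F k = (`]-oo, quantile nu u[%classic : set mR).
  apply/seteqP; split=> x /=.
    move=> [k _]; rewrite /F/= !in_itv/= => xk; apply: (le_lt_trans xk).
    by rewrite ltrBlDr ltrDl invr_gt0.
  rewrite in_itv/= => /ltr_add_invr[k xk]; exists k => //=.
  by rewrite /F/= in_itv/= lerBrDr ltW.
have mF k : measurable (F k) by rewrite /F; apply: (measurable_itv `]-oo, _]).
have cF : (nu \o F) k @[k --> \oo] --> nu (\bigcup_k F k).
  apply: nondecreasing_cvg_mu => //; first exact: bigcup_measurable.
  move=> j k jk; apply/subsetPset => x; rewrite /F/= !in_itv/= => xj; apply: (le_trans xj).
  by rewrite lerB// lef_pV2 ?posrE// ler_nat.
rewrite -lee_fin fineK ?fin_num_measure// -FU -(cvg_lim _ cF)//.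
apply: lime_le; first by apply/cvg_ex; eexists; exact: cF.
apply: nearW => k /=; rewrite cdf_of_prob lee_fin ltW// ltNge -quantile_le// -ltNge.
by rewrite ltrBlDr ltrDl invr_gt0.
Qed.

Let freq (B : set mR) w : R := frequency (fun n => X n @^-1` B) w.

Let freq_mono (B C : set mR) w : B `<=` C -> freq B w <= freq C w.
Proof.
move=> BC; rewrite /freq /frequency ler_wpM2r//; apply: ler_sum => n _; rewrite !indicE ler_nat.
have [/set_mem h|//] := boolP (w \in X n @^-1` B).
by rewrite mem_set//; exact: BC.
Qed.

Let freq_le1 (B : set mR) w : freq B w <= 1.
Proof.
rewrite /freq /frequency ler_pdivrMr// mul1r.
rewrite -[leRHS]mulr1 mulr_natl -[X in _ *+ X](card_ord N.+1) -sumr_const ler_sum// => n _.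
Qed.

(* The open and closed rays at each quantile are needed because nu may have atoms. *)
Lemma grid_dist m eta w : (0 < m)%N -> 0 <= eta ->
  (forall j : 'I_m, (0 < j)%N -> forall b : bool, let B := [set` Interval -oo%O (BSide b (quantile nu (j%:R / m%:R)))] in
   `|freq B w - fine (nu B)| <= eta) ->
  close (m%:R^-1 + eta) (emp (X ^~ w)) nu.
Proof.
move=> m0 eta0 H a.
have Ea : cdf_of (emp (X ^~ w)) a = freq `]-oo, a]%classic w.
  rewrite cdf_of_emp /freq /frequency; congr (_ / _); apply: eq_bigr => n _.
  rewrite indicE; congr (nat_of_bool _)%:R.
  by apply/idP/idP => [h|/set_mem/=]; [apply/mem_set => /=|]; rewrite in_itv.
rewrite Ea; set F := cdf_of nu a; set j := Num.truncn (m%:R * F).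
have mR0 : 0 < m%:R :> R by rewrite ltr0n.
have F0 : 0 <= F := cdf_of_ge0 nu a.
have F1 : F <= 1 := cdf_of_le1 nu a.
have /andP[jl ju] : j%:R <= m%:R * F < j.+1%:R by apply: truncn_itv; rewrite mulr_ge0// ltW.
have jm : (j <= m)%N by rewrite -(ler_nat R) (le_trans jl)// ler_piMr// ltW.
have q01 (i : nat) : (0 < i < m)%N -> 0 < (i%:R / m%:R : R) < 1.
  move=> /andP[i0 im]; rewrite divr_gt0 ?ltr0n//= ltr_pdivrMr// mul1r ltr_nat.
  by rewrite im.
rewrite ler_distl; apply/andP; split.
(* If F = 1 then j = m and has no grid point, so the index is capped at m - 1. For i = 0 the lower
   bound is not positive because F <= 1 / m. *)
- pose i := minn j m.-1.
  have il : i%:R <= m%:R * F by rewrite (le_trans _ jl)// ler_nat geq_minl.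
  have iu : m%:R * F <= i%:R + 1.
    rewrite natr1 /i /minn; case: ifPn => _; first exact: ltW.
    by rewrite prednK// ler_piMr// ltW.
  have Fi : F <= i%:R / m%:R + m%:R^-1.
    by rewrite -[X in _ + X]mul1r -mulrDl ler_pdivlMr// mulrC.
  have im : (i < m)%N by rewrite (leq_ltn_trans (geq_minr _ _))// prednK.
  have [i0|i0] := posnP i.
    apply: (@le_trans _ _ 0); last by rewrite /freq/frequency divr_ge0// sumr_ge0.
    rewrite subr_le0 (le_trans Fi)// i0 mul0r add0r lerDl//.
  have i01 := q01 i; rewrite i0 im in i01.
  have := H (Ordinal im) i0 false; rewrite /= ler_distl => /andP[+ _].
  rewrite lerBlDr; set B := [set` _] => hB.
  have nB : i%:R / m%:R <= fine (nu B) by rewrite -quantile_le// i01.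
  have fB : freq B w <= freq `]-oo, a]%classic w.
    apply: freq_mono => x; rewrite /B /= !in_itv/= => xq; apply: (le_trans xq).
    by rewrite quantile_le ?i01// ler_pdivrMr// mulrC.
  by move: Fi nB fB hB; clear; lra.
- have jF : (j.+1%:R) / m%:R <= F + m%:R^-1.
    rewrite -natr1 mulrDl mul1r lerD2r ler_pdivrMr// mulrC//.
  (* Beyond the last grid point F + 1 / m is at least 1, which bounds every frequency. *)
  have [jm'|jm'] := ltnP j.+1 m; last first.
    apply: (le_trans (freq_le1 _ _)); rewrite addrA; apply: (@le_trans _ _ (j.+1%:R / m%:R)).
      by rewrite ler_pdivlMr// mul1r ler_nat.
    by rewrite (le_trans jF)// lerDl.
  have j01 := q01 j.+1; rewrite /= jm' in j01.
  have := H (Ordinal jm') isT true; rewrite /= ler_distl => /andP[_].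
  set B := [set` _] => hB.
  have nB : fine (nu B) <= j.+1%:R / m%:R by exact: open_ray_quantile (j01 isT).
  have fB : freq `]-oo, a]%classic w <= freq B w.
    apply: freq_mono => x; rewrite /B /= !in_itv/= => xa; apply: (le_lt_trans xa).
    by rewrite ltNge quantile_le ?j01// -ltNge ltr_pdivlMr// mulrC.
  by move: jF nB fB hB; clear; lra.
Qed.

(** A union bound over at most 2 * m rays, each failing with probability at most twice an
    exponential. [A] stands for a measurable set of failures, so that measurability is settled where
    the lemma is applied. *)
Lemma weak_dkw m eta (A : set T) : (0 < m)%N -> 0 < eta <= 1 -> measurable A ->
  (forall w, A w -> ~ close (m%:R^-1 + eta) (emp (X ^~ w)) nu) ->
  (P A <= (4 * m%:R * expR (- (3 / 8 * N.+1%:R * eta ^+ 2)))%:E)%E.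
Proof.
move=> m0 eta01 mA Abad.
(* [BSide true] gives the open ray, [BSide false] the closed one. *)
pose B (i : 'I_m * bool) : set mR := [set` Interval -oo%O (BSide i.2 (quantile nu (i.1%:R / m%:R)))].
have mB i : measurable (B i) by rewrite /B; case: i => i b; apply: (measurable_itv (Interval -oo%O (BSide b _))).
have h1 : (P A <= \sum_(i : 'I_m * bool | (0 < i.1)%N) P [set w | (eta < `|freq (B i) w - fine (nu (B i))|)%R])%E.
  apply: finite_union_bound => //.
    move=> i _; apply: measurable_ltr => //; apply: measurableT_comp => //; apply: measurable_funB => //.
    apply: measurable_frequency => n.
    by rewrite -[X in measurable X]setTI; apply: mX.
  move=> w /Abad nc; apply: contrapT => h; apply: nc; apply: grid_dist => //.
    by case/andP: eta01 => /ltW.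
  move=> j j0 b /=; rewrite leNgt; apply/negP => hj; apply: h.
  by exists (j, b).
apply: (le_trans h1); apply: (@le_trans _ _ (\sum_(i : 'I_m * bool) (2 * expR (- (3 / 8 * N.+1%:R * eta ^+ 2)))%:E)%E).
  rewrite big_mkcond/=; apply: lee_sum => i _; case: ifPn => _; last first.
    by rewrite lee_fin mulr_ge0// expR_ge0.
  apply: hoeffding => //.
  - by move=> n; rewrite -[X in measurable X]setTI; apply: mX.
  - exact: indepX.
  - exact: m01.
rewrite sumEFin sumr_const card_prod card_ord card_bool lee_fin -[leLHS]mulr_natr natrM.
by rewrite le_eqVlt; apply/orP; left; apply/eqP; ring.
Qed.

End weak_dkw.

(** * Inverse transform sampling *)

Section inverse_transform.
Context {R : realType}.
Local Notation mR := (measurableTypeR R).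
Local Notation unif := (uniform_prob (@ltr01 R)).

(* For u <= 0 and for u > 1, [quantile pi u] is the junk infimum of [set: R] and of
   [set0] respectively. *)
Definition clamp (v : R) : R := if 0 < v < 1 then v else 1 / 2.

Lemma clamp01 v : 0 < clamp v < 1.
Proof. by rewrite /clamp; case: ifPn => // _; apply/andP; split; lra. Qed.

Lemma clamp_id v : 0 < v < 1 -> clamp v = v.
Proof. by rewrite /clamp => ->. Qed.

Lemma measurable_clamp : measurable_fun [set: mR] (clamp : mR -> mR).
Proof.
by apply: measurable_fun_ifT => //; apply: measurable_and; exact: measurable_fun_ltr.
Qed.

Lemma uniform_probE (A : set mR) : measurable A ->
  unif A = lebesgue_measure (A `&` `[0, 1]%classic).
Proof.
move=> mA; rewrite /uniform_prob integral_uniform_pdf (eq_integral (cst 1%E)).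
  by rewrite integral_cst ?mul1e//; exact: measurableI.
by move=> x; rewrite inE => -[_]; rewrite /= in_itv/= /uniform_pdf => ->; rewrite subr0 invr1.
Qed.

(** Within [0, 1], [clamp] moves only the two endpoints, which are null. *)
Lemma uniform_clamp p : 0 <= p <= 1 -> unif [set v | clamp v <= p] = p%:E.
Proof.
move=> /andP[p0 p1].
have mS : measurable ([set v | clamp v <= p] : set mR).
  by apply: measurable_ler => //; exact: measurable_clamp.
have mI b : measurable (`[0, b]%classic : set mR) by exact: measurable_itv.
rewrite uniform_probE//; apply/eqP; rewrite eq_le; apply/andP; split.
  apply: (@le_trans _ _ (lebesgue_measure (`[0, p]%classic `|` `[1, 1]%classic : set mR))).
    apply: le_measure; rewrite ?inE.
    - exact: measurableI.
    - by apply: measurableU => //; exact: measurable_itv.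
    - move=> v /= [+ +]; rewrite /clamp !in_itv/= => + /andP[v0 v1].
      rewrite v0 v1 !andbT /=.
      have [->|v1'] := eqVneq v 1; first by right.
      have [->|v0'] := eqVneq v 0; first by left.
      rewrite lt_neqAle eq_sym v0' v0 lt_neqAle v1' v1/= => vp.
      by left.
  apply: le_trans (measureU2 _ _ _) _ => //.
  have h0 : lebesgue_measure (`[0, p]%classic : set mR) = p%:E.
    by rewrite lebesgue_measure_itv/= lte_fin; case: ltP => pp; rewrite ?oppr0 ?adde0// (@le_anti _ _ p 0)// pp.
  have h1 : lebesgue_measure (`[1, 1]%classic : set mR) = 0%E.
    by rewrite lebesgue_measure_itv/= lte_fin ltxx.
  by rewrite [X in (X + _ <= _)%E]h0 [X in (_ + X <= _)%E]h1 adde0.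
apply: (@le_trans _ _ (lebesgue_measure (`]0, p[%classic : set mR))).
  by rewrite lebesgue_measure_itv/= lte_fin; case: ltP => pp; rewrite ?oppr0 ?adde0 ?lee_fin.
apply: le_measure; rewrite ?inE; first exact: measurable_itv.
  exact: measurableI.
move=> v /=; rewrite !in_itv/= => /andP[v0 vp].
have v1 := lt_le_trans vp p1.
by rewrite /clamp v0 v1 (ltW vp) (ltW v0) (ltW v1).
Qed.

Lemma measurable_quantile_clamp (pi : probability mR R) :
  measurable_fun [set: mR] (fun v => quantile pi (clamp v) : mR).
Proof.
by apply: (@measurable_quantile _ mR R (fun=> pi) clamp) => //; [exact: measurable_clamp|exact: clamp01].
Qed.

Lemma uniform_quantile (pi : probability mR R) (B : set mR) : measurable B ->
  unif [set v | B (quantile pi (clamp v))] = pi B.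
Proof.
move=> mB.
pose f : {mfun mR >-> mR} := mfun_Sub (mem_set (measurable_quantile_clamp pi)).
apply: (@eq_cdf_of_measure R (distribution unif f) pi) => // a.
rewrite /cdf_of /distribution/= /pushforward.
rewrite (_ : _ @^-1` _ = [set v | clamp v <= cdf_of pi a]).
  by rewrite uniform_clamp// cdf_of_ge0 cdf_of_le1.
by apply/seteqP; split=> v /=; rewrite in_itv/= quantile_le// clamp01.
Qed.

Variables (rho : R) (sigma c : {posnum R}) (N : nat).

Lemma measurable_next_clamp (x : 'I_N.+1 -> R) :
  measurable_fun [set: mR * mR] (fun uv => next_particle rho sigma c x (clamp uv.1, clamp uv.2) : mR).
Proof.
apply: (@measurable_next_particle _ (mR * mR)%type R rho sigma c N (fun n _ => x n)) => //.
- by apply: measurableT_comp => //; exact: measurable_clamp.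
- by apply: measurableT_comp => //; exact: measurable_clamp.
- by move=> w; exact: clamp01.
- by move=> w; exact: clamp01.
Qed.

(** The first coordinate draws from the updated measure, the second from the transition out of that
    draw; integrating the second out first leaves the mixture that defines [predict]. *)
Lemma next_particle_law (x : 'I_N.+1 -> R) (B : set mR) : measurable B ->
  (unif \x unif)%E [set uv | B (next_particle rho sigma c x (clamp uv.1, clamp uv.2))] =
  filter_step rho sigma c (emp x) B.
Proof.
move=> mB; rewrite /product_measure1/=.
pose f : {mfun mR >-> mR} := mfun_Sub (mem_set (measurable_quantile_clamp (update c (emp x)))).
transitivity (\int[unif]_u M rho sigma (f u) B)%E.
  apply: eq_integral => u _ /=.
  rewrite -[RHS](@uniform_quantile (normal_prob (rho * f u) sigma%:num))//.
  congr (unif _); apply/seteqP; split => v; rewrite /xsection/= inE/= /next_particle/=;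
    by rewrite quantile_weighted_empirical.
rewrite [RHS](_ : _ = (\int[update c (emp x)]_z M rho sigma z B)%E)//.
rewrite -(@ge0_integral_pushforward _ _ _ _ R f _ unif setT (fun z => M rho sigma z B))//.
apply: (@eq_measure_integral _ mR R) => A mA _.
  exact: uniform_quantile.
by apply: (@measurable_kernel _ _ mR mR R (M rho sigma)).
Qed.

End inverse_transform.

(** * Conditioning on the past *)

Section section_bound.
Local Open Scope ereal_scope.
Context d (Omega : measurableType d) {R : realType} (P : probability Omega R).
Context d1 (T1 : measurableType d1) d2 (T2 : measurableType d2).
Variables (V : Omega -> T1) (W : Omega -> T2).
Hypotheses (mV : measurable_fun setT V) (mW : measurable_fun setT W).
Hypothesis indep : forall A B, measurable A -> measurable B ->
  P (V @^-1` A `&` W @^-1` B) = P (V @^-1` A) * P (W @^-1` B).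

(** Replaces conditional probabilities: the joint law is a product measure, so a bound valid for
    every frozen value of V integrates to the joint event. *)
Lemma independent_section_bound (bad : set (T1 * T2)) (b : R) :
  measurable bad -> (forall x, P (W @^-1` xsection bad x) <= b%:E) ->
  P [set w | bad (V w, W w)] <= b%:E.
Proof.
move=> mbad hb.
pose V' : {mfun Omega >-> T1} := mfun_Sub (mem_set mV).
pose W' : {mfun Omega >-> T2} := mfun_Sub (mem_set mW).
have mVW : measurable_fun setT (fun w => (V w, W w)) by exact/measurable_fun_pair.
pose VW : {mfun Omega >-> (T1 * T2)%type} := mfun_Sub (mem_set mVW).
have -> : P [set w | bad (V w, W w)] = distribution P VW bad by [].
rewrite -(@product_measure_unique _ _ T1 T2 R (distribution P V') (distribution P W') (distribution P VW))//.
apply: (@le_trans _ _ (\int[distribution P V']_x cst b%:E x)).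
  apply: ge0_le_integral => //.
  - exact: measurable_fun_xsection.
  - by move=> x _; exact: hb.
by rewrite integral_cst// [X in _ * X]probability_setT mule1.
Qed.

End section_bound.

Section independence.
Context d (Omega : measurableType d) {R : realType} (P : probability Omega R).
Context d' (T : measurableType d').

Lemma independent_on_seq (I : choiceType) (D : set I) (X : I -> Omega -> T) (s : seq I)
    (B : I -> set T) :
  independent_on P D X -> uniq s -> (forall i, i \in s -> D i) ->
  (forall i, measurable (B i)) ->
  P (\bigcap_(i in [set` s]) (X i @^-1` B i)) =
  (\big[*%E/1%E]_(i <- s) P (X i @^-1` B i))%E.
Proof.
move=> indep us sD mB.
have := indep [fset i in s]%fset B.
rewrite (_ : [set` [fset i in s]%fset] = [set` s]); last first.
  by apply/seteqP; split=> i /=; rewrite !inE.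
move=> -> //.
apply: perm_big; apply: uniq_perm => //.
by move=> i; rewrite !inE.
Qed.

Lemma independent_on_events N (Y : 'I_N -> Omega -> T) (C : set T) (p : R) :
  independent_on P [set: 'I_N] Y -> measurable C ->
  (forall n, measurable_fun setT (Y n)) ->
  (forall n, P (Y n @^-1` C) = p%:E) ->
  independent_events P (fun n => Y n @^-1` C) p.
Proof.
move=> indep mC mY Yp cell f; rewrite {}/cell.
pose B n := if f n then C else ~` C.
have := @independent_on_seq _ _ Y (index_enum 'I_N) B indep (index_enum_uniq _).
rewrite (_ : [set` index_enum 'I_N] = setT); last first.
  by apply/seteqP; split=> i //= _; rewrite mem_index_enum.
move=> /(_ (fun _ _ => I)) h.
rewrite (eq_bigcapr (G := fun n => Y n @^-1` B n)); last first.
  by move=> n _; rewrite /B; case: (f n).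
rewrite h; last by move=> n; rewrite /B; case: (f n) => //; exact: measurableC.
rewrite -prodEFin; apply: eq_bigr => n _.
rewrite /B; case: (f n) => //.
rewrite preimage_setC probability_setC ?Yp//.
by rewrite -[X in measurable X]setTI; exact: mY.
Qed.

Variable U : nat -> Omega -> T.
Hypothesis mU : forall t, measurable_fun setT (U t).
Hypothesis indepU : independent_on P [set t | (1 <= t)%N] U.
Variable n : nat.

(** Cylinder sets of the times 1 to n. They are stable under intersection and generate the
    sigma-algebra of the first n variables. *)
Definition past : set (set Omega) :=
  [set A | exists2 B : nat -> set T, (forall i, measurable (B i)) &
    A = \bigcap_(i in [set` iota 1 n]) (U i @^-1` B i)].

Let past_measurable : past `<=` measurable.
Proof.
move=> _ [B mB ->]; apply: bigcap_measurableType => i _.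
by rewrite -[X in measurable X]setTI; exact: mU.
Qed.

Lemma measurable_past s : (1 <= s <= n)%N ->
  measurable_fun [set: g_sigma_algebraType past] (U s : g_sigma_algebraType past -> T).
Proof.
move=> sn _ B mB; rewrite setTI; apply: sub_sigma_algebra.
exists (fun i => if i == s then B else setT); first by move=> i; case: ifP.
apply/seteqP; split=> [w Bw i /= _|w /(_ s)/=]; first by case: eqP => // ->.
by rewrite eqxx; apply; rewrite mem_iota add1n ltnS.
Qed.

(** Both sides are finite measures in A that agree on the cylinder sets, where the claim is
    independence of n + 1 variables. *)
Lemma independent_past (A : set Omega) (B : set T) : <<s past >> A -> measurable B ->
  P (A `&` U n.+1 @^-1` B) = (P A * P (U n.+1 @^-1` B))%E.
Proof.
move=> pA mB.
have mWB : measurable (U n.+1 @^-1` B) by rewrite -[X in measurable X]setTI; exact: mU.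
have p0 : 0 <= fine (P (U n.+1 @^-1` B)) by exact: fine_ge0.
have pE : P (U n.+1 @^-1` B) = (fine (P (U n.+1 @^-1` B)))%:E.
  by rewrite fineK ?fin_num_measure.
transitivity (mscale (NngNum p0) P A); last by rewrite [RHS]muleC [X in _ = (X * _)%E]pE.
transitivity (mrestr P mWB A) => //.
apply: (@g_sigma_algebra_measure_unique _ R Omega past past_measurable (fun=> setT)) => //.
- move=> _; exists (fun=> setT) => //.
  by apply/seteqP; split.
- by rewrite bigcup_const.
- move=> _ _ [B1 mB1 ->] [B2 mB2 ->]; exists (fun i => B1 i `&` B2 i).
    by move=> i; exact: measurableI.
  by rewrite -bigcapI.
- move=> _ [C mC ->].
  pose C' i := if i == n.+1 then B else C i.
  have mC' i : measurable (C' i) by rewrite /C'; case: ifP.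
  have C'n : C' n.+1 = B by rewrite /C' eqxx.
  have h (r : seq nat) : uniq r -> (forall i, i \in r -> (1 <= i)%N) -> P (\bigcap_(i in [set` r]) (U i @^-1` C' i)) = (\big[*%E/1%E]_(i <- r) P (U i @^-1` C' i))%E.
    move=> ur r1; apply: (independent_on_seq indepU) => //.
  have E1 : \bigcap_(i in [set` iota 1 n]) (U i @^-1` C i) = \bigcap_(i in [set` iota 1 n]) (U i @^-1` C' i).
    apply: eq_bigcapr => i /=; rewrite mem_iota /C' => /andP[_ ni].
    by case: eqP ni => // ->; rewrite add1n ltnn.
  rewrite [LHS](_ : _ = P (\bigcap_(i in [set` iota 1 n]) (U i @^-1` C' i) `&` U n.+1 @^-1` B)) -?E1//.
  rewrite [RHS](_ : _ = ((fine (P (U n.+1 @^-1` B)))%:E * P (\bigcap_(i in [set` iota 1 n]) (U i @^-1` C i)))%E)// -pE E1.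
  rewrite (_ : _ `&` _ = \bigcap_(i in [set` rcons (iota 1 n) n.+1]) (U i @^-1` C' i)).
    rewrite !h ?iota_uniq//.
    - by rewrite big_rcons/= C'n muleC.
    - by move=> i; rewrite mem_iota => /andP[].
    - by rewrite rcons_uniq iota_uniq mem_iota add1n ltnn andbF.
    - by move=> i; rewrite mem_rcons inE mem_iota => /orP[/eqP->//|/andP[]].
  apply/seteqP; split=> [w [h1 h2] i /=|w h1].
    rewrite mem_rcons inE => /orP[/eqP->|]; first by rewrite /C' eqxx.
    exact: h1.
  split=> [i /= ir|]; first by apply: h1 => /=; rewrite mem_rcons inE ir orbT.
  have := h1 n.+1; rewrite /C' /= eqxx; apply.
  by rewrite mem_rcons inE eqxx.
- move=> _; rewrite [X in (X < _)%E](_ : _ = P (setT `&` U n.+1 @^-1` B))//.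
  by rewrite (le_lt_trans (probability_le1 _ _)) ?ltry//; exact: measurableI.
Qed.

(** The history is the sample point itself, seen through the coarser sigma-algebra: V is the
    identity of Omega. *)
Lemma past_section_bound (bad : set (g_sigma_algebraType past * T)) (b : R) :
  measurable bad -> (forall x, (P (U n.+1 @^-1` xsection bad x) <= b%:E)%E) ->
  (P [set w | bad (w, U n.+1 w)] <= b%:E)%E.
Proof.
move=> mbad hb.
apply: (@independent_section_bound _ Omega R P _ (g_sigma_algebraType past) _ T idfun (U n.+1)) => //.
- move=> _ A mA; rewrite setTI preimage_id.
  apply: (@smallest_sub _ _ past measurable) mA => //.
  exact: sigma_algebra_measurable.
- by move=> A B mA mB; apply: independent_past.
Qed.

End independence.

(** * Measurability of the closeness events *)

Section measurable_close.
Context {R : realType}.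
Local Notation mR := (measurableTypeR R).

(** By right continuity, a violation at a persists at a rational point to the right of a. Closeness
    is thus a countable intersection of events. *)
Lemma close_rat e (mu nu : probability mR R) :
  (forall q : rat, `|cdf_of mu (ratr q) - cdf_of nu (ratr q)| <= e) -> close e mu nu.
Proof.
move=> h a; rewrite leNgt; apply/negP => ea.
have cv : `|cdf_of mu x - cdf_of nu x| @[x --> a^'+] --> `|cdf_of mu a - cdf_of nu a|.
  by apply: cvg_norm; apply: cvgB; exact: cdf_of_right_continuous.
have := cvgr_gt _ cv _ ea; rewrite near_withinE => -[/= r r0 ball].
have [q] : exists q : rat, ratr q \in `]a, a + r[.
  by apply: rat_in_itvoo; rewrite ltrDl.
rewrite in_itv/= => /andP[aq qr]; have := h q; rewrite leNgt => /negP; apply.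
by apply: ball => //=; rewrite ltr0_norm ?subr_lt0// opprB ltrBlDl.
Qed.

Context d (D : measurableType d).

Lemma measurable_close (mu nu : D -> probability mR R) e :
  (forall a, measurable_fun setT (fun w => cdf_of (mu w) a)) ->
  (forall a, measurable_fun setT (fun w => cdf_of (nu w) a)) ->
  measurable [set w | close e (mu w) (nu w)].
Proof.
move=> mmu mnu; rewrite -[X in measurable X]setCK; apply: measurableC.
rewrite (_ : ~` _ = \bigcup_(q : rat)
    [set w | e < `|cdf_of (mu w) (ratr q) - cdf_of (nu w) (ratr q)|]).
  apply: bigcupT_measurable_rat => q; apply: measurable_ltr => //.
  by apply: measurableT_comp => //; exact: measurable_funB.
apply/seteqP; split=> [w /= nc|w [q _] /= eq /(_ (ratr q))]; last by rewrite leNgt eq.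
apply: contrapT => h; apply: nc; apply: close_rat => q; rewrite leNgt; apply/negP => eq.
by apply: h; exists q.
Qed.

Variables (rho : R) (sigma c : {posnum R}) (N : nat).

Lemma measurable_filter_step_cdf (X : 'I_N.+1 -> D -> mR) a :
  (forall n, measurable_fun setT (X n)) ->
  measurable_fun setT (fun w => cdf_of (filter_step rho sigma c (emp (X ^~ w))) a).
Proof.
move=> mX.
have mF : measurable_fun [set: mR] (fun x : mR => cdf_of (normal_prob (rho * x) sigma%:num) a).
  apply: measurableT_comp => //.
  by apply: (@measurable_kernel _ _ mR mR R (M rho sigma)).
have mG := @measurable_G R c.
have F0 x : 0 <= cdf_of (normal_prob (rho * x) sigma%:num) a by exact: cdf_of_ge0.
have G0 x : 0 < G c x := G_gt0 c x.
have h (f : mR -> R) w : measurable_fun setT f -> (forall x, 0 <= f x) ->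
   \int[emp (X ^~ w)]_x f x = (\sum_(n < N.+1) f (X n w)) / N.+1%:R.
  move=> mf f0; rewrite /Rintegral integral_emp//; last first.
  - by move=> y _; rewrite lee_fin.
  - exact/measurable_EFinP.
  rewrite mulr_suml; under eq_bigr do rewrite diracT mul1e -EFinM mulrC.
  by rewrite sumEFin.
under eq_fun do rewrite cdf_of_filter_step /Gint.
have mFG : measurable_fun [set: mR] (fun x : mR => cdf_of (normal_prob (rho * x) sigma%:num) a * G c x).
  exact: measurable_funM.
rewrite (_ : (fun _ => _) = (fun w =>
  ((\sum_(n < N.+1) (cdf_of (normal_prob (rho * X n w) sigma%:num) a * G c (X n w))) / N.+1%:R) /
  ((\sum_(n < N.+1) G c (X n w)) / N.+1%:R))); last first.
  apply/funext => w; rewrite (h _ _ mFG) ?(h _ _ mG)//.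
    by move=> x; exact: ltW (G0 x).
  by move=> x; rewrite mulr_ge0// ltW.
have mGX n : measurable_fun setT (fun w => G c (X n w)) by exact: measurableT_comp (mX n).
apply: measurable_funM; first apply: measurable_funM => //.
  apply: measurable_sum => n; apply: measurable_funM => //.
  exact: (measurableT_comp mF (mX n)).
apply: measurable_fun_posV; first by apply: measurable_funM => //; exact: measurable_sum.
move=> w; rewrite divr_gt0// big_ord_recl ltr_wpDr//; apply: sumr_ge0 => i _; exact: ltW (G0 _).
Qed.

End measurable_close.

Section measurable_close_next.
Context {R : realType} d (S : measurableType d).
Local Notation mR := (measurableTypeR R).
Variables (rho : R) (sigma c : {posnum R}) (N : nat).
Local Notation T := (N.+1.-tuple (mR * mR)%type).
Variable x : S -> 'I_N.+1 -> R.

(** Joint measurability in history and new points, as [past_section_bound] demands. *)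
Lemma measurable_close_next e : (forall n, measurable_fun [set: S] (fun w => x w n : mR)) ->
  measurable [set wv : S * T | close e
    (emp (fun n => next_particle rho sigma c (x wv.1)
            (clamp (tnth wv.2 n).1, clamp (tnth wv.2 n).2)))
    (filter_step rho sigma c (emp (x wv.1)))].
Proof.
move=> mx.
have mxST n : measurable_fun [set: S * T] (fun wv => x wv.1 n : mR).
  by apply: (measurableT_comp (mx n)); exact: measurable_fst.
have mv n : measurable_fun [set: S * T] (fun wv => tnth wv.2 n).
  by apply: (measurableT_comp (measurable_tnth n)); exact: measurable_snd.
apply: measurable_close => a.
  apply: (@measurable_empirical_cdf _ _ R N (fun n (wv : S * T) => next_particle rho sigma c (x wv.1)
            (clamp (tnth wv.2 n).1, clamp (tnth wv.2 n).2))) => n.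
  apply: (@measurable_next_particle _ _ R rho sigma c N (fun n wv => x wv.1 n)) => //.
  - by apply: (measurableT_comp measurable_clamp); apply: (measurableT_comp measurable_fst (mv n)).
  - by apply: (measurableT_comp measurable_clamp); apply: (measurableT_comp measurable_snd (mv n)).
  - by move=> w; exact: clamp01.
  - by move=> w; exact: clamp01.
exact: (@measurable_filter_step_cdf R _ _ rho sigma c N (fun n wv => x wv.1 n)).
Qed.

End measurable_close_next.

(** * Local errors of the particle system *)

Section one_step.
Context {R : realType}.
Local Notation mR := (measurableTypeR R).
Local Notation unif := (uniform_prob (@ltr01 R)).
Variables (rho : R) (sigma c : {posnum R}) (eta1 : probability mR R) (N : nat).
Context d (Omega : measurableType d) (P : probability Omega R).
Local Notation T := (N.+1.-tuple (mR * mR)%type).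
Variable U : nat -> Omega -> T.
Hypothesis mU : forall t, measurable_fun setT (U t).
Let u (omega : Omega) (t : nat) (n : 'I_N.+1) := tnth (U t omega) n.
Hypothesis u01 : forall t n omega, (1 <= t)%N ->
  0 < (u omega t n).1 < 1 /\ 0 < (u omega t n).2 < 1.
Hypothesis indepU : independent_on P [set t | (1 <= t)%N] U.
Hypothesis indepu : forall t, (1 <= t)%N ->
  independent_on P [set: 'I_N.+1] (fun n omega => u omega t n).
Hypothesis lawu : forall t n (A : set (mR * mR)), (1 <= t)%N -> measurable A ->
  P ((fun omega => u omega t n) @^-1` A) = (unif \x unif)%E A.

Let x m w : 'I_N.+1 -> R := particles rho sigma c eta1 (u w) m.+1.

Let mu_ t n : measurable_fun [set: Omega] (fun w => u w t n).
Proof. by have /measurable_fun_tnthP := mU t; apply. Qed.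

Lemma particles_clampS m n w : x m.+1 w n =
  next_particle rho sigma c (x m w) (clamp (u w m.+2 n).1, clamp (u w m.+2 n).2).
Proof.
rewrite /x particlesS; have [h1 h2] := @u01 m.+2 n w isT.
by rewrite !clamp_id// -surjective_pairing.
Qed.

Lemma measurable_random_particles m n : measurable_fun setT (fun w => x m w n : mR).
Proof. by apply: measurable_particles => // s k w _; exact: u01. Qed.

Let fail m eta : R := 4 * m%:R * expR (- (3 / 8 * N.+1%:R * eta ^+ 2)).

Let prob_fine (nu : probability mR R) (B : set mR) : measurable B -> nu B = (fine (nu B))%:E.
Proof. by move=> mB; rewrite fineK ?fin_num_measure. Qed.

Lemma initial_bound m eta : (0 < m)%N -> 0 < eta <= 1 ->
  (P [set w | ~ close (m%:R^-1 + eta)%R (emp (x 0 w)) eta1] <= (fail m eta)%:E)%E.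
Proof.
move=> m0 eta01; apply: (@weak_dkw _ Omega R P eta1 N (fun n w => x 0 w n)) => //.
- by move=> n; exact: measurable_random_particles.
- move=> B mB.
  pose C : set (mR * mR) := [set uv | B (quantile eta1 (clamp uv.1))].
  have mC : measurable C.
    rewrite -[X in measurable X]setTI; apply: (measurableT_comp (measurable_quantile_clamp eta1)) => //.
  rewrite (_ : (fun n => _) = (fun n => (fun w => u w 1 n) @^-1` C)); last first.
    apply/funext => n; rewrite /C /preimage; apply/funext => w /=.
    by rewrite /x/= clamp_id//; have [] := @u01 1 n w isT.
  apply: independent_on_events => //; first exact: indepu.
  move=> n; rewrite lawu// -prob_fine//.
  rewrite (_ : C = [set v | B (quantile eta1 (clamp v))] `*` setT).
    have mS : measurable ([set v | B (quantile eta1 (clamp v))] : set mR).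
      by rewrite -[X in measurable X]setTI; exact: (measurable_quantile_clamp eta1).
    have h1 : unif [set: mR] = 1%E by exact: probability_setT.
    rewrite product_measure1E//; transitivity (unif [set v | B (quantile eta1 (clamp v))] * 1)%E.
      exact: (congr1 (fun z => _ * z)%E h1).
    by rewrite mule1 uniform_quantile.
  by apply/seteqP; split=> [[]|[]]//= a b [].
- apply: measurableC; apply: measurable_close => a //.
  by apply: (@measurable_empirical_cdf _ Omega R N (fun n w => x 0 w n)) => n; exact: measurable_random_particles.
Qed.

Lemma step_bound k m eta : (0 < m)%N -> 0 < eta <= 1 ->
  (P [set w | ~ close (m%:R^-1 + eta)%R (emp (x k.+1 w))
     (filter_step rho sigma c (emp (x k w)))] <= (fail m eta)%:E)%E.
Proof.
move=> m0 eta01.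
(* The particles at time k + 1 depend on the first k + 1 point sets only, hence are measurable for
   this sigma-algebra. *)
pose S := g_sigma_algebraType (past U k.+1).
(* Measurability is needed on all of T, also at points with coordinates outside (0, 1); [clamp]
   ensures it and is the identity at the actual points. *)
pose y (w : S) (v : T) n := next_particle rho sigma c (x k w)
  (clamp (tnth v n).1, clamp (tnth v n).2).
pose bad : set (S * T) := [set wv | ~ close (m%:R^-1 + eta)%R (emp (y wv.1 wv.2))
     (filter_step rho sigma c (emp (x k wv.1)))].
have key w : x k.+1 w = y w (U k.+2 w) by apply/funext => n; exact: particles_clampS.
rewrite (_ : [set w | _] = [set w | bad (w, U k.+2 w)]); last first.
  by apply/funext => w; rewrite /mkset key.
have mxS n : measurable_fun [set: S] (fun w => x k w n : mR).
  apply: (@measurable_particles _ S) => [s j sk|s j w _]; last exact: u01.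
  have mUs : measurable_fun [set: S] (U s.+1) by apply: measurable_past; rewrite ltnS.
  by have /measurable_fun_tnthP := mUs; apply.
have mbad : measurable bad.
  apply: measurableC.
  exact: (@measurable_close_next R _ S rho sigma c N (x k) _ mxS).
apply: (@past_section_bound _ Omega R P _ T U mU indepU k.+1 bad) => // w0.
(* With the history frozen at w0, the new particles are independent with the law [filter_step] of a
   fixed empirical measure. *)
pose X n w := next_particle rho sigma c (x k w0) (clamp (u w k.+2 n).1, clamp (u w k.+2 n).2).
apply: (@weak_dkw _ Omega R P (filter_step rho sigma c (emp (x k w0))) N X) => //.
- by move=> n; apply: (measurableT_comp (measurable_next_clamp rho sigma c (x k w0))); exact: mu_.
- move=> B mB.
  pose C : set (mR * mR) := [set uv | B (next_particle rho sigma c (x k w0) (clamp uv.1, clamp uv.2))].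
  have mC : measurable C.
    by rewrite -[X in measurable X]setTI; apply: (measurable_next_clamp rho sigma c (x k w0)).
  apply: (@independent_on_events _ Omega R P _ _ _ (fun n w => u w k.+2 n) C) => //.
    exact: indepu.
  by move=> n; rewrite lawu// -prob_fine// next_particle_law.
- by rewrite -[X in measurable X]setTI; apply: mU => //; exact: measurable_xsection.
- by move=> w; rewrite /xsection/= /preimage/= => /set_mem.
Qed.

End one_step.

(** * The rate and the size of the grid *)

Section rate.
Context {R : realType}.
Implicit Types s q : R.

(** The inequality ln(1 + x) <= x at x = - 1 / (s + 1), with 1 + x the inverse of 1 + 1 / s. *)
Lemma ln1V_ge s : 0 < s -> (s + 1)^-1 <= ln (1 + s^-1).
Proof.
move=> s0; have s1 : 0 < s + 1 by rewrite addr_gt0.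
have h : ln (1 + - (s + 1)^-1) <= - (s + 1)^-1.
  by apply: le_ln1Dx; rewrite ltrN2 invf_lt1// ltrDr.
have E : (1 + s^-1)^-1 = 1 + - (s + 1)^-1.
  by field; rewrite !gt_eqF// addrC.
by rewrite -lerN2 -lnV ?E// posrE addr_gt0// invr_gt0.
Qed.

Let rate s := s * ln (1 + s^-1).

(** Puts s >= 1 into the regime where the claimed bound exceeds 1. *)
Lemma rate_ge_half s : 1 <= s -> 1 / 2 <= rate s.
Proof.
move=> s1; have s0 : 0 < s by apply: lt_le_trans s1.
rewrite /rate; apply: (@le_trans _ _ (s * (s + 1)^-1)); last first.
  by apply: ler_wpM2l; [exact: ltW|exact: ln1V_ge].
by rewrite ler_pdivlMr ?addr_gt0//; lra.
Qed.

Lemma rate_gt0 s : 0 < s -> 0 < rate s.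
Proof.
move=> s0; rewrite mulr_gt0//; apply: lt_le_trans (ln1V_ge s0).
by rewrite invr_gt0 addr_gt0.
Qed.

Lemma delta_gt0 N T q : 0 < q < 1 -> (1 <= N)%N -> (1 <= T)%N -> 0 < delta N T q.
Proof.
move=> /andP[q0 q1] N0 T0; rewrite /delta mulr_gt0 ?invr_gt0 ?ltr0n//.
rewrite ltr_pwDl// ln_ge0// ler_pdivlMr// mul1r (le_trans (ltW q1))//.
by rewrite ler1n.
Qed.

(* [ln (4 m)] is at most [ln (1 + 1 / s)], which costs only the logarithmic
   factor of the rate. *)
Lemma grid_size N T q : 0 < q < 1 -> (1 <= N)%N -> (1 <= T)%N ->
  let s := Num.sqrt (delta N T q) in s <= 1 -> 16 * rate s <= 1 ->
  exists m : nat, [/\ (0 < m)%N, m%:R^-1 <= 16 * rate s &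
    T%:R * (4 * m%:R * expR (- (3 / 8 * N%:R * m%:R^-1 ^+ 2))) <= q].
Proof.
move=> q01 N0 T0 s s1 r1.
have d0 := delta_gt0 q01 N0 T0.
have s0 : 0 < s by rewrite sqrtr_gt0.
have r0 := rate_gt0 s0.
have [q0 q1] := andP q01.
have n0 : 0 < N%:R :> R by rewrite ltr0n.
have t0 : 0 < T%:R :> R by rewrite ltr0n.
set l := ln (T%:R / q).
have l0 : 0 <= l.
  by rewrite ln_ge0// ler_pdivlMr// mul1r (le_trans (ltW q1))// ler1n.
set L := ln (1 + s^-1).
have L2 : 1 / 2 <= L.
  apply: le_trans (ln1V_ge s0); rewrite mul1r lef_pV2 ?posrE ?addr_gt0//; lra.
have nsq : N%:R * s ^+ 2 = 1 + l.
  by rewrite sqr_sqrtr ?ltW// /delta mulrA mulfV ?gt_eqF// mul1r.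
(* The grid size is the integer following y >= 1, so 1 / m lies between 8 * rate s and 16 * rate
   s. *)
pose y := (16 * rate s)^-1.
have y1 : 1 <= y by rewrite invr_ge1 ?inE/=; [|rewrite unitfE gt_eqF// mulr_gt0|rewrite mulr_gt0].
exists (Num.truncn y).+1.
have y00 : 0 <= y by apply: le_trans y1.
have /andP[my ym] := truncn_itv y00.
set m := (Num.truncn y).+1.
have m2y : m%:R <= 2 * y by rewrite /m -natr1; move: my y1; lra.
have m0 : 0 < m%:R :> R by rewrite ltr0n.
have y0 : 0 < y by apply: lt_le_trans y1.
have yE : 16 * rate s = y^-1 by rewrite invrK.
have ymV : m%:R^-1 <= 16 * rate s by rewrite yE lef_pV2 ?posrE// ltW.
split=> //.
have hm : 8 * rate s <= m%:R^-1.
  have -> : 8 * rate s = (2 * y)^-1 by rewrite invfM -yE; field.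
  by rewrite lef_pV2 ?posrE ?mulr_gt0.
(* Here 24 = 3 / 8 * 8^2, and N * s^2 = 1 + l removes the sample size. *)
have hA : 24 * ((1 + l) * L ^+ 2) <= 3 / 8 * N%:R * m%:R^-1 ^+ 2.
  apply: (@le_trans _ _ (3 / 8 * N%:R * (8 * rate s) ^+ 2)); last first.
    apply: ler_wpM2l; first by rewrite !mulr_ge0// ltW.
    have a0 : 0 <= 8 * rate s by rewrite mulr_ge0// ltW.
    by rewrite ler_sqr ?nnegrE// (le_trans a0).
  rewrite le_eqVlt; apply/orP; left; apply/eqP.
  by rewrite /rate -/L -nsq; field.
(* Since m <= 2 * y, 4 * m is at most 8 * y = 1 / (2 * s * L), and L >= 1 / 2 brings this below 1 /
   s. *)
have hln : ln (4 * m%:R) <= L.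
  have sV0 : 0 < s^-1 by rewrite invr_gt0.
  have m40 : 0 < 4 * m%:R :> R by rewrite mulr_gt0.
  rewrite ler_ln ?posrE ?addr_gt0//.
  apply: (@le_trans _ _ s^-1); last by rewrite lerDr.
  apply: (@le_trans _ _ (8 * y)); first by move: m2y; lra.
  rewrite -[leRHS]mul1r ler_pdivlMr// (_ : 8 * y * s = 8 * s * y); last by ring.
  rewrite -ler_pdivlMr// mul1r -yE /rate -/L mulrCA [leLHS]mulrC; apply: ler_wpM2l; [exact: ltW|].
  by move: L2; lra.
have -> : T%:R * (4 * m%:R * expR (- (3 / 8 * N%:R * m%:R^-1 ^+ 2))) =
  q * expR (ln (4 * m%:R) + l - 3 / 8 * N%:R * m%:R^-1 ^+ 2).
  rewrite !expRD lnK ?posrE ?mulr_gt0// /l lnK ?posrE ?divr_gt0//.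
  by field; rewrite gt_eqF.
rewrite -[leRHS]mulr1 ler_pM2l// -[leRHS]expR0 ler_expR.
rewrite subr_le0; apply: le_trans hA.
(* By L >= 1 / 2, L <= 2 * L^2 and l <= 4 * l * L^2, well below the available 24 * (1 + l) * L^2. *)
apply: (@le_trans _ _ (L + l)); first by rewrite lerD2r.
have L0 : 0 <= L by apply: le_trans L2.
have h1 : 1 <= 4 * L ^+ 2.
  rewrite (_ : 4 * L ^+ 2 = (2 * L) ^+ 2); last by ring.
  by rewrite exprn_ege1//; move: L2; lra.
have h2 : L <= 2 * L ^+ 2.
  by rewrite expr2 mulrA -[leLHS]mul1r ler_wpM2r//; move: L2; lra.
have h3 : l <= l * (4 * L ^+ 2) by rewrite -[leLHS]mulr1 ler_wpM2l.
have h4 : 0 <= l * L ^+ 2 by rewrite mulr_ge0// exprn_ge0.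
have h5 : 0 <= L ^+ 2 by rewrite exprn_ge0.
have -> : 24 * ((1 + l) * L ^+ 2) = 24 * L ^+ 2 + 24 * (l * L ^+ 2) by ring.
have : l * (4 * L ^+ 2) = 4 * (l * L ^+ 2) by ring.
move: h2 h3 h4 h5 => + + + + h6; rewrite h6; clear.
by move: (l * L ^+ 2) (L ^+ 2) => a b; lra.
Qed.

End rate.

(** * From local errors to the theorem *)

Section assembly.
Context {R : realType}.
Local Notation mR := (measurableTypeR R).
Local Notation unif := (uniform_prob (@ltr01 R)).

(** The real supremum is meaningful here because the set is nonempty and bounded by 1. *)
Lemma kolmogorov_dist_le (mu nu : probability mR R) e :
  (kolmogorov_dist mu nu <= e) <-> close e mu nu.
Proof.
have ub : ubound (range (fun a => `|cdf_of mu a - cdf_of nu a|)) 1.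
  move=> _ [a _ <-]; rewrite ler_norml.
  have := (cdf_of_ge0 mu a, cdf_of_le1 mu a, cdf_of_ge0 nu a, cdf_of_le1 nu a).
  move: (cdf_of mu a) (cdf_of nu a) => x y [[[x0 x1] y0] y1].
  by apply/andP; split; lra.
split=> [h a|h].
  by apply: le_trans h; apply: ub_le_sup; [exists 1|exists a].
by apply: ge_sup; [exists `|cdf_of mu 0 - cdf_of nu 0|, 0|move=> _ [a _ <-]; exact: h].
Qed.

Lemma close_le1 (mu nu : probability mR R) e : 1 <= e -> close e mu nu.
Proof.
move=> e1 a; have := (cdf_of_ge0 mu a, cdf_of_le1 mu a, cdf_of_ge0 nu a, cdf_of_le1 nu a).
move: (cdf_of mu a) (cdf_of nu a) => x y [[[x0 x1] y0] y1].
by rewrite ler_norml; apply/andP; split; lra.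
Qed.

Lemma close_weaken e e' (mu nu : probability mR R) : e <= e' -> close e mu nu -> close e' mu nu.
Proof. by move=> ee' h a; exact: le_trans (h a) ee'. Qed.

Lemma eq_kolmogorov_dist (mu nu mu' nu' : set mR -> \bar R) :
  (forall A, measurable A -> mu A = mu' A) -> (forall A, measurable A -> nu A = nu' A) ->
  kolmogorov_dist mu nu = kolmogorov_dist mu' nu'.
Proof.
move=> E E'; apply: (congr1 (fun f => sup (range f))).
by apply/funext => a; rewrite /cdf_of E// E'.
Qed.

Variables (rho : R) (sigma c : {posnum R}) (eta1 : probability mR R) (N : nat).
Local Notation Phi := (filter_step rho sigma c).
Local Notation nu := (eta_seq rho sigma c eta1).

Let p0 (w : nat -> 'I_N.+1 -> R * R) m := emp (particles rho sigma c eta1 w m.+1).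

(** Index n stands for time n + 1, and r >= 0 accounts for the value 0 from which the maxima
    start. *)
Lemma max_dist_le (w : nat -> 'I_N.+1 -> R * R) T r : 0 <= r ->
  Num.max
    (\big[Num.max/0]_(1 <= t < T.+1) kolmogorov_dist
       (eta_hatN rho sigma c eta1 w t) (eta_hat rho sigma c eta1 t))
    (\big[Num.max/0]_(1 <= t < T.+1) kolmogorov_dist
       (etaN rho sigma c eta1 w t) (eta_pred rho sigma c eta1 t)) <= r <->
  forall n, (n < T)%N ->
    close r (p0 w n) (nu n) /\ close r (update c (p0 w n)) (update c (nu n)).
Proof.
move=> r0.
have E1 n : kolmogorov_dist (eta_hatN rho sigma c eta1 w n.+1) (eta_hat rho sigma c eta1 n.+1) =
    kolmogorov_dist (update c (p0 w n)) (update c (nu n)).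
  apply: eq_kolmogorov_dist => A mA; last exact: eta_hat_update.
  exact: weighted_empirical_update.
have E2 n : kolmogorov_dist (etaN rho sigma c eta1 w n.+1) (eta_pred rho sigma c eta1 n.+1) =
    kolmogorov_dist (p0 w n) (nu n).
  apply: eq_kolmogorov_dist => A mA; last by rewrite eta_seq_pred.
  by rewrite /p0 empE.
rewrite ge_max !big_add1 !big_mkord.
split=> [/andP[/bigmax_leP[_ h1] /bigmax_leP[_ h2]] n nT|h].
  split; apply/kolmogorov_dist_le.
    by rewrite -E2; exact: (h2 (Ordinal nT)).
  by rewrite -E1; exact: (h1 (Ordinal nT)).
apply/andP; split; apply/bigmax_leP; split=> // i _.
  by rewrite E1; apply/kolmogorov_dist_le; have [] := h i (ltn_ord i).
by rewrite E2; apply/kolmogorov_dist_le; have [] := h i (ltn_ord i).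
Qed.

Context d (Omega : measurableType d) (P : probability Omega R).
Local Notation T := (N.+1.-tuple (mR * mR)%type).
Variable U : nat -> Omega -> T.
Hypothesis mU : forall t, measurable_fun setT (U t).
Let u (omega : Omega) (t : nat) (n : 'I_N.+1) := tnth (U t omega) n.
Hypothesis u01 : forall t n omega, (1 <= t)%N ->
  0 < (u omega t n).1 < 1 /\ 0 < (u omega t n).2 < 1.

Let mp n k : measurable_fun setT (fun w => particles rho sigma c eta1 (u w) n.+1 k : mR).
Proof. exact: measurable_random_particles. Qed.

Let mp0 n a : measurable_fun setT (fun w => cdf_of (p0 (u w) n) a).
Proof. exact: (measurable_empirical_cdf a (mp n)). Qed.

Lemma measurable_max_dist_le tmax r : 0 <= r ->
  measurable [set w | Num.max
    (\big[Num.max/0]_(1 <= t < tmax.+1) kolmogorov_dist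
       (eta_hatN rho sigma c eta1 (u w) t) (eta_hat rho sigma c eta1 t))
    (\big[Num.max/0]_(1 <= t < tmax.+1) kolmogorov_dist
       (etaN rho sigma c eta1 (u w) t) (eta_pred rho sigma c eta1 t)) <= r].
Proof.
move=> r0; rewrite (_ : [set w | _] = \bigcap_(n in [set n | (n < tmax)%N])
  ([set w | close r (p0 (u w) n) (nu n)] `&`
   [set w | close r (update c (p0 (u w) n)) (update c (nu n))])).
  apply: bigcap_measurableType => n _; apply: measurableI.
    by apply: measurable_close => a //; exact: mp0.
  apply: measurable_close => a //.
  exact: (measurable_empirical_update_cdf c a (mp n)).
apply/seteqP; split=> [w /= /(max_dist_le _ _ r0) h n /= nT|w /= h].
  by have [] := h n nT.
by apply/(max_dist_le _ _ r0) => n nT; have [] := h n nT.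
Qed.

Hypothesis indepU : independent_on P [set t | (1 <= t)%N] U.
Hypothesis indepu : forall t, (1 <= t)%N ->
  independent_on P [set: 'I_N.+1] (fun n omega => u omega t n).
Hypothesis lawu : forall t n (A : set (mR * mR)), (1 <= t)%N -> measurable A ->
  P ((fun omega => u omega t n) @^-1` A) = (unif \x unif)%E A.

Let local_error_exceeds (e : R) k : set Omega :=
  if k is k'.+1 then [set w | ~ close e (p0 (u w) k) (Phi (p0 (u w) k'))]
  else [set w | ~ close e (p0 (u w) 0) eta1].

(** The deviation eta of [weak_dkw] is set equal to the mesh 1 / m, so each local error is at most 2
    / m outside its exceptional event. *)
Lemma local_error_bound m tmax (A : set Omega) : (0 < m)%N -> measurable A ->
  (forall w, A w -> exists2 k, (k < tmax)%N & local_error_exceeds (m%:R^-1 + m%:R^-1) k w) ->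
  (P A <= (tmax%:R * (4 * m%:R * expR (- (3 / 8 * N.+1%:R * m%:R^-1 ^+ 2))))%:E)%E.
Proof.
move=> m0 mA hA.
have m01 : 0 < (m%:R^-1 : R) <= 1 by rewrite invr_gt0 ltr0n m0 invf_le1 ?ltr0n ?ler1n.
have mk k : measurable (local_error_exceeds (m%:R^-1 + m%:R^-1) k).
  case: k => [|k]; apply: measurableC; apply: measurable_close => a.
  - exact: mp0.
  - exact: measurable_cst.
  - exact: mp0.
  - exact: (measurable_filter_step_cdf rho sigma c a (mp k)).
apply: (@le_trans _ _ (\sum_(k < tmax) P (local_error_exceeds (m%:R^-1 + m%:R^-1)%R k))%E).
  apply: finite_union_bound => // w /hA[k kT h].
  by exists (Ordinal kT).
apply: (@le_trans _ _ (\sum_(k < tmax) (4 * m%:R * expR (- (3 / 8 * N.+1%:R * m%:R^-1 ^+ 2)))%:E)%E).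
  apply: lee_sum => k _; case: (nat_of_ord k) => [|k'].
    exact: initial_bound.
  exact: step_bound.
by rewrite sumEFin sumr_const card_ord lee_fin -[leLHS]mulr_natl.
Qed.

End assembly.

Theorem theorem1 (R : realType) (rho : R) (sigma c : {posnum R})
    (eta1 : probability (measurableTypeR R) R) :
  exists C1 : R, 0 < C1 /\
  forall (N : nat) (d : measure_display) (Omega : measurableType d)
    (P : probability Omega R)
    (U : nat -> {RV P >-> N.-tuple (measurableTypeR R * measurableTypeR R)%type}),
  let u (omega : Omega) (t : nat) (n : 'I_N) := tnth (U t omega) n in
  (1 <= N)%N ->
  (forall t n omega, (1 <= t)%N ->
     0 < (u omega t n).1 < 1 /\ 0 < (u omega t n).2 < 1) ->
  independent_on P [set t | (1 <= t)%N] (fun t omega => U t omega) ->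
  (forall t, (1 <= t)%N ->
     independent_on P [set: 'I_N] (fun n omega => u omega t n)) ->
  (forall t n (A : set (measurableTypeR R * measurableTypeR R)),
     (1 <= t)%N -> measurable A ->
     P ((fun omega => u omega t n) @^-1` A) =
       (uniform_prob (@ltr01 R) \x uniform_prob (@ltr01 R))%E A) ->
  forall (q : R) (T : nat), 0 < q < 1 -> (1 <= T)%N ->
  let E := [set omega : Omega |
    Num.max
      (\big[Num.max/0]_(1 <= t < T.+1) kolmogorov_dist
         (eta_hatN rho sigma c eta1 (u omega) t) (eta_hat rho sigma c eta1 t))
      (\big[Num.max/0]_(1 <= t < T.+1) kolmogorov_dist
         (etaN rho sigma c eta1 (u omega) t) (eta_pred rho sigma c eta1 t))
    <= C1 * Num.sqrt (delta N T q) * ln (1 + (Num.sqrt (delta N T q))^-1)] in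
  measurable E /\ ((1 - q)%:E <= P E)%E.
Proof.
have [k k0 kE] := riccati_root rho (gt0 sigma) (gt0 c).
have [C [e1 [C0 e10 stab]]] := filter_stability k0 kE eta1.
(* A local error 2 / m is at most 32 * r, which stability amplifies by C. When C1 * r < 1, the term
   32 / e1 gives 32 * r <= e1, and 16 gives 16 * r <= 1, hence s <= 1 by [rate_ge_half], as
   [grid_size] requires. *)
exists (16 + 32 / e1 + 32 * C); split.
  by rewrite addr_gt0 ?mulr_gt0// addr_gt0// divr_gt0.
case=> [//|N] d Omega P U u _ u01 indepU indepu lawu q T q01 T0 E.
have mU t : measurable_fun setT (U t) by exact: measurable_funPT.
set s := Num.sqrt (delta N.+1 T q).
have s0 : 0 < s by rewrite sqrtr_gt0 delta_gt0.
pose r := s * ln (1 + s^-1).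
have r0 : 0 < r := rate_gt0 s0.
pose C1 := 16 + 32 / e1 + 32 * C.
have C1r : C1 * s * ln (1 + s^-1) = C1 * r by rewrite mulrA.
have [hC hE1 h16] : [/\ 32 * C <= C1, 32 / e1 <= C1 & 16 <= C1].
  have : 0 < 32 / e1 by rewrite divr_gt0.
  by rewrite /C1; move: (32 / e1) C0 => y ? ?; split; lra.
have C1r0 : 0 <= C1 * r by rewrite mulr_ge0 ?(ltW r0)// (le_trans _ h16).
have mE : measurable E.
  by rewrite /E -/s -/C1 C1r; apply: measurable_max_dist_le.
split=> //.
have Eok w : E w <-> forall n, (n < T)%N ->
    close (C1 * r) (emp (particles rho sigma c eta1 (u w) n.+1)) (eta_seq rho sigma c eta1 n) /\
    close (C1 * r) (update c (emp (particles rho sigma c eta1 (u w) n.+1))) (update c (eta_seq rho sigma c eta1 n)).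
  by rewrite /E -/s -/C1 C1r; exact: max_dist_le.
have [q0 q1] := andP q01.
(* If C1 * r >= 1 the event is the whole space. *)
have [big|small] := leP 1 (C1 * r).
  rewrite (_ : E = setT) ?probability_setT ?lee_fin; first by rewrite lerBlDr lerDl ltW.
  by apply/seteqP; split=> // w _; apply/Eok => n _; split; exact: close_le1.
have s1 : s <= 1.
  rewrite leNgt; apply/negP => s1; have := rate_ge_half (ltW s1); rewrite -/r => h.
  have : 16 * r <= C1 * r by rewrite ler_wpM2r// ltW.
  by move: small h; lra.
have r16 : 16 * r <= 1.
  have : 16 * r <= C1 * r by rewrite ler_wpM2r// ltW.
  by move: small; lra.
have [m [m0 mr hm]] := grid_size q01 (isT : (1 <= N.+1)%N) T0 s1 r16.
have hnE : (P (~` E) <= q%:E)%E.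
  apply: le_trans (_ : (_ <= (T%:R * (4 * m%:R * expR (- (3 / 8 * N.+1%:R * m%:R^-1 ^+ 2))))%:E)%E) _; last by rewrite lee_fin.
  apply: (local_error_bound (rho := rho) (sigma := sigma) (c := c) (eta1 := eta1) mU u01) => //; first exact: measurableC.
  (* If none of the T local errors exceeds 2 / m, the deterministic stability theorem puts w into
     E. *)
  move=> w nE; apply: contrapT => h; apply: nE; apply/Eok => n nT.
  have e32 : m%:R^-1 + m%:R^-1 <= 32 * r.
    by move: mr; rewrite -/s -/r; lra.
  have e1r : 32 * r <= e1.
    have : 32 / e1 * r <= 1 by rewrite (le_trans _ (ltW small))// ler_wpM2r// ltW.
    by rewrite mulrAC ler_pdivrMr// mul1r.
  have cl : C * (32 * r) <= C1 * r.
    by rewrite mulrA [C * _]mulrC ler_wpM2r// ltW.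
  have [] := stab (fun j => emp (particles rho sigma c eta1 (u w) j.+1)) (eta_seq rho sigma c eta1) (32 * r) n.
  - by [].
  - by move=> j A mA; exact: eta_seqS.
  - by rewrite mulr_ge0// ltW.
  - by [].
  - apply: close_weaken e32 _; apply: contrapT => hc; apply: h; exists 0%N.
    + exact: leq_ltn_trans nT.
    + exact: hc.
  - move=> j jn; apply: close_weaken e32 _; apply: contrapT => hc; apply: h; exists j.+1.
    + exact: leq_ltn_trans jn nT.
    + exact: hc.
  - by move=> h1 h2; split; exact: close_weaken cl _.
have := probability_setC P mE => hPE.
have : (P E = 1 - P (~` E))%E by rewrite -probability_setC ?setCK//; exact: measurableC.
by move=> ->; rewrite EFinB leeB.
Qed.
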